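(* Let $1<q\le p\le q'<\infty$, $\gamma\in[1,\infty)$, $m\in\mathbb{R}$, $0<\rho\le1$, and $a(\xi)=e^{i|\xi|^{1-\rho}}|\xi|^m$ on $\mathbb{R}^n$. If $a(D)$ is bounded from $L^q(|\cdot|^{qs})$ to $L^p(|\cdot|^{ps})$ for every $s\in(-n/\gamma,0)$, then $$m\le-n(1-\rho)\left(\frac12-\frac1p\right)-\rho n\left(\frac1q-\frac1p\right)-\frac{n(1-\rho)}{\gamma}.$$ In particular, if for some $r\in[1,q)$ the operator $a(D)$ is bounded from $L^q(\omega^q)$ to $L^p(\omega^p)$ for every weight $\omega$ with $\omega^q\in RH_{(p/q)(r'/p)'}$, then $$m\le-n(1-\rho)\left(\frac1r-\frac12\right)-\rho n\left(\frac1q-\frac1p\right).$$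
   Context: $a(D)f(x)=(2\pi)^{-n}\int_{\mathbb{R}^n}e^{ix\cdot\xi}a(\xi)\hat f(\xi)\,d\xi$; boundedness from $L^q(v)$ to $L^p(w)$ means $\|a(D)f\|_{L^p(w)}\le C\|f\|_{L^q(v)}$ for all Schwartz $f$ with $a\hat f$ integrable, with $C$ independent of $f$ (but possibly depending on the weight). $\|f\|_{L^p(w)}=(\int|f|^pw\,dx)^{1/p}$. A weight is a nonnegative locally integrable function. For $1<t<\infty$, $w\in RH_t$ means $\sup_Q\left(\frac1{|Q|}\int_Qw\right)^{-1}\left(\frac1{|Q|}\int_Qw^t\right)^{1/t}<\infty$, supremum over all cubes; $RH_1$ imposes no condition. $t'$ denotes the conjugate exponent of $t$. *)

(* Defs.v *)
From HB Require Import structures.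
From mathcomp Require Import all_boot all_order all_algebra.
From mathcomp Require Import complex.
From mathcomp Require Import all_classical all_reals all_analysis.

Set Implicit Arguments.
Unset Strict Implicit.
Unset Printing Implicit Defensive.
Import Order.TTheory GRing.Theory Num.Theory.
Import numFieldNormedType.Exports.

Local Open Scope classical_set_scope.
Local Open Scope ring_scope.
Local Open Scope complex_scope.

(* The sigma-algebra on row vectors generated by the coordinates; it is declared
   in the same way as the library's instance on tuples. *)
Section measurable_rV.
Context {d : measure_display} {T : measurableType d}.
Variable n : nat.

Definition rV_coord (i : 'I_n) (x : 'rV[T]_n) : T := x ord0 i.

Let rV_set0 : g_sigma_preimage rV_coord set0.
Proof. exact: sigma_algebra0. Qed.

Let rV_setC A : g_sigma_preimage rV_coord A -> g_sigma_preimage rV_coord (~` A).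
Proof. exact: sigma_algebraC. Qed.

Let rV_bigcup (F : _^nat) : (forall i, g_sigma_preimage rV_coord (F i)) ->
  g_sigma_preimage rV_coord (\bigcup_i (F i)).
Proof. exact: sigma_algebra_bigcup. Qed.

HB.instance Definition _ := @isMeasurable.Build (measure_tuple_display d)
  'rV[T]_n (g_sigma_preimage rV_coord) rV_set0 rV_setC rV_bigcup.

Lemma measurable_rV_coord (i : 'I_n) : measurable_fun setT (rV_coord i).
Proof.
move=> _ Y mY; rewrite setTI; apply: sub_sigma_algebra => /=.
rewrite -bigcup_seq/=; exists i => /=; first by rewrite mem_index_enum.
by exists Y => //; rewrite setTI.
Qed.

Lemma measurable_fun_rV d' (X : measurableType d') (f : X -> 'rV[T]_n) :
  (forall i, measurable_fun setT (rV_coord i \o f)) -> measurable_fun setT f.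
Proof.
move=> mf.
have H : g_sigma_preimage (fun i => rV_coord i \o f) `<=` measurable.
  apply: smallest_sub; first exact: sigma_algebra_measurable.
  rewrite -bigcup_seq; apply: bigcup_sub => i _ A [B mB <-]; exact: mf.
rewrite g_sigma_preimage_comp in H.
by move=> _ A mA; apply: H; exists A.
Qed.

End measurable_rV.

Section lebesgue_rV.
Context {R : realType}.

Definition rV_cons (n : nat) (xy : R * 'rV[R]_n) : 'rV[R]_n.+1 :=
  \row_i (if unlift ord0 i is Some j then xy.2 ord0 j else xy.1).

Definition rV_uncons (n : nat) (x : 'rV[R]_n.+1) : R * 'rV[R]_n :=
  (x ord0 ord0, \row_i x ord0 (lift ord0 i)).

Lemma rV_consK n : cancel (@rV_cons n) (@rV_uncons n).
Proof.
move=> [x y]; rewrite /rV_uncons mxE unlift_none; congr pair.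
by apply/rowP => i; rewrite !mxE liftK.
Qed.

Lemma measurable_rV_cons n : measurable_fun setT (@rV_cons n).
Proof.
apply: measurable_fun_rV => i.
case: (unliftP ord0 i) => [j|] ->.
- rewrite (_ : _ \o _ = rV_coord j \o snd); last first.
    by apply/funext => xy /=; rewrite /rV_coord mxE liftK.
  by apply: measurableT_comp => //; exact: measurable_rV_coord.
- rewrite (_ : _ \o _ = fst) //.
  by apply/funext => xy /=; rewrite /rV_coord mxE unlift_none.
Qed.

Lemma measurable_rV_uncons n : measurable_fun setT (@rV_uncons n).
Proof.
apply/measurable_fun_pairP; split; first exact: measurable_rV_coord.
apply: measurable_fun_rV => i.
rewrite (_ : _ \o _ = rV_coord (lift ord0 i)).
  exact: measurable_rV_coord.
by apply/funext => x; rewrite /rV_coord/= mxE.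
Qed.

Section step.
Variables (n : nat) (m : {sigma_finite_measure set 'rV[R]_n -> \bar R}).
Local Open Scope ereal_scope.

Definition lebesgue_rV_step : set 'rV[R]_n.+1 -> \bar R :=
  pushforward (@lebesgue_measure R \x m) (@rV_cons n).

Let step0 : lebesgue_rV_step set0 = 0.
Proof. by rewrite /lebesgue_rV_step /pushforward preimage_set0 measure0. Qed.

Let step_ge0 A : 0 <= lebesgue_rV_step A.
Proof. exact: (measure_ge0 (@lebesgue_measure R \x m)). Qed.

Let step_sigma_additive : semi_sigma_additive lebesgue_rV_step.
Proof.
move=> F mF tF mUF; rewrite /lebesgue_rV_step /pushforward preimage_bigcup.
apply: measure_semi_sigma_additive.
- by move=> k; rewrite -[X in measurable X]setTI; exact: measurable_rV_cons.
- apply/trivIsetP => /= i j _ _ ij; rewrite -preimage_setI.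
  by move/trivIsetP : tF => /(_ _ _ _ _ ij) ->//; rewrite preimage_set0.
- rewrite -preimage_bigcup -[X in measurable X]setTI.
  exact: measurable_rV_cons.
Qed.

HB.instance Definition _ := isMeasure.Build _ _ _ lebesgue_rV_step
  step0 step_ge0 step_sigma_additive.

Let prod_sigma_finite : sigma_finite setT (@lebesgue_measure R \x m).
Proof.
have /sigma_finiteP[F [TF ndF Foo]] := sigma_finiteT (@lebesgue_measure R).
have /sigma_finiteP[G [TG ndG Goo]] := sigma_finiteT m.
exists (fun k => F k `*` G k).
  rewrite -setXTT TF TG predeqE => -[x y]; split.
    move=> [/= [k _ Fkx] [l _ Gly]]; exists (maxn k l) => //; split.
    - by move: x Fkx; exact/subsetPset/ndF/leq_maxl.
    - by move: y Gly; exact/subsetPset/ndG/leq_maxr.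
  by move=> [k _ []/= ? ?]; split; exists k.
move=> k; have [? ?] := Foo k; have [? ?] := Goo k.
split; first exact: measurableX.
by rewrite product_measure1E// lte_mul_pinfty// ge0_fin_numE.
Qed.

Let step_sigma_finite : sigma_finite setT lebesgue_rV_step.
Proof.
have [F UF Foo] := prod_sigma_finite.
exists (fun k => @rV_uncons n @^-1` F k).
  by rewrite -preimage_bigcup -UF preimage_setT.
move=> k; have [mF Fk] := Foo k; split.
  by rewrite -[X in measurable X]setTI; exact: measurable_rV_uncons.
rewrite /lebesgue_rV_step /pushforward -comp_preimage.
by rewrite (_ : _ \o _ = id) //; apply/funext => x; exact: rV_consK.
Qed.

HB.instance Definition _ := Measure_isSigmaFinite.Build _ _ _ lebesgue_rV_step
  step_sigma_finite.

End step.

(* Lebesgue measure on R^n: a unit point mass on R^0, and the product measure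
   transported along R * R^n = R^(n+1). *)
Fixpoint lebesgue_rV (n : nat) : {sigma_finite_measure set 'rV[R]_n -> \bar R} :=
  match n with
  | 0 => \d_(0 : 'rV[R]_0)
  | n'.+1 => lebesgue_rV_step (lebesgue_rV n')
  end.

End lebesgue_rV.

Arguments lebesgue_rV : clear implicits.

Section complex_integral.
Context {d : measure_display} {T : measurableType d} {R : realType}.
Variable mu : {measure set T -> \bar R}.

Definition cintegrable (f : T -> R[i]) : Prop :=
  mu.-integrable setT (fun x => (complex.Re (f x))%:E) /\
  mu.-integrable setT (fun x => (complex.Im (f x))%:E).

Definition cintegral (f : T -> R[i]) : R[i] :=
  (\int[mu]_x complex.Re (f x)) +i* (\int[mu]_x complex.Im (f x)).

End complex_integral.

Section euclidean.
Context {R : realType} {n : nat}.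
Implicit Types (x y : 'rV[R]_n) (f : 'rV[R]_n -> R[i]) (g : 'rV[R]_n -> R).

Definition cexpi (t : R) : R[i] := cos t +i* sin t.

Definition dot x y : R := \sum_(i < n) x ord0 i * y ord0 i.

(* The norm of 'rV[R]_n in the library is the sup norm. *)
Definition enorm x : R := Num.sqrt (dot x x).

Definition iter_partial (s : seq 'I_n) g : 'rV[R]_n -> R :=
  foldr (fun i h => 'D_(delta_mx ord0 i) h) g s.

Definition real_schwartz g : Prop :=
  forall s : seq 'I_n,
    (forall x, differentiable (iter_partial s g) x) /\
    (forall alpha : 'I_n -> nat, exists M : R, forall x,
      `|(\prod_(i < n) x ord0 i ^+ alpha i) * iter_partial s g x| <= M).

Definition schwartz f : Prop :=
  real_schwartz (fun x => complex.Re (f x)) /\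
  real_schwartz (fun x => complex.Im (f x)).

Definition fourier f (xi : 'rV[R]_n) : R[i] :=
  cintegral (lebesgue_rV R n) (fun x => cexpi (- dot x xi) * f x).

Definition multiplier_op (a f : 'rV[R]_n -> R[i]) x : R[i] :=
  ((2 * pi) ^- n)%:C *
  cintegral (lebesgue_rV R n)
    (fun xi => cexpi (dot x xi) * (a xi * fourier f xi)).

Definition weighted_norm (p : R) (w : 'rV[R]_n -> R) f : \bar R :=
  ((\int[lebesgue_rV R n]_x (Normc.normc (f x) `^ p * w x)%:E) `^ p^-1)%E.

Definition multiplier_bounded (a : 'rV[R]_n -> R[i])
    (q : R) (v : 'rV[R]_n -> R) (p : R) (w : 'rV[R]_n -> R) : Prop :=
  exists C : R, 0 < C /\
    forall f, schwartz f ->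
      cintegrable (lebesgue_rV R n) (fun xi => a xi * fourier f xi) ->
      (weighted_norm p w (multiplier_op a f) <= C%:E * weighted_norm q v f)%E.

Definition weight (w : 'rV[R]_n -> R) : Prop :=
  [/\ measurable_fun setT w,
      (forall x, 0 <= w x) &
      forall K : set 'rV[R]_n, compact K ->
        (\int[lebesgue_rV R n]_(x in K) (w x)%:E < +oo)%E].

Definition cube (c : 'rV[R]_n) (l : R) : set 'rV[R]_n :=
  [set x | forall i, c ord0 i <= x ord0 i <= c ord0 i + l].

Definition average (Q : set 'rV[R]_n) (w : 'rV[R]_n -> R) : \bar R :=
  ((lebesgue_rV R n Q)^-1 * \int[lebesgue_rV R n]_(x in Q) (w x)%:E)%E.

(* If w vanishes almost everywhere on Q, this is +oo * 0 = 0, so such a cube does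
   not contribute to the supremum below. *)
Definition reverse_holder_quotient (t : R) w (Q : set 'rV[R]_n) : \bar R :=
  ((average Q w)^-1 * (average Q (fun x => w x `^ t)%R) `^ t^-1)%E.

Definition reverse_holder (t : R) (w : 'rV[R]_n -> R) : Prop :=
  weight w /\
  (1 < t ->
   (ereal_sup [set reverse_holder_quotient t w (cube cl.1 cl.2)
              | cl in [set cl : 'rV[R]_n * R | (0 < cl.2)%R]] < +oo)%E).

(* The value at the origin is irrelevant: it concerns a null set. *)
Definition oscillating_symbol (rho m : R) (xi : 'rV[R]_n) : R[i] :=
  cexpi (enorm xi `^ (1 - rho)) * (enorm xi `^ m)%:C.

End euclidean.

(* Main.v *)
(* Boundedness is tested on explicit sums of Gaussian wave packets, whose Fourier
   transforms are again Gaussian.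

   High frequencies (rho < 1, m > -n).  Take the packets at the lattice points
   delta * kappa, kappa in [L, 2L)^n, with phases cancelling
   |delta * kappa|^(1 - rho), and delta^(1 - rho) = L^rho.  Then a(D) f is at least
   c delta^m L^(m + n) on a ball of radius comparable to 1 / (delta L), whereas
   Schur's test and |P|^q <= A^q + A^(q - 2) |P|^2 with A = L^(n / 2) bound the
   L^q(|x|^(q s)) norm of f by C delta^(- n / q - s) L^(n / 2).  Letting L tend to
   infinity and then s to - n / gamma gives the bound on m.

   Low frequencies.  A single packet at frequency scale delta, tested on boxes
   shrinking to the origin, shows that boundedness for some s < - n / p is impossible
   when rho < 1; with delta tending to infinity it yields the bound when rho = 1.
   In the remaining cases with m <= -n the bound is at least -n.

   For the second part, |x|^(q s) with s in (- n / gamma, 0) belongs to the reverse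
   Hoelder class of exponent gamma / q, where 1 / gamma = 1 / p - 1 / r', and the
   first part applies. *)
Require Import Defs.
From HB Require Import structures.
From mathcomp Require Import all_boot all_order all_algebra.
From mathcomp Require Import complex.
From mathcomp Require Import all_classical all_reals all_analysis.
From mathcomp Require Import measurable_realfun.
From mathcomp Require Import ring lra.

Set Implicit Arguments.
Unset Strict Implicit.
Unset Printing Implicit Defensive.
Import Order.TTheory GRing.Theory Num.Theory.
Import numFieldNormedType.Exports.

Local Open Scope classical_set_scope.
Local Open Scope ring_scope.

(** * Integration on R^n *)

(** The weight [|x|^(q s)] may fail to be integrable at the origin, so plain Gaussian packets could
    have infinite norm. The packets therefore carry the envelope [g (1 - g)^n], [g] a Gaussian,
    which vanishes to order [2 n] at the origin, and the operator has to move mass there. It does: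
    for a packet of scale [delta] at frequency [delta * kappa], the gradient of the phase of the
    symbol displaces the envelope by about [delta^(1 - rho) * |kappa|^(- rho)] in units of
    [1 / delta]. The coupling [delta^(1 - rho) = L^rho] makes this displacement comparable to 1,
    where the envelope is bounded below, while the second-order term of the phase has size [1 / L]
    and disappears in the limit. The condition [m > -n] keeps [|xi|^m] integrable at frequency zero,
    which the Gaussian tails reach. At low frequency the same profile is used on the Fourier side,
    where its zero absorbs [|xi|^m] for every real [m]. *)

Section integral_rV.
Context {R : realType}.
Local Notation leb := (@lebesgue_measure R).

Section pointwise.
Local Open Scope ereal_scope.

(* [f] need not be measurable: measurability of a multiplier operator's output
   is never established. *)
Lemma le_ge0_integral d (T : measurableType d) (mu : {measure set T -> \bar R})
  (f g : T -> \bar R) :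
  (forall x, 0 <= f x) -> (forall x, f x <= g x) ->
  \int[mu]_x f x <= \int[mu]_x g x.
Proof.
move=> f0 fg.
have g0 x : 0 <= g x by apply: le_trans (fg x).
rewrite !ge0_integralTE//; apply: le_ereal_sup => _ [h hf <-].
by exists h => // x; exact: le_trans (hf x) (fg x).
Qed.

Lemma ge0_integral_rVS n (f : 'rV[R]_n.+1 -> \bar R) :
  measurable_fun setT f -> (forall x, 0 <= f x) ->
  \int[lebesgue_rV R n.+1]_x f x =
  \int[leb]_t \int[lebesgue_rV R n]_y f (rV_cons (t, y)).
Proof.
move=> mf f0.
transitivity (\int[pushforward (leb \x lebesgue_rV R n) (@rV_cons R n)]_x f x).
  by [].
rewrite ge0_integral_pushforward//; last exact: measurable_rV_cons.
rewrite preimage_setT fubini_tonelli1//=.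
by apply: measurableT_comp => //; exact: measurable_rV_cons.
Qed.

Lemma integral_rVS n (f : 'rV[R]_n.+1 -> \bar R) :
  (lebesgue_rV R n.+1).-integrable setT f ->
  \int[lebesgue_rV R n.+1]_x f x =
  \int[leb]_t \int[lebesgue_rV R n]_y f (rV_cons (t, y)).
Proof.
move=> intf; have mf := measurable_int _ intf.
have mcf : measurable_fun setT (f \o @rV_cons R n).
  by apply: measurableT_comp => //; exact: measurable_rV_cons.
have ic : (leb \x lebesgue_rV R n).-integrable setT (f \o @rV_cons R n).
  apply/integrableP; split => //.
  case/integrableP : intf => _; apply: le_lt_trans.
  rewrite ge0_integral_rVS//; last exact: measurableT_comp.
  by rewrite fubini_tonelli1//; exact: measurableT_comp.
transitivity (\int[pushforward (leb \x lebesgue_rV R n) (@rV_cons R n)]_x f x).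
  by [].
rewrite integral_pushforward//; last exact: measurable_rV_cons.
by rewrite preimage_setT -(integral12_prod_meas1 ic).
Qed.

Lemma ge0_integral_rV0 (f : 'rV[R]_0 -> \bar R) : measurable_fun setT f ->
  \int[lebesgue_rV R 0]_x f x = f 0%R.
Proof.
by move=> mf; rewrite /= integral_dirac// diracT mul1e.
Qed.

Section substitution.
Context d (T : measurableType d) (mu : {measure set T -> \bar R}).
Variables (phi : T -> T) (k : R).
Hypothesis k0 : (0 <= k)%R.
Hypothesis mphi : measurable_fun setT phi.
Hypothesis phiE : forall f : T -> \bar R, measurable_fun setT f ->
  (forall x, 0 <= f x) -> \int[mu]_x f (phi x) = k%:E * \int[mu]_x f x.

(** Changes of variables are established for nonnegative functions; applied to the modulus and to
    the positive and negative parts, [phiE] then yields the integrable case formally. *)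
Lemma integrable_subst (f : T -> \bar R) :
  mu.-integrable setT f -> mu.-integrable setT (fun x => f (phi x)).
Proof.
move=> /integrableP[mf foo]; apply/integrableP; split.
  exact: measurableT_comp mf mphi.
have maf : measurable_fun setT (abse \o f) by exact: measurableT_comp.
have := phiE maf (fun x => abse_ge0 (f x)).
by move=> /= ->; rewrite lte_mul_pinfty.
Qed.

Lemma integral_subst (f : T -> \bar R) : mu.-integrable setT f ->
  \int[mu]_x f (phi x) = k%:E * \int[mu]_x f x.
Proof.
move=> intf; have mf := measurable_int _ intf.
rewrite integralE [in RHS]integralE.
under eq_integral do rewrite (funepos_comp f).
under [X in _ - X]eq_integral do rewrite (funeneg_comp f).
rewrite (phiE (measurable_funepos mf))// (phiE (measurable_funeneg mf))//.
by rewrite [RHS]muleBr//; exact: integrable_add_def.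
Qed.

Lemma Rintegral_subst (f : T -> R) : mu.-integrable setT (EFin \o f) ->
  (\int[mu]_x f (phi x) = k * \int[mu]_x f x)%R.
Proof.
move=> intf; rewrite /Rintegral (integral_subst intf) fineM//.
exact: integrable_fin_num.
Qed.

End substitution.

Lemma ge0_integral_affine (d b : R) (f : R -> \bar R) : (0 < d)%R ->
  measurable_fun setT f -> (forall t, 0 <= f t) ->
  \int[leb]_t f (d * t + b)%R = d^-1%:E * \int[leb]_t f t.
Proof.
move=> d0 mf f0.
pose phi : measurableTypeR R -> measurableTypeR R := fun t => (d * t + b)%R.
have mphi : measurable_fun setT phi.
  by apply: measurable_funD => //; exact: measurable_funM.
have di0 : (0 <= d^-1)%R by rewrite invr_ge0 ltW.
transitivity (\int[pushforward leb phi]_t f t).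
  by rewrite ge0_integral_pushforward// preimage_setT.
pose k : {nonneg R} := NngNum (ltW d0).
(* [d] times the image of Lebesgue measure under [phi] gives []x, y]] the mass [y - x]; uniqueness
   of Lebesgue measure identifies the two. *)
have pE A : measurable A -> leb A = mscale k (pushforward leb phi) A.
  apply: lebesgue_measure_unique => _ [[x y]] _ <-.
  rewrite /= /mscale /= /pushforward.
  have -> : phi @^-1` `]x, y] = `]((x - b) / d)%R, ((y - b) / d)%R]%classic.
    apply/seteqP; split => t /=; rewrite /phi !in_itv/=;
      by rewrite ltr_pdivrMr// ler_pdivlMr// ltrBlDr lerBrDr mulrC.
  rewrite !lebesgue_measure_itv/= !lte_fin ltr_pM2r ?invr_gt0//.
  rewrite ltrD2r; case: ifPn => // _; last by rewrite mule0.
  rewrite -!EFinB -EFinM; congr EFin.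
  by field; rewrite gt_eqF.
have -> : \int[leb]_t f t = d%:E * \int[pushforward leb phi]_t f t.
  rewrite (eq_measure_integral (mscale k (pushforward leb phi))).
    by rewrite ge0_integral_mscale.
  by move=> A mA _; exact: pE.
by rewrite muleA -EFinM mulVf ?gt_eqF// mul1e.
Qed.

(** The map acts separately on the first coordinate and on the others, which carries the change of
    variables by induction on the dimension. *)
Lemma rV_consZD n (d : R) (b : 'rV[R]_n.+1) (t : R) (y : 'rV[R]_n) :
  (d *: rV_cons (t, y) + b =
   rV_cons (d * t + (rV_uncons b).1, d *: y + (rV_uncons b).2))%R.
Proof.
apply/rowP => i; rewrite !mxE.
by case: (unliftP ord0 i) => [j|] -> /=; rewrite ?mxE.
Qed.

Lemma measurable_rV_affine n (d : R) (b : 'rV[R]_n) :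
  measurable_fun setT (fun x : 'rV[R]_n => d *: x + b)%R.
Proof.
apply: measurable_fun_rV => i.
rewrite (_ : _ \o _ = fun x => d * rV_coord i x + b ord0 i)%R; last first.
  by apply/funext => x; rewrite /rV_coord/= !mxE.
apply: measurable_funD => //; apply: measurable_funM => //.
exact: measurable_rV_coord.
Qed.

Lemma ge0_integral_rV_affine n (d : R) (b : 'rV[R]_n) (f : 'rV[R]_n -> \bar R) :
  (0 < d)%R -> measurable_fun setT f -> (forall x, 0 <= f x) ->
  \int[lebesgue_rV R n]_x f (d *: x + b)%R =
  (d ^- n)%:E * \int[lebesgue_rV R n]_x f x.
Proof.
move=> d0; elim: n b f => [|n IH] b f mf f0.
  rewrite !ge0_integral_rV0//; last first.
    by apply: (measurableT_comp mf); exact: measurable_rV_affine.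
  by rewrite expr0 invr1 mul1e; congr f; apply/rowP => -[].
rewrite ge0_integral_rVS//; last first.
  by apply: (measurableT_comp mf); exact: measurable_rV_affine.
rewrite ge0_integral_rVS//.
have mfc : measurable_fun setT (f \o @rV_cons R n).
  by apply: measurableT_comp => //; exact: measurable_rV_cons.
have mfc1 s : measurable_fun setT (fun y => f (rV_cons (s, y))).
  exact: (measurableT_comp mfc (pair1_measurable s)).
under eq_integral => t _.
  under eq_integral do rewrite rV_consZD.
  rewrite (IH (rV_uncons b).2 (fun y => f (rV_cons (d * t + (rV_uncons b).1, y))%R))//.
  over.
pose g s := \int[lebesgue_rV R n]_y f (rV_cons (s, y)).
have mg : measurable_fun setT g.
  apply: (measurable_fun_fubini_tonelli_F (m2 := lebesgue_rV R n)
    (f \o @rV_cons R n)) => //=.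
have g0 s : 0 <= g s by exact: integral_ge0.
have di0 : (0 <= d ^- n)%R by rewrite invr_ge0 exprn_ge0 ?ltW.
have maff : measurable_fun setT (fun t : R => d * t + (rV_uncons b).1)%R.
  by apply: measurable_funD => //; exact: measurable_funM.
rewrite ge0_integralZl//; [|exact: (measurableT_comp mg maff)|by move=> *; exact: g0].
rewrite (ge0_integral_affine _ d0 mg)//.
by rewrite muleA -EFinM exprS invfM mulrC.
Qed.

Lemma integrable_rV_affine n (d : R) (b : 'rV[R]_n) (f : 'rV[R]_n -> \bar R) :
  (0 < d)%R -> (lebesgue_rV R n).-integrable setT f ->
  (lebesgue_rV R n).-integrable setT (fun x => f (d *: x + b)%R).
Proof.
move=> d0.
have k0 : (0 <= (d ^- n))%R by rewrite invr_ge0 exprn_ge0 ?ltW.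
have mphi : measurable_fun setT (fun x : 'rV[R]_n => d *: x + b)%R
  by exact: measurable_rV_affine.
exact: (integrable_subst k0 mphi (fun g => @ge0_integral_rV_affine n d b g d0)).
Qed.

Lemma Rintegral_rV_affine n (d : R) (b : 'rV[R]_n) (f : 'rV[R]_n -> R) :
  (0 < d)%R -> (lebesgue_rV R n).-integrable setT (EFin \o f) ->
  (\int[lebesgue_rV R n]_x f (d *: x + b)
   = d ^- n * \int[lebesgue_rV R n]_x f x)%R.
Proof.
move=> d0.
by move=> fi; rewrite -(Rintegral_subst (fun g => @ge0_integral_rV_affine n d b g d0) fi).
Qed.

Lemma integrable_affine (d b : R) (f : R -> \bar R) :
  (0 < d)%R -> leb.-integrable setT f ->
  leb.-integrable setT (fun t => f (d * t + b)%R).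
Proof.
move=> d0.
have k0 : (0 <= d^-1)%R by rewrite invr_ge0 ltW.
have mphi : measurable_fun setT (fun t : measurableTypeR R => d * t + b)%R
  by apply: measurable_funD => //; exact: measurable_funM.
exact: (integrable_subst k0 mphi (fun g => @ge0_integral_affine d b g d0)).
Qed.

Lemma Rintegral_affine (d b : R) (f : R -> R) :
  (0 < d)%R -> leb.-integrable setT (EFin \o f) ->
  (\int[leb]_t f (d * t + b) = d^-1 * \int[leb]_t f t)%R.
Proof.
move=> d0.
exact: (@Rintegral_subst _ (measurableTypeR R) leb
  (fun t => d * t + b)%R d^-1 (fun g => @ge0_integral_affine d b g d0)).
Qed.

Lemma ge0_integral_rV_prod n (g : 'I_n -> R -> R) (C : 'I_n -> R) :
  (forall i, measurable_fun setT (g i)) -> (forall i t, 0 <= g i t)%R ->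
  (forall i, \int[leb]_t (g i t)%:E = (C i)%:E) ->
  \int[lebesgue_rV R n]_x (\prod_i g i (x ord0 i))%:E = (\prod_i C i)%:E.
Proof.
have mprod k (h : 'I_k -> R -> R) : (forall i, measurable_fun setT (h i)) ->
    measurable_fun setT (fun x : 'rV[R]_k => (\prod_i h i (x ord0 i))%:E).
  move=> mh; apply/measurable_EFinP; apply: measurable_prod => i _.
  by apply: (measurableT_comp (mh i)); exact: measurable_rV_coord.
elim: n g C => [|n IH] g C mg g0 gC.
  by rewrite ge0_integral_rV0 ?big_ord0//; exact: mprod.
rewrite ge0_integral_rVS//; [|exact: mprod|]; last first.
  by move=> x; rewrite lee_fin; apply: prodr_ge0.
under eq_integral => t _.
  under eq_integral => y _.
    rewrite big_ord_recl mxE unlift_none/=.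
    under eq_bigr do rewrite mxE liftK/=.
    rewrite EFinM.
    over.
  rewrite ge0_integralZl//; last 3 first.
    exact: (mprod _ (fun i => g (lift ord0 i))).
    by move=> y _; rewrite lee_fin; apply: prodr_ge0.
    by rewrite lee_fin.
  rewrite (IH (fun i => g (lift ord0 i)) (fun i => C (lift ord0 i)))//.
  over.
have C0 i : (0 <= C i)%R by rewrite -lee_fin -gC; apply: integral_ge0 => t _; rewrite lee_fin.
rewrite ge0_integralZr//; last 3 first.
  by apply/measurable_EFinP; exact: mg.
  by move=> t _; rewrite lee_fin.
  by rewrite lee_fin; apply: prodr_ge0.
by rewrite gC -EFinM big_ord_recl.
Qed.

End pointwise.
End integral_rV.

(** * Gaussian integrals *)

Section gauss1.
Context {R : realType}.
Local Notation leb := (@lebesgue_measure R).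
Implicit Types (s t y c : R).

(** The parameter is an inverse variance: the Fourier transform has parameter [s^-1], and a dilation
    by [a] multiplies the parameter by [a ^+ 2]. *)
Definition gauss s t : R := expR (- (s / 2 * t ^+ 2)).

Lemma measurable_gauss s : measurable_fun setT (gauss s).
Proof.
apply: measurableT_comp => //; apply: measurableT_comp => //.
by apply: measurable_funM => //; exact: measurable_funX.
Qed.

Lemma gaussE s t : 0 < s -> gauss s t = normal_fun 0 (Num.sqrt s^-1) t.
Proof.
move=> s0; rewrite /gauss /normal_fun subr0 sqr_sqrtr ?invr_ge0 ?ltW//.
by congr expR; rewrite -mulr_natr; field; rewrite gt_eqF.
Qed.

Lemma integrable_gauss s : 0 < s -> leb.-integrable setT (EFin \o gauss s).
Proof.
move=> s0.
have s0' : Num.sqrt s^-1 != 0 by rewrite gt_eqF// sqrtr_gt0 invr_gt0.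
have := integrable_normal_pdf 0 (Num.sqrt s^-1).
move=> /(integrableZl measurableT (normal_peak (Num.sqrt s^-1))^-1).
apply: eq_integrable => // t _.
rewrite /normal_pdf (negbTE s0') -EFinM mulrA mulVf ?mul1r; last first.
  by rewrite gt_eqF// normal_peak_gt0.
by rewrite /= gaussE.
Qed.

Lemma Rintegral_gauss s : 0 < s ->
  \int[leb]_t gauss s t = Num.sqrt (2 * pi / s).
Proof.
move=> s0.
have s0' : Num.sqrt s^-1 != 0 by rewrite gt_eqF// sqrtr_gt0 invr_gt0.
have p0 : normal_peak (Num.sqrt s^-1) != 0 by rewrite gt_eqF// normal_peak_gt0.
have := integral_normal_pdf 0 (Num.sqrt s^-1).
under eq_integral.
  move=> t _; rewrite /normal_pdf (negbTE s0') -gaussE// EFinM; over.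
rewrite integralZl//; last exact: integrable_gauss.
rewrite -(fineK (integrable_fin_num measurableT (integrable_gauss s0))) -EFinM.
case=> /(canRL (mulKf p0)) => H.
rewrite /Rintegral [LHS]H mulr1 /normal_peak invrK sqr_sqrtr ?invr_ge0 ?ltW//.
by congr Num.sqrt; rewrite -mulr_natr; ring.
Qed.

(** [|t| <= s^-1 + s / 4 * t ^+ 2] is a completed square, and the right side is at most [s^-1 + 1]
    times [expR (s / 4 * t ^+ 2)], which is paid for by half of the Gaussian. *)
Lemma normr_gauss_le s t : 0 < s -> `|t| * gauss s t <= (s^-1 + 1) * gauss (s / 2) t.
Proof.
move=> s0.
have -> : gauss s t = gauss (s / 2) t * gauss (s / 2) t.
  by rewrite /gauss -expRD; congr expR; field.
rewrite mulrA ler_wpM2r ?expR_ge0// {1}/gauss expRN ler_pdivrMr ?expR_gt0//.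
have := expR_ge1Dx (s / 2 / 2 * t ^+ 2); set e := expR _ => He.
have ti : `|t| <= s^-1 + s / 4 * t ^+ 2.
  rewrite -subr_ge0 -(real_normK (num_real t)).
  have -> : s^-1 + s / 4 * `|t| ^+ 2 - `|t| = s^-1 * (1 - s / 2 * `|t|) ^+ 2.
    by field; rewrite gt_eqF.
  by rewrite mulr_ge0 ?sqr_ge0// invr_ge0 ltW.
have si : 0 < s^-1 by rewrite invr_gt0.
have t2 : 0 <= s * t ^+ 2 by rewrite mulr_ge0 ?sqr_ge0// ltW.
apply: (le_trans ti); nra.
Qed.

Lemma integrable_gaussM s (h : R -> R) M : 0 < s -> measurable_fun setT h ->
  (forall t, `|h t| <= M) -> leb.-integrable setT (EFin \o (fun t => h t * gauss s t)).
Proof.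
move=> s0 mh hM.
have := integrableZl measurableT M (integrable_gauss s0).
apply: le_integrable => //.
  apply/measurable_EFinP; apply: measurable_funM => //; exact: measurable_gauss.
move=> t _ /=; rewrite lee_fin !normrM.
rewrite ler_wpM2r//; exact: le_trans (hM t) (ler_norm _).
Qed.

Lemma normr_cos_le1 (t : R) : `|cos t| <= 1.
Proof. by rewrite ler_norml cos_geN1 cos_le1. Qed.

Lemma normr_sin_le1 (t : R) : `|sin t| <= 1.
Proof. by rewrite ler_norml sin_geN1 sin_le1. Qed.

Lemma is_derive_affine (a b x : R) : is_derive x 1 (fun t => a + b * t) b.
Proof.
have := is_deriveD (is_derive_cst a x 1) (is_deriveZ b (is_derive_id x 1)).
by rewrite add0r /GRing.scale/= mulr1.
Qed.

Lemma is_derive_gauss s t : is_derive t 1 (gauss s) (- (s * t) * gauss s t).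
Proof.
have H : is_derive t 1 (fun t => - (s / 2 * t ^+ 2)) (- (s * t)).
  have := is_deriveN (is_deriveZ (s / 2) (is_deriveX 2 (is_derive_id t 1))).
  rewrite /GRing.scale/= expr1 mulr1 => D; apply: (is_derive_eq D).
  by congr (- _); field.
by rewrite mulrC; exact: (is_derive1_comp (is_derive_expR _) H).
Qed.

Lemma is_derive_sin_gauss s c y t :
  is_derive t 1 (fun t => sin (c + y * t) * gauss s t)
    ((y * cos (c + y * t) - s * t * sin (c + y * t)) * gauss s t).
Proof.
have H1 := is_derive_affine c y t.
have H2 := is_derive_gauss s t.
have H3 : is_derive t 1 (fun t => sin (c + y * t)) (cos (c + y * t) * y).
  exact: (is_derive1_comp (is_derive_sin _) H1).
have D := is_deriveM H3 H2.
apply: (is_derive_eq D).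
by rewrite /GRing.scale/=; ring.
Qed.

Lemma measurable_affine (a b : R) : measurable_fun setT (fun t : R => a + b * t).
Proof. by apply: measurable_funD => //; exact: measurable_funM. Qed.

Lemma measurable_cos_affine (c y : R) : measurable_fun setT (fun t : R => cos (c + y * t)).
Proof.
apply: (measurableT_comp (f := @cos R)); last exact: measurable_affine.
by apply: continuous_measurable_fun; exact: continuous_cos.
Qed.

Lemma measurable_sin_affine (c y : R) : measurable_fun setT (fun t : R => sin (c + y * t)).
Proof.
apply: (measurableT_comp (f := @sin R)); last exact: measurable_affine.
by apply: continuous_measurable_fun; exact: continuous_sin.
Qed.

Lemma integrable_cos_gauss s c y : 0 < s ->
  leb.-integrable setT (EFin \o (fun t => cos (c + y * t) * gauss s t)).
Proof.
move=> s0; apply: (integrable_gaussM (M := 1)) => // [|t]; last exact: normr_cos_le1.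
exact: measurable_cos_affine.
Qed.

Lemma integrable_sin_gauss s c y : 0 < s ->
  leb.-integrable setT (EFin \o (fun t => sin (c + y * t) * gauss s t)).
Proof.
move=> s0; apply: (integrable_gaussM (M := 1)) => // [|t]; last exact: normr_sin_le1.
exact: measurable_sin_affine.
Qed.

Lemma integrable_id_sin_gauss s c y : 0 < s ->
  leb.-integrable setT (EFin \o (fun t => t * sin (c + y * t) * gauss s t)).
Proof.
move=> s0; have s20 : 0 < s / 2 by rewrite divr_gt0.
have := integrableZl measurableT (s^-1 + 1) (integrable_gauss s20).
apply: le_integrable => //.
  apply/measurable_EFinP; apply: measurable_funM; last exact: measurable_gauss.
  by apply: measurable_funM => //; exact: measurable_sin_affine.
move=> t _ /=; rewrite lee_fin !normrM [X in _ * _ * X]ger0_norm ?expR_ge0//.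
rewrite mulrAC; apply: (@le_trans _ _ (`|t| * gauss s t * 1)).
  by rewrite ler_wpM2l ?normr_sin_le1// mulr_ge0 ?expR_ge0.
rewrite mulr1; apply: (le_trans (normr_gauss_le t s0)).
by rewrite -normrM ler_norm.
Qed.

(** The integrand is the derivative of [sin (c + y * t) * gauss s t]. Its integral is the derivative
    at [tau = 0] of the integral of the translate by [tau], which is constant by translation
    invariance; differentiation under the integral replaces an integration by parts. *)
Lemma integral_gauss_by_parts s c y : 0 < s ->
  \int[leb]_t ((y * cos (c + y * t) - s * t * sin (c + y * t)) * gauss s t) = 0.
Proof.
move=> s0.
pose h t := sin (c + y * t) * gauss s t.
pose Dh t := (y * cos (c + y * t) - s * t * sin (c + y * t)) * gauss s t.
pose f (tau t : R) := h (1 * t + tau).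
have fD (tau t : R) : is_derive tau 1 (f ^~ t) (Dh (1 * t + tau)).
  have H : is_derive tau 1 (fun u : R => 1 * t + u) 1.
    rewrite (_ : (fun u : R => 1 * t + u) = (fun u => 1 * t + 1 * u)).
      exact: is_derive_affine.
    by apply/funext => u; rewrite (mul1r u).
  have := is_derive1_comp (is_derive_sin_gauss s c y (1 * t + tau)) H.
  by rewrite mulr1.
have fd1 (tau t : R) : partial1of2 f tau t = Dh (1 * t + tau).
  by rewrite partial1of2E; case: (fD tau t).
have s4 : 0 < s / 4 by rewrite divr_gt0.
(* Uniform bound over [|tau| < 1]. Half of the Gaussian at [u = t + tau] absorbs the factor
   [s * |u|]; the other half is compared with a Gaussian centred at the origin through
   [(t + 2 * tau) ^+ 2 >= 0], at the cost of [expR (s / 4)]. *)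
pose G t := (`|y| + (1 + s)) * expR (s / 4) * gauss (s / 4) t.
have fint (tau : R) : leb.-integrable setT (EFin \o f tau).
  exact: (@integrable_affine R 1 tau (EFin \o h) ltr01 (integrable_sin_gauss c y s0)).
have C0 : 0 <= `|y| + (1 + s) by have := normr_ge0 y; lra.
have G_ge0 t : 0 <= G t by rewrite /G !mulr_ge0 ?expR_ge0.
have intG : leb.-integrable setT (EFin \o G).
  exact: (integrableZl measurableT ((`|y| + (1 + s)) * expR (s / 4))
    (integrable_gauss s4)).
have I0 : `]-1, 1[%classic (0 : R) by rewrite /= in_itv/= ltrN10 ltr01.
have G_ub tau t : `]-1, 1[%classic tau -> setT t -> `|partial1of2 f tau t| <= G t.
  rewrite /= in_itv/= => /andP[tau1 tau2] _; rewrite fd1 mul1r.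
  set u := t + tau.
  have us : gauss (s / 2) u <= expR (s / 4) * gauss (s / 4) t.
    rewrite /gauss -expRD ler_expR.
    have : 0 <= s * (t + 2 * tau) ^+ 2 by rewrite mulr_ge0 ?sqr_ge0 ?ltW.
    have : s * tau ^+ 2 <= s by rewrite ler_piMr ?ltW// expr2; nra.
    rewrite /u; lra.
  rewrite /G -mulrA; apply: (le_trans _ (ler_wpM2l C0 us)).
  rewrite normrM (ger0_norm (expR_ge0 _)).
  have b1 : `|y * cos (c + y * u) - s * u * sin (c + y * u)| <= `|y| + s * `|u|.
    apply: (le_trans (ler_normB _ _)); rewrite !normrM (gtr0_norm s0).
    by apply: lerD; rewrite ler_piMr ?mulr_ge0 ?(ltW s0) ?normr_cos_le1 ?normr_sin_le1.
  apply: (le_trans (ler_wpM2r (expR_ge0 _) b1)).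
  rewrite mulrDl [in leRHS]mulrDl; apply: lerD.
    apply: ler_wpM2l => //; rewrite /gauss ler_expR lerN2.
    by rewrite ler_wpM2r ?sqr_ge0//; lra.
  have := ler_wpM2l (ltW s0) (normr_gauss_le u s0).
  by rewrite mulrA (mulrA s (_ + _)) mulrDr mulr1 divff ?gt_eqF.
have derf1 (tau t : R) : `]-1, 1[%classic tau -> setT t -> derivable (f ^~ t) tau 1.
  by move=> _ _; case: (fD tau t).
have := @differentiation_under_integral R _ _ leb f setT measurableT 0 (-1) 1 I0
  (fun x _ => fint x) derf1 G G_ge0 intG G_ub.
have -> : (fun x : R => \int[leb]_t f x t) = cst (\int[leb]_t h t).
  apply/funext => tau; rewrite /f Rintegral_affine ?invr1 ?mul1r//.
  exact: integrable_sin_gauss.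
rewrite derive1_cst => E; rewrite [RHS]E.
apply: eq_Rintegral => t _; have := fd1 0 t.
by rewrite mul1r addr0; exact: esym.
Qed.

(** Differentiating under the integral produces the factor [- t] and a sine;
    [integral_gauss_by_parts] trades this for [- (y / s)] times the original integral. *)
Lemma is_derive_cos_gauss_transform s c y : 0 < s ->
  is_derive y 1 (fun y => \int[leb]_t (cos (c + y * t) * gauss s t))
    (- (y / s) * \int[leb]_t (cos (c + y * t) * gauss s t)).
Proof.
move=> s0; have s20 : 0 < s / 2 by rewrite divr_gt0.
pose f (y t : R) := cos (c + y * t) * gauss s t.
have fD (v t : R) : is_derive v 1 (f ^~ t) (- (t * sin (c + v * t) * gauss s t)).
  have H : is_derive v 1 (fun u : R => c + u * t) t.
    rewrite (_ : (fun u : R => c + u * t) = (fun u => c + t * u)).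
      exact: is_derive_affine.
    by apply/funext => u; rewrite mulrC.
  have D := is_deriveM (is_derive1_comp (is_derive_cos _) H)
    (is_derive_cst (gauss s t) v 1).
  apply: (is_derive_eq D); rewrite /GRing.scale/=; ring.
have fd1 (v t : R) : partial1of2 f v t = - (t * sin (c + v * t) * gauss s t).
  by rewrite partial1of2E; case: (fD v t).
pose G t := (s^-1 + 1) * gauss (s / 2) t.
have si : 0 < s^-1 + 1 by rewrite addr_gt0 ?invr_gt0.
have G_ge0 t : 0 <= G t by rewrite /G mulr_ge0 ?expR_ge0 ?ltW.
have intG : leb.-integrable setT (EFin \o G).
  exact: (integrableZl measurableT (s^-1 + 1) (integrable_gauss s20)).
have Iy : `]y - 1, y + 1[%classic y by rewrite /= in_itv/=; lra.
have fint (v : R) : leb.-integrable setT (EFin \o f v) by exact: integrable_cos_gauss.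
have derf1 (u t : R) : `]y - 1, y + 1[%classic u -> setT t -> derivable (f ^~ t) u 1.
  by move=> _ _; case: (fD u t).
have G_ub u t : `]y - 1, y + 1[%classic u -> setT t -> `|partial1of2 f u t| <= G t.
  move=> _ _; rewrite fd1 normrN !normrM (ger0_norm (expR_ge0 _)) mulrAC.
  apply: le_trans (normr_gauss_le t s0).
  by rewrite ler_piMr ?normr_sin_le1// mulr_ge0 ?expR_ge0.
have D := @derivable_under_integral R _ _ leb f setT measurableT y _ _ Iy
  (fun x _ => fint x) derf1 G G_ge0 intG G_ub.
have E := @differentiation_under_integral R _ _ leb f setT measurableT y _ _ Iy
  (fun x _ => fint x) derf1 G G_ge0 intG G_ub.
apply: DeriveDef => //; rewrite -derive1E [LHS]E.
transitivity (\int[leb]_t (- (t * sin (c + y * t) * gauss s t))).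
  by apply: eq_Rintegral => t _; exact: fd1.
have icos := integrable_cos_gauss c y s0.
have isin := integrable_id_sin_gauss c y s0.
have := integral_gauss_by_parts c y s0.
rewrite (_ : (fun t => _) = (fun t => y * (cos (c + y * t) * gauss s t)
   - s * (t * sin (c + y * t) * gauss s t))); last by apply/funext => t; ring.
rewrite RintegralB ?RintegralZl//; last 2 first.
- exact: (integrableZl measurableT y icos).
- exact: (integrableZl measurableT s isin).
under [X in _ -> X = _]eq_Rintegral do rewrite -mulN1r.
rewrite RintegralZl// => /eqP; rewrite subr_eq0 => /eqP.
set A := \int[leb]_t (cos _ * _); set B := \int[leb]_t _ => AB.
by rewrite mulN1r mulNr mulrAC AB mulrAC divff ?mul1r// gt_eqF.
Qed.

Lemma Rintegral_cos_gauss s c y : 0 < s ->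
  \int[leb]_t (cos (c + y * t) * gauss s t) =
  cos c * Num.sqrt (2 * pi / s) * expR (- (y ^+ 2 / (2 * s))).
Proof.
move=> s0.
(* As a function of [y] the integral satisfies [Phi' = - (y / s) Phi]. *)
pose Phi y := \int[leb]_t (cos (c + y * t) * gauss s t).
pose Psi y := Phi y * expR (y ^+ 2 / (2 * s)).
have PsiD (u : R) : is_derive u 1 Psi 0.
  have H : is_derive u 1 (fun u : R => u ^+ 2 / (2 * s)) (u / s).
    have D := is_deriveM (is_deriveX 2 (is_derive_id u 1))
      (is_derive_cst (2 * s)^-1 u 1).
    apply: (is_derive_eq D); rewrite /GRing.scale/=.
    by field; rewrite gt_eqF.
  have D := is_deriveM (is_derive_cos_gauss_transform c u s0)
    (is_derive1_comp (is_derive_expR _) H).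
  apply: (is_derive_eq D); rewrite /GRing.scale/= -/(Phi u); ring.
have := is_derive_0_is_cst y 0 PsiD.
rewrite /Psi expr0n/= mul0r expR0 mulr1 {2}/Phi.
under [X in _ = X -> _]eq_Rintegral do rewrite mul0r addr0.
rewrite RintegralZl//; last exact: integrable_gauss.
rewrite Rintegral_gauss// => <-.
by rewrite -mulrA -expRD subrr expR0 mulr1.
Qed.

End gauss1.

(** * Inner product, Euclidean norm and Gaussians in dimension [n] *)

Section dot.
Context {R : realType} {n : nat}.
Implicit Types (x y z : 'rV[R]_n) (a : R).

Lemma dotC x y : dot x y = dot y x.
Proof. by apply: eq_bigr => i _; rewrite mulrC. Qed.

Lemma dotDl x y z : dot (x + y) z = dot x z + dot y z.
Proof. by rewrite /dot -big_split/=; apply: eq_bigr => i _; rewrite mxE mulrDl. Qed.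

Lemma dotZl a x y : dot (a *: x) y = a * dot x y.
Proof. by rewrite /dot mulr_sumr; apply: eq_bigr => i _; rewrite mxE mulrA. Qed.

Lemma dotDr x y z : dot x (y + z) = dot x y + dot x z.
Proof. by rewrite dotC dotDl !(dotC x). Qed.

Lemma dotZr a x y : dot x (a *: y) = a * dot x y.
Proof. by rewrite dotC dotZl dotC. Qed.

Lemma dotNl x y : dot (- x) y = - dot x y.
Proof. by rewrite -scaleN1r dotZl mulN1r. Qed.

Lemma dotNr x y : dot x (- y) = - dot x y.
Proof. by rewrite dotC dotNl dotC. Qed.

Lemma dot0l x : dot 0 x = 0.
Proof. by rewrite /dot big1// => i _; rewrite mxE mul0r. Qed.

Lemma dot_ge0 x : 0 <= dot x x.
Proof. by apply: sumr_ge0 => i _; rewrite -expr2 sqr_ge0. Qed.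

Lemma enorm_ge0 x : 0 <= enorm x.
Proof. exact: sqrtr_ge0. Qed.

Lemma sqr_enorm x : enorm x ^+ 2 = dot x x.
Proof. by rewrite sqr_sqrtr ?dot_ge0. Qed.

Lemma enormZ a x : enorm (a *: x) = `|a| * enorm x.
Proof. by rewrite /enorm dotZl dotZr mulrA -expr2 sqrtrM ?sqr_ge0// sqrtr_sqr. Qed.

Lemma enormN x : enorm (- x) = enorm x.
Proof. by rewrite -scaleN1r enormZ normrN1 mul1r. Qed.

Lemma enorm0 : enorm (0 : 'rV[R]_n) = 0.
Proof. by rewrite /enorm dot0l sqrtr0. Qed.

Lemma normr_coord_le x i : `|x ord0 i| <= enorm x.
Proof.
rewrite -(@ler_pXn2r _ 2) ?nnegrE ?normr_ge0 ?enorm_ge0// sqr_enorm real_normK ?num_real//.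
rewrite /dot (bigD1 i)//= -expr2 lerDl.
by apply: sumr_ge0 => j _; rewrite -expr2 sqr_ge0.
Qed.

Lemma enorm_eq0 x : enorm x = 0 -> x = 0.
Proof.
move=> x0; apply/rowP => i; rewrite mxE; apply/eqP.
by rewrite -normr_le0 -x0 normr_coord_le.
Qed.

Lemma normr_dot_le x y : `|dot x y| <= enorm x * enorm y.
Proof.
wlog : x / 0 <= dot x y.
  move=> H; case: (lerP 0 (dot x y)) => [/H//|xy0].
  by rewrite -normrN -dotNl -(enormN x); apply: H; rewrite dotNl; lra.
move=> xy0; rewrite ger0_norm//.
have [x0|x0] := eqVneq (enorm x) 0.
  by rewrite (enorm_eq0 x0) dot0l enorm0 mul0r.
have [y0|y0] := eqVneq (enorm y) 0.
  by rewrite (enorm_eq0 y0) dotC dot0l enorm0 mulr0.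
have xy : 0 < enorm x * enorm y by rewrite mulr_gt0 ?lt0r ?x0 ?y0 ?enorm_ge0.
have := dot_ge0 (enorm y *: x - enorm x *: y).
rewrite dotDl !dotDr !(dotNl, dotNr, dotZl, dotZr) (dotC y x) -!sqr_enorm => H.
have : 0 <= (enorm x * enorm y) * (enorm x * enorm y - dot x y) by nra.
by rewrite pmulr_rge0// subr_ge0.
Qed.

Lemma ler_enormD x y : enorm (x + y) <= enorm x + enorm y.
Proof.
rewrite -(@ler_pXn2r _ 2) ?nnegrE ?addr_ge0 ?enorm_ge0// sqr_enorm.
rewrite dotDl !dotDr (dotC y x) -!sqr_enorm.
have := normr_dot_le x y; have := ler_norm (dot x y).
by move=> ? ?; nra.
Qed.

Lemma ler_enormB x y : enorm x - enorm y <= enorm (x - y).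
Proof. by rewrite lerBlDr -[in leLHS](subrK y x) ler_enormD. Qed.

Lemma enorm_le x a : (forall i, `|x ord0 i| <= a) -> enorm x <= Num.sqrt n%:R * a.
Proof.
move=> xa; case: (posnP n) => [n0|n0].
  rewrite /enorm /dot big1 ?sqrtr0; first by rewrite n0 sqrtr0 mul0r.
  by move=> [i hi] _; exfalso; rewrite n0 in hi.
have a0 : 0 <= a by apply: le_trans (xa (Ordinal n0)).
rewrite -(@ler_pXn2r _ 2) ?nnegrE ?mulr_ge0 ?enorm_ge0 ?sqrtr_ge0//.
rewrite sqr_enorm exprMn sqr_sqrtr// mulr_natl.
rewrite -[X in _ *+ X]card_ord -sumr_const; apply: ler_sum => i _.
by rewrite -expr2 -(real_normK (num_real _)) ler_pXn2r ?nnegrE.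
Qed.

Lemma measurable_dot y : measurable_fun setT (dot y).
Proof.
apply: measurable_sum => i; apply: measurable_funM => //.
exact: measurable_rV_coord.
Qed.

Lemma measurable_enorm : measurable_fun setT (@enorm R n).
Proof.
apply: (measurableT_comp (f := @Num.sqrt R)).
  by apply: continuous_measurable_fun; exact: sqrt_continuous.
apply: measurable_sum => i; apply: measurable_funM; exact: measurable_rV_coord.
Qed.

Lemma measurable_enorm_powR a : measurable_fun setT (fun x => enorm x `^ a).
Proof.
by apply: (measurableT_comp (measurable_powR a)); exact: measurable_enorm.
Qed.

Definition gaussn (s : R) x : R := expR (- (s / 2 * dot x x)).

Lemma gaussn_gt0 s x : 0 < gaussn s x.
Proof. exact: expR_gt0. Qed.

Lemma gaussn_ge0 s x : 0 <= gaussn s x.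
Proof. exact: expR_ge0. Qed.

Lemma gaussn_le1 s x : 0 <= s -> gaussn s x <= 1.
Proof.
by move=> s0; rewrite /gaussn -expR0 ler_expR oppr_le0 mulr_ge0 ?dot_ge0 ?divr_ge0.
Qed.

Lemma gaussnE s x : gaussn s x = \prod_i gauss s (x ord0 i).
Proof.
rewrite /gaussn /dot mulr_sumr -sumrN expR_sum.
by apply: eq_bigr => i _; rewrite -expr2.
Qed.

Lemma gaussnZ s a x : gaussn s (a *: x) = gaussn (s * a ^+ 2) x.
Proof. by rewrite /gaussn dotZl dotZr; congr expR; ring. Qed.

Lemma measurable_gaussn s : measurable_fun setT (gaussn s).
Proof.
rewrite (_ : gaussn s = expR \o (fun x => (- (s / 2)) * enorm x ^+ 2)); last first.
  by apply/funext => x; rewrite /gaussn/= sqr_enorm mulNr.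
apply: measurableT_comp => //; apply: measurable_funM => //.
by apply: measurable_funX; exact: measurable_enorm.
Qed.

Lemma measurable_cos_dot c y : measurable_fun setT (fun x => cos (c + dot y x)).
Proof.
apply: (measurableT_comp (f := @cos R)).
  by apply: continuous_measurable_fun; exact: continuous_cos.
by apply: measurable_funD => //; exact: measurable_dot.
Qed.

End dot.

(** * Gaussian integrals in dimension [n] *)

Section gaussn_integral.
Context {R : realType}.
Local Notation leb := (@lebesgue_measure R).
Local Notation mu n := (lebesgue_rV R n).

Lemma EFin_Rintegral d (T : measurableType d) (m : {measure set T -> \bar R})
  (f : T -> R) : m.-integrable setT (EFin \o f) ->
  (\int[m]_x (f x)%:E = (\int[m]_x f x)%R%:E)%E.
Proof. by move=> fi; rewrite /Rintegral fineK//; exact: integrable_fin_num. Qed.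

Lemma ge0_integral_rVZl n (k : R) (f : 'rV[R]_n -> R) : 0 <= k ->
  measurable_fun setT f -> (forall x, 0 <= f x) ->
  (\int[mu n]_x (k * f x)%:E = k%:E * \int[mu n]_x (f x)%:E)%E.
Proof.
move=> k0 mf f0; under eq_integral do rewrite EFinM.
rewrite ge0_integralZl//; first exact/measurable_EFinP.
by move=> x _; rewrite lee_fin.
Qed.

Lemma integral_gaussn n (s : R) : 0 < s ->
  (\int[mu n]_x (gaussn s x)%:E = (Num.sqrt (2 * pi / s) ^+ n)%:E)%E.
Proof.
move=> s0; under eq_integral do rewrite gaussnE.
rewrite (@ge0_integral_rV_prod R n (fun=> gauss s) (fun=> Num.sqrt (2 * pi / s))).
- by rewrite prodr_const card_ord.
- by move=> i; exact: measurable_gauss.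
- by move=> i t; exact: expR_ge0.
- by move=> i; rewrite -Rintegral_gauss// EFin_Rintegral//; exact: integrable_gauss.
Qed.

Lemma integrable_gaussn n (s : R) : 0 < s ->
  (mu n).-integrable setT (EFin \o gaussn s).
Proof.
move=> s0; apply/integrableP; split.
  by apply/measurable_EFinP; exact: measurable_gaussn.
under eq_integral do rewrite /= ger0_norm ?gaussn_ge0//.
by rewrite integral_gaussn// ltry.
Qed.

Lemma Rintegral_gaussn n (s : R) : 0 < s ->
  \int[mu n]_x gaussn s x = Num.sqrt (2 * pi / s) ^+ n.
Proof. by move=> s0; rewrite /Rintegral integral_gaussn. Qed.

Lemma le_norm_integrable n (f g : 'rV[R]_n -> R) :
  measurable_fun setT f -> (mu n).-integrable setT (EFin \o g) ->
  (forall x, `|f x| <= g x) -> (mu n).-integrable setT (EFin \o f).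
Proof.
move=> mf ig fg; apply: le_integrable ig => //; first exact/measurable_EFinP.
by move=> x _ /=; rewrite lee_fin; exact: le_trans (fg x) (ler_norm _).
Qed.

Lemma integrable_cos_gaussn n (s c : R) (y : 'rV[R]_n) : 0 < s ->
  (mu n).-integrable setT (EFin \o (fun x => cos (c + dot y x) * gaussn s x)).
Proof.
move=> s0; apply: (@le_norm_integrable _ _ (gaussn s)).
- apply: measurable_funM; first exact: measurable_cos_dot.
  exact: measurable_gaussn.
- exact: integrable_gaussn.
- move=> x; rewrite normrM [X in _ * X]ger0_norm ?gaussn_ge0//.
  by rewrite ler_piMl ?gaussn_ge0 ?normr_cos_le1.
Qed.

Lemma dot_rV_cons n (t u : R) (x y : 'rV[R]_n) :
  dot (rV_cons (t, x)) (rV_cons (u, y)) = t * u + dot x y.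
Proof.
rewrite /dot big_ord_recl !mxE !unlift_none/=; congr (_ + _).
by apply: eq_bigr => i _; rewrite !mxE !liftK.
Qed.

Lemma rV_unconsK n (x : 'rV[R]_n.+1) : rV_cons (rV_uncons x) = x.
Proof.
apply/rowP => i; rewrite !mxE.
by case: (unliftP ord0 i) => [j|] -> /=; rewrite ?mxE.
Qed.

(** The free phase [c] makes the induction on the dimension close: for a fixed first coordinate [t]
    the inner integral has phase [c + y0 * t], and its value leaves a one-dimensional integral of
    the same form. *)
Lemma Rintegral_cos_gaussn n (s c : R) (y : 'rV[R]_n) : 0 < s ->
  \int[mu n]_x (cos (c + dot y x) * gaussn s x) =
  cos c * Num.sqrt (2 * pi / s) ^+ n * gaussn s^-1 y.
Proof.
move=> s0; apply: EFin_inj; rewrite -EFin_Rintegral; last first.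
  exact: integrable_cos_gaussn.
have := integrable_cos_gaussn c y s0.
elim: n c y => [|n IH] c y iy.
  rewrite ge0_integral_rV0; last exact: measurable_int iy.
  by rewrite /gaussn /dot !big_ord0 !mulr0 addr0 oppr0 expR0 expr0 !mulr1.
rewrite integral_rVS//.
have -> : y = rV_cons (rV_uncons y) by rewrite rV_unconsK.
case: (rV_uncons y) => y0 {iy}y.
have E t (x : 'rV[R]_n) : gaussn s (rV_cons (t, x)) = gauss s t * gaussn s x.
  by rewrite /gaussn /gauss dot_rV_cons -expRD; congr expR; ring.
under eq_integral => t _.
  under eq_integral => x _.
    rewrite dot_rV_cons E mulrCA addrA EFinM; over.
  rewrite integralZl//; last exact: integrable_cos_gaussn.
  rewrite (IH (c + y0 * t) y); last exact: integrable_cos_gaussn.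
  rewrite -EFinM (_ : _ * _ = (Num.sqrt (2 * pi / s) ^+ n * gaussn s^-1 y) *
    (cos (c + y0 * t) * gauss s t)); last by ring.
  rewrite EFinM; over.
have ic := integrable_cos_gauss c y0 s0.
rewrite integralZl// EFin_Rintegral// -EFinM Rintegral_cos_gauss//; congr EFin.
rewrite [gaussn s^-1 (rV_cons _)](_ : _ = expR (- (y0 ^+ 2 / (2 * s))) * gaussn s^-1 y).
  by rewrite [_ ^+ n.+1]exprS; ring.
rewrite /gaussn dot_rV_cons -expRD; congr expR.
by field; rewrite gt_eqF.
Qed.

End gaussn_integral.

(** * Integrals of powers of the norm *)

Section power_integral.
Context {R : realType}.
Local Notation mu n := (lebesgue_rV R n).

Lemma ler_powR_npos (a x y : R) : a <= 0 -> 0 < x -> x <= y -> y `^ a <= x `^ a.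
Proof.
move=> a0 x0 xy; have y0 := lt_le_trans x0 xy.
rewrite -(opprK a) !(powRN _ (- a)) lef_pV2 ?posrE ?powR_gt0//.
by apply: ge0_ler_powR => //; rewrite ?nnegrE ?oppr_ge0//; exact: ltW.
Qed.

Lemma dyadic_scale (r : R) : 0 < r <= 1 -> exists k, 2^-1 ^+ k.+1 < r <= 2^-1 ^+ k.
Proof.
move=> /andP[r0 r1].
have ex : exists k, 2^-1 ^+ k < r.
  have [k rk] : exists k : nat, r^-1 < k%:R.
    by exists (Num.Def.archi_bound r^-1); apply: archi_boundP; rewrite invr_ge0 ltW.
  exists k; rewrite exprVn -[ltRHS]invrK ltf_pV2 ?posrE ?invr_gt0 ?exprn_gt0//.
  by apply: (lt_trans rk); rewrite -natrX ltr_nat ltn_expl.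
case: (ex_minnP ex) => -[|k] rk kmin; first by rewrite expr0 ltNge r1 in rk.
exists k; rewrite rk /= leNgt; apply/negP => /kmin.
by rewrite ltnn.
Qed.

(** In place of polar coordinates, on the shell [2^-(k+1) < |x| <= 2^-k] the power is dominated by
    the [k]-th term of a series of dilated Gaussians. That term has integral proportional to
    [2^(-(m + n) k)], so [m > -n] makes the series geometric with ratio below one. *)
Lemma integral_unit_ball_powR n (m : R) : - n%:R < m < 0 ->
  exists2 J : R, 0 <= J &
  (\int[mu n]_x (enorm x `^ m * (enorm x <= 1)%R%:R)%:E <= J%:E)%E.
Proof.
move=> /andP[nm m0].
pose q := 2 `^ (- m) : R.
(* [expR (1 / 2)] compensates the Gaussian, which is at least [expR (- (1 / 2))] where
   [2^k |x| <= 1]; the extra [q] is due to the inner edge of the shell, where the power reaches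
   [q^(k+1)]. *)
pose B : R := expR (1 / 2) * q.
have q0 : 0 < q by rewrite powR_gt0.
have B0 : 0 < B by rewrite mulr_gt0 ?expR_gt0.
pose f k (x : 'rV[R]_n) := B * q ^+ k * gaussn 1 (2 ^+ k *: x).
have f0 k x : 0 <= f k x.
  exact: mulr_ge0 (mulr_ge0 (ltW B0) (exprn_ge0 k (ltW q0))) (gaussn_ge0 _ _).
have mf k : measurable_fun setT (f k).
  apply: measurable_funM => //.
  rewrite (_ : (fun _ => _) = gaussn (1 * (2 ^+ k) ^+ 2)); first exact: measurable_gaussn.
  by apply/funext => x; rewrite gaussnZ.
have fint k : (\int[mu n]_x (f k x)%:E =
    (B * Num.sqrt (2 * pi / 1) ^+ n * (q * 2 ^- n) ^+ k)%:E)%E.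
  under eq_integral do rewrite /f EFinM -[2 ^+ k *: _]addr0.
  rewrite ge0_integralZl//; last 3 first.
  - apply/measurable_EFinP; apply: (measurableT_comp (measurable_gaussn 1)).
    exact: measurable_rV_affine.
  - by move=> x _; rewrite lee_fin gaussn_ge0.
  - by rewrite lee_fin mulr_ge0 ?exprn_ge0 ?ltW.
  rewrite (@ge0_integral_rV_affine R n (2 ^+ k) 0 (fun x => (gaussn 1 x)%:E)) ?exprn_gt0//; last 2 first.
  - by apply/measurable_EFinP; exact: measurable_gaussn.
  - by move=> x; rewrite lee_fin gaussn_ge0.
  rewrite integral_gaussn// -!EFinM; congr EFin.
  rewrite exprMn exprVn -!exprM mulnC; ring.
pose A := B * Num.sqrt (2 * pi / 1) ^+ n.
have A0 : 0 <= A by rewrite mulr_ge0 ?exprn_ge0 ?sqrtr_ge0 ?ltW.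
pose th := q * 2 ^- n.
have th0 : 0 < th by rewrite mulr_gt0// invr_gt0 exprn_gt0.
have th1 : th < 1.
  rewrite /th /q -powR_mulrn// -powRN -powRD; last by rewrite pnatr_eq0 implybT.
  rewrite /powR pnatr_eq0/= -[X in _ < X]expR0 ltr_expR pmulr_llt0 ?ln_gt0 ?ltr1n//.
  by lra.
exists (A * (1 - th)^-1); first by rewrite mulr_ge0// invr_ge0; lra.
apply: (@le_trans _ _ (\int[mu n]_x \sum_(k <oo) (f k x)%:E)%E); last first.
  rewrite integral_nneseries//; last 2 first.
  - by move=> k; exact/measurable_EFinP.
  - by move=> k x _; rewrite lee_fin.
  under eq_eseriesr do rewrite fint.
  apply: lime_le.
    apply: is_cvg_nneseries => k _ _; rewrite lee_fin.
    by apply: mulr_ge0; [exact: A0 | exact: exprn_ge0 (ltW th0)].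
  apply: nearW => N; rewrite sumEFin lee_fin.
  have := @geometric_le_lim R N A th A0 th0.
  by rewrite ger0_norm ?(ltW th0)// => /(_ th1); rewrite /series/= big_mkord.
apply: le_ge0_integral => x.
  by rewrite lee_fin mulr_ge0 ?powR_ge0.
case: (lerP (enorm x) 1) => x1; last first.
  by rewrite mulr0; apply: nneseries_ge0 => k _ _; rewrite lee_fin.
rewrite mulr1.
(* The power of [0] with nonzero exponent is [0] by convention, so the origin is harmless although
   [m < 0]. *)
have [x0|x0] := eqVneq (enorm x) 0.
  rewrite x0 powR0 ?lt_eqF//.
  by apply: nneseries_ge0 => k _ _; rewrite lee_fin.
have {}x0 : 0 < enorm x by rewrite lt0r x0 enorm_ge0.
have [|k /andP[k1 k2]] := dyadic_scale (r := enorm x); first by rewrite x0.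
apply: (@le_trans _ _ (\sum_(0 <= i < k.+1) (f i x)%:E)%E); last first.
  by apply: nneseries_lim_ge => i _ _; rewrite lee_fin.
rewrite big_nat_recr//= -[leLHS]add0e leeD//.
  by apply: sume_ge0 => i _; rewrite lee_fin.
rewrite lee_fin.
have h0 : 0 < 2^-1 :> R by rewrite invr_gt0.
have h1 : enorm x `^ m <= q ^+ k.+1.
  apply: le_trans (ler_powR_npos (ltW m0) (exprn_gt0 k.+1 h0) (ltW k1)) _.
  have -> : q = 2^-1 `^ m by rewrite -(powR_inv1 (ler0n _ 2)) -powRrM mulN1r.
  by rewrite -(powR_mulrn k.+1 (ltW h0)) -(powR_mulrn k.+1 (powR_ge0 _ _)) powRAC.
have h2 : expR (- (1 / 2)) <= gaussn 1 (2 ^+ k *: x).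
  rewrite ler_expR lerN2 dotZl dotZr -sqr_enorm ler_piMr//.
  rewrite mulrA -expr2 -exprMn exprn_ile1 ?mulr_ge0 ?exprn_ge0 ?enorm_ge0//.
  have : 2 ^+ k * enorm x <= 2 ^+ k * 2^-1 ^+ k by rewrite ler_pM2l ?exprn_gt0.
  by rewrite -exprMn divff ?expr1n// pnatr_eq0.
rewrite /f; apply: (le_trans h1).
have := ler_wpM2l (mulr_ge0 (ltW B0) (exprn_ge0 k (ltW q0))) h2.
apply: le_trans; rewrite /B expRN exprS.
by rewrite le_eqVlt; apply/orP; left; apply/eqP; field; rewrite gt_eqF ?expR_gt0.
Qed.

Lemma measurable_enorm_le n (a : R) :
  measurable_fun setT (fun x : 'rV[R]_n => (enorm x <= a)%R%:R : R).
Proof.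
rewrite (_ : (fun x => _) = \1_(@enorm R n @^-1` `]-oo, a])).
  apply: measurable_indic; rewrite -[X in measurable X]setTI.
  by apply: measurable_enorm => //; exact: measurable_itv.
apply/funext => x; rewrite indicE; congr (nat_of_bool _)%:R.
by apply/idP/idP => [h|]; [rewrite inE/= in_itv|rewrite inE/= in_itv].
Qed.

Lemma integral_ball_powR n (m : R) : - n%:R < m < 0 ->
  exists2 J : R, 0 <= J & forall a, 0 < a ->
  (\int[mu n]_x (enorm x `^ m * (enorm x <= a)%R%:R)%:E
     <= (J * a `^ (m + n%:R))%:E)%E.
Proof.
move=> hm; have [J J0 HJ] := integral_unit_ball_powR hm; exists J => // a a0.
have ai : 0 < a^-1 by rewrite invr_gt0.
pose g (x : 'rV[R]_n) := (enorm x `^ m * (enorm x <= 1)%R%:R)%:E.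
have mg : measurable_fun setT g.
  apply/measurable_EFinP; apply: measurable_funM; first exact: measurable_enorm_powR.
  exact: measurable_enorm_le.
have g0 x : (0 <= g x)%E by rewrite lee_fin mulr_ge0 ?powR_ge0.
have E x : (enorm x `^ m * (enorm x <= a)%R%:R)%:E = ((a `^ m)%:E * g (a^-1 *: x + 0)%R)%E.
  rewrite /g addr0 -EFinM enormZ gtr0_norm// (powRM _ (ltW ai) (enorm_ge0 x)).
  rewrite ler_pdivrMl// mulr1 !mulrA; congr (_ * _)%:E.
  by rewrite -(powRM _ (ltW a0) (ltW ai)) divff ?gt_eqF// powR1 mul1r.
under eq_integral do rewrite E.
rewrite ge0_integralZl//; last 2 first.
- by apply: (measurableT_comp mg); exact: measurable_rV_affine.
- by rewrite lee_fin powR_ge0.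
rewrite (@ge0_integral_rV_affine R n a^-1 0 g)// exprVn invrK muleA -EFinM.
apply: (le_trans (lee_wpmul2l _ HJ)); first by rewrite lee_fin mulr_ge0 ?powR_ge0// exprn_ge0// ltW.
rewrite -EFinM lee_fin powRD; last by rewrite (gt_eqF a0) implybT.
by rewrite (powR_mulrn _ (ltW a0)) mulrC.
Qed.

End power_integral.

Section moments.
Context {R : realType} {n : nat}.
Local Notation mu := (lebesgue_rV R n).
Implicit Types (x y eta kappa : 'rV[R]_n) (s m K C : R).

Lemma expR_poly_bound K (r : R) : 0 <= K -> 0 <= r -> (1 + r) `^ K <= expR (K * r).
Proof.
move=> K0 r0; rewrite /powR gt_eqF; last by lra.
by rewrite ler_expR ler_wpM2l// le_ln1Dx//; lra.
Qed.

(** Polynomial growth costs half of the Gaussian: [(1 + r)^K <= expR (K * r)], and completing the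
    square gives [K * r <= K ^+ 2 / s + s / 4 * r ^+ 2]. *)
Lemma poly_gaussn_le K s x : 0 <= K -> 0 < s ->
  (1 + enorm x) `^ K * gaussn s x <= expR (K ^+ 2 / s) * gaussn (s / 2) x.
Proof.
move=> K0 s0; have := enorm_ge0 x; set r := enorm x => r0.
apply: (le_trans (ler_wpM2r (gaussn_ge0 s x) (expR_poly_bound K0 r0))).
rewrite /gaussn -sqr_enorm -/r -!expRD ler_expR.
rewrite -subr_ge0.
have -> : K ^+ 2 / s + - (s / 2 / 2 * r ^+ 2) - (K * r + - (s / 2 * r ^+ 2)) =
  s^-1 * (K - s / 2 * r) ^+ 2 by field; rewrite gt_eqF.
by rewrite mulr_ge0 ?sqr_ge0// invr_ge0 ltW.
Qed.

Lemma ge0_integrable_le C (f : 'rV[R]_n -> R) : measurable_fun setT f ->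
  (forall x, 0 <= f x) -> (\int[mu]_x (f x)%:E <= C%:E)%E ->
  mu.-integrable setT (EFin \o f) /\ \int[mu]_x f x <= C.
Proof.
move=> mf f0 fC.
have fi : mu.-integrable setT (EFin \o f).
  apply/integrableP; split; first exact/measurable_EFinP.
  under eq_integral do rewrite /= ger0_norm//.
  exact: le_lt_trans fC (ltry _).
by split=> //; rewrite -lee_fin -EFin_Rintegral.
Qed.

Lemma measurable_enorm_shift kappa : measurable_fun setT (fun x => enorm (kappa + x)).
Proof.
rewrite (_ : (fun x => _) = @enorm R n \o (fun x => 1 *: x + kappa)).
  exact: (measurableT_comp measurable_enorm (measurable_rV_affine 1 kappa)).
by apply/funext => x /=; rewrite scale1r addrC.
Qed.

Lemma measurable_enorm_shift_powR kappa m :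
  measurable_fun setT (fun x => enorm (kappa + x) `^ m).
Proof. exact: (measurableT_comp (measurable_powR m) (measurable_enorm_shift kappa)). Qed.

(** Split at [|kappa + eta| = a]: outside the ball the power is at most [a^m] because [m < 0];
    inside, the Gaussian is replaced by its bound [M] and [HJ] integrates the singularity. *)
Lemma integral_shift_powR_gaussn m s J : - n%:R < m < 0 -> 0 < s ->
  (forall a, 0 < a -> (\int[mu]_x (enorm x `^ m * (enorm x <= a)%R%:R)%:E
     <= (J * a `^ (m + n%:R))%:E)%E) ->
  forall kappa a M, 0 < a -> 0 <= M ->
  (forall eta, enorm (kappa + eta) <= a -> gaussn s eta <= M) ->
  (\int[mu]_eta (enorm (kappa + eta) `^ m * gaussn s eta)%:E <=
   (a `^ m * Num.sqrt (2 * pi / s) ^+ n + M * (J * a `^ (m + n%:R)))%:E)%E.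
Proof.
move=> /andP[nm m0] s0 HJ kappa a M a0 M0 HM.
pose g x := (enorm x `^ m * (enorm x <= a)%R%:R)%:E.
have mg : measurable_fun setT g.
  apply/measurable_EFinP; apply: measurable_funM; first exact: measurable_enorm_powR.
  exact: measurable_enorm_le.
have g0 x : (0 <= g x)%E by rewrite lee_fin mulr_ge0 ?powR_ge0.
apply: (@le_trans _ _ (\int[mu]_eta ((a `^ m * gaussn s eta)%:E
   + M%:E * g (1 *: eta + kappa)%R)))%E.
  apply: le_ge0_integral => eta.
    by rewrite lee_fin mulr_ge0 ?powR_ge0 ?gaussn_ge0.
  rewrite /g -EFinM -EFinD lee_fin scale1r (addrC eta).
  case: (lerP (enorm (kappa + eta)) a) => ha.
    rewrite mulr1 -[leLHS]add0r lerD ?mulr_ge0 ?powR_ge0 ?gaussn_ge0//.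
    by rewrite mulrC ler_wpM2r ?powR_ge0 ?HM.
  rewrite !mulr0 addr0 ler_wpM2r ?gaussn_ge0// ler_powR_npos ?(ltW m0)//.
  exact: ltW.
have mg1 : measurable_fun setT (fun eta => g (1 *: eta + kappa)).
  exact: (measurableT_comp mg (measurable_rV_affine 1 kappa)).
rewrite ge0_integralD//; last 4 first.
- by move=> x _; rewrite lee_fin mulr_ge0 ?powR_ge0 ?gaussn_ge0.
- apply/measurable_EFinP; apply: measurable_funM => //; exact: measurable_gaussn.
- by move=> x _; rewrite mule_ge0.
- exact: measurable_funeM.
rewrite ge0_integralZl//.
rewrite (@ge0_integral_rV_affine R n 1 kappa g)// expr1n invr1 mul1e.
rewrite ge0_integral_rVZl ?powR_ge0//; last 2 first.
- exact: measurable_gaussn.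
- by move=> x; rewrite gaussn_ge0.
rewrite integral_gaussn// -EFinM EFinD leeD// EFinM.
by apply: lee_wpmul2l => //; exact: HJ.
Qed.

Lemma integral_powR_gaussn m s : - n%:R < m < 0 -> 0 < s ->
  exists C, (\int[mu]_x (enorm x `^ m * gaussn s x)%:E <= C%:E)%E.
Proof.
move=> hm s0; have [J J0 HJ] := integral_ball_powR hm.
have := @integral_shift_powR_gaussn m s J hm s0 HJ 0 _ _ ltr01 ler01.
move=> /(_ (fun eta _ => gaussn_le1 eta (ltW s0))) H.
by eexists; under eq_integral do rewrite -[X in enorm X]add0r; exact: H.
Qed.

(** Take [a = r / 2] in the splitting. On the ball [|kappa + eta| <= r / 2] one has
    [|eta| >= r / 2], so [poly_gaussn_le] with [K = n] bounds the Gaussian by [D * (r / 2)^(- n)].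
    This cancels the volume factor [a^n] and leaves a multiple of [r^m], as outside the ball. *)
Lemma integral_moment_neg m s : - n%:R < m < 0 -> 0 < s ->
  exists2 C, 0 <= C & forall kappa, 1 <= enorm kappa ->
  (\int[mu]_eta (enorm (kappa + eta) `^ m * gaussn s eta)%:E <=
    (C * enorm kappa `^ m)%:E)%E.
Proof.
move=> hm s0; have [J J0 HJ] := integral_ball_powR hm.
case/andP: (hm) => nm m0.
pose D := expR (n%:R ^+ 2 / s).
exists (2 `^ (- m) * (Num.sqrt (2 * pi / s) ^+ n + D * J)).
  by rewrite mulr_ge0 ?powR_ge0// addr_ge0 ?exprn_ge0 ?sqrtr_ge0// mulr_ge0 ?expR_ge0.
move=> kappa k1; set r := enorm kappa in k1 *.
have r0 : 0 < r by lra.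
have r20 : 0 < r / 2 by lra.
have M0 : 0 <= D * (r / 2) `^ (- n%:R) by rewrite mulr_ge0 ?expR_ge0 ?powR_ge0.
apply: (le_trans (integral_shift_powR_gaussn hm s0 HJ r20 M0 _)).
  move=> eta ha.
  have re : r / 2 <= enorm eta.
    have := ler_enormB kappa (- eta); rewrite enormN opprK -/r; lra.
  have e0 : 0 < 1 + enorm eta by lra.
  have := poly_gaussn_le eta (ler0n R n) s0.
  rewrite -ler_pdivlMl ?powR_gt0// -powRN => H; apply: (le_trans H).
  rewrite mulrC ler_pM ?mulr_ge0 ?expR_ge0 ?gaussn_ge0 ?powR_ge0//.
    by rewrite ler_piMr ?expR_ge0// gaussn_le1// ltW// divr_gt0.
  by apply: ler_powR_npos; rewrite ?oppr_le0 ?ler0n//; lra.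
have E : (r / 2) `^ (- n%:R) * (r / 2) `^ (m + n%:R) = r `^ m * 2 `^ (- m).
  rewrite -powRD; last by rewrite (gt_eqF r20) implybT.
  rewrite (_ : - n%:R + (m + n%:R) = m); last by ring.
  rewrite (powRM m (ltW r0)) ?invr_ge0//; congr (_ * _).
  by rewrite -(powR_inv1 (ler0n _ 2)) -powRrM mulN1r.
have E2 : (r / 2) `^ m = r `^ m * 2 `^ (- m).
  rewrite (powRM m (ltW r0)) ?invr_ge0//; congr (_ * _).
  by rewrite -(powR_inv1 (ler0n _ 2)) -powRrM mulN1r.
rewrite lee_fin E2 (_ : D * _ * _ = D * J * (r `^ m * 2 `^ (- m))); last by rewrite -E; ring.
by rewrite le_eqVlt; apply/orP; left; apply/eqP; ring.
Qed.

Lemma enorm_shift_powR_le m kappa eta : 0 <= m -> 1 <= enorm kappa ->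
  enorm (kappa + eta) `^ m <= enorm kappa `^ m * (1 + enorm eta) `^ m.
Proof.
move=> m0 k1; have e0 := enorm_ge0 eta.
rewrite -powRM ?(le_trans ler01)//; last by lra.
apply: ge0_ler_powR => //; rewrite ?nnegrE ?enorm_ge0//.
  by rewrite mulr_ge0 ?enorm_ge0; lra.
apply: (le_trans (ler_enormD _ _)); rewrite mulrDr mulr1 lerD2l.
by rewrite ler_peMl.
Qed.

Lemma measurable_poly_enorm K : measurable_fun setT (fun x => (1 + enorm x) `^ K).
Proof.
apply: (measurableT_comp (measurable_powR K)).
by apply: measurable_funD => //; exact: measurable_enorm.
Qed.

(** For [m < 0] the polynomial factor is absorbed into half of the Gaussian, which reduces to
    [integral_moment_neg]; for [m >= 0] and [|kappa| >= 1] the triangle inequality gives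
    [|kappa + eta| <= |kappa| (1 + |eta|)]. *)
Lemma integral_moment m K s : - n%:R < m -> 0 <= K -> 0 < s ->
  exists2 C, 0 <= C & forall kappa, 1 <= enorm kappa ->
  (\int[mu]_eta ((1 + enorm eta) `^ K * enorm (kappa + eta) `^ m * gaussn s eta)%:E <=
    (C * enorm kappa `^ m)%:E)%E.
Proof.
move=> nm K0 s0; have s20 : 0 < s / 2 by rewrite divr_gt0.
case: (ltrP m 0) => m0.
  have hm : - n%:R < m < 0 by rewrite nm.
  have [C C0 HC] := integral_moment_neg hm s20.
  exists (expR (K ^+ 2 / s) * C); first by rewrite mulr_ge0 ?expR_ge0.
  move=> kappa k1.
  apply: (@le_trans _ _ (\int[mu]_eta (expR (K ^+ 2 / s) *
     (enorm (kappa + eta) `^ m * gaussn (s / 2) eta))%:E))%E.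
    apply: le_ge0_integral => eta.
      by rewrite lee_fin !mulr_ge0 ?powR_ge0 ?gaussn_ge0.
    rewrite lee_fin mulrAC mulrC (mulrCA (expR _)).
    by rewrite ler_wpM2l ?powR_ge0 ?poly_gaussn_le.
  rewrite ge0_integral_rVZl ?expR_ge0//; last 2 first.
  - apply: measurable_funM; last exact: measurable_gaussn.
    exact: measurable_enorm_shift_powR.
  - by move=> x; rewrite mulr_ge0 ?powR_ge0 ?gaussn_ge0.
  rewrite -(mulrA (expR _)) EFinM; apply: lee_wpmul2l; first by rewrite lee_fin expR_ge0.
  exact: HC.
exists (expR ((K + m) ^+ 2 / s) * Num.sqrt (2 * pi / (s / 2)) ^+ n).
  by rewrite mulr_ge0 ?expR_ge0 ?exprn_ge0 ?sqrtr_ge0.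
move=> kappa k1.
apply: (@le_trans _ _ (\int[mu]_eta (enorm kappa `^ m * expR ((K + m) ^+ 2 / s) *
   gaussn (s / 2) eta)%:E))%E.
  apply: le_ge0_integral => eta.
    by rewrite lee_fin !mulr_ge0 ?powR_ge0 ?gaussn_ge0.
  rewrite lee_fin -[leRHS]mulrA.
  have Km0 : 0 <= K + m by lra.
  apply: le_trans (ler_wpM2l (powR_ge0 (enorm kappa) m) (poly_gaussn_le eta Km0 s0)).
  have e1 : 1 + enorm eta != 0 by rewrite gt_eqF//; have := enorm_ge0 eta; lra.
  rewrite powRD; last by rewrite e1 implybT.
  have := enorm_shift_powR_le eta m0 k1.
  move=> /(ler_wpM2l (mulr_ge0 (powR_ge0 (1 + enorm eta) K) (gaussn_ge0 s eta))) H.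
  by apply: (le_trans _ (le_trans H _)); rewrite le_eqVlt; apply/orP; left; apply/eqP; ring.
rewrite ge0_integral_rVZl ?mulr_ge0 ?powR_ge0 ?expR_ge0//; last 2 first.
- exact: measurable_gaussn.
- by move=> x; rewrite gaussn_ge0.
rewrite integral_gaussn// -EFinM lee_fin le_eqVlt; apply/orP; left; apply/eqP; ring.
Qed.

End moments.

(** * Oscillating Gaussians are Schwartz functions *)

Section schwartz_gauss.
Context {R : realType} {n : nat}.
Implicit Types (x z v : 'rV[R]_n) (i j : 'I_n).

Lemma is_diff_coord j x :
  is_diff x (fun y : 'rV[R]_n => y ord0 j) (fun y => y ord0 j).
Proof.
have @f : {linear 'rV[R]_n -> R}.
  by exists (fun y : 'rV[R]_n => y ord0 j); do 2![eexists]; do ?[constructor];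
     rewrite ?mxE// => ? *; rewrite ?mxE//; move=> ?; rewrite !mxE.
apply: DiffDef; first exact: differentiable_coord.
by rewrite (_ : (fun _ => _) = f)// diff_lin//; exact: coord_continuous.
Qed.

Lemma derive_is_diff (f df : 'rV[R]_n -> R) x v : is_diff x f df ->
  differentiable f x /\ 'D_v f x = df v.
Proof.
by move=> d; split; [apply: ex_diff | rewrite deriveE ?diff_val//; apply: ex_diff].
Qed.

Lemma is_diff_bigsum (I : Type) (r : seq I) (f df : I -> 'rV[R]_n -> R) x :
  (forall k, is_diff x (f k) (df k)) ->
  is_diff x (\sum_(k <- r) f k) (\sum_(k <- r) df k).
Proof.
move=> H; elim: r => [|k r IH]; first by rewrite !big_nil; exact: is_diff_cst.
by rewrite !big_cons; exact: is_diffD.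
Qed.

Lemma is_diff_dot z x : is_diff x (dot z) (dot z).
Proof.
have -> : dot z = \sum_i (z ord0 i *: (fun y : 'rV[R]_n => y ord0 i)).
  by apply/funext => y; rewrite /dot fct_sumE.
by apply: is_diff_bigsum => i; apply: is_diffZ; exact: is_diff_coord.
Qed.

Lemma is_diff_sqr x : is_diff x (fun y : 'rV[R]_n => dot y y) (fun y => 2 * dot x y).
Proof.
rewrite (_ : (fun y => dot y y) = \sum_i ((fun y : 'rV[R]_n => y ord0 i) * (fun y => y ord0 i))); last first.
  by apply/funext => y; rewrite /dot fct_sumE.
rewrite (_ : (fun y => 2 * _) = \sum_i (x ord0 i *: (fun y : 'rV[R]_n => y ord0 i) +
    x ord0 i *: (fun y => y ord0 i))); last first.
  apply/funext => y; rewrite /dot fct_sumE mulr_sumr; apply: eq_bigr => i _.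
  by rewrite mulr_natl mulr2n.
by apply: is_diff_bigsum => i; apply: is_diffM; exact: is_diff_coord.
Qed.

Lemma is_diff_comp1 (g : R -> R) (u du : 'rV[R]_n -> R) dg x :
  is_derive (u x) 1 g dg -> is_diff x u du ->
  is_diff x (g \o u) (fun y => du y * dg).
Proof.
move=> [dg1 dg2] du1.
have dgx : differentiable g (u x) by exact/derivable1_diffP.
have G : is_diff (u x) g ('d g (u x)) by exact: DiffDef.
apply: (is_diff_eq (is_diff_comp du1 G)).
by apply/funext => y /=; rewrite diff1E//= derive1E dg2.
Qed.

(* A class of Schwartz functions that is stable under partial derivatives. *)
Inductive gosc : ('rV[R]_n -> R) -> Prop :=
| gosc_base c z s : 0 < s -> gosc (fun x => cos (c + dot z x) * gaussn s x)
| gosc_coord i h : gosc h -> gosc (fun x => x ord0 i * h x)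
| gosc_add h1 h2 : gosc h1 -> gosc h2 -> gosc (fun x => h1 x + h2 x)
| gosc_scale k h : gosc h -> gosc (fun x => k * h x).

Lemma gosc_derive i h : gosc h -> exists2 h', gosc h' &
  forall x, differentiable h x /\ 'D_(delta_mx ord0 i) h x = h' x.
Proof.
have dot_delta z : dot z (delta_mx ord0 i) = z ord0 i.
  rewrite /dot (bigD1 i)//= mxE !eqxx mulr1 big1 ?addr0// => j ji.
  by rewrite mxE (negbTE ji) andbF mulr0.
move=> gh0; elim: gh0 => {h} 
  [c z s s0|j h gh [h' gh' dh]|h1 h2 gh1 [h1' gh1' dh1] gh2 [h2' gh2' dh2]|k h gh [h' gh' dh]].
- exists (fun x => z ord0 i * (cos ((c + pi / 2) + dot z x) * gaussn s x)
       + (- s) * (x ord0 i * (cos (c + dot z x) * gaussn s x))).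
    by apply: gosc_add; apply: gosc_scale; [|apply: gosc_coord]; exact: gosc_base.
  move=> x.
  have d1 : is_diff x (fun x => c + dot z x) (dot z).
    have := is_diffD (is_diff_cst c x) (is_diff_dot z x).
    by rewrite add0r.
  have d2 : is_diff x (fun x => - (s / 2 * dot x x)) (fun y => - (s / 2 * (2 * dot x y))).
    exact: (is_diffN (is_diffZ (s / 2) (is_diff_sqr x))).
  have d3 := is_diff_comp1 (is_derive_cos _) d1.
  have d4 := is_diff_comp1 (is_derive_expR _) d2.
  have d5 := is_diffM d3 d4.
  have [d6 d7] := derive_is_diff (delta_mx ord0 i) d5.
  split; first exact: d6.
  rewrite [LHS]d7 /= !fctE/= !dot_delta -/(gaussn s x).
  have -> : cos (c + pi / 2 + dot z x) = - sin (c + dot z x).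
    by rewrite addrAC cosD cos_pihalf sin_pihalf mulr0 mulr1 sub0r.
  rewrite /GRing.scale/=; by field.
- exists (fun x => (j == i)%:R * h x + x ord0 j * h' x).
    by apply: gosc_add; [exact: gosc_scale|exact: gosc_coord].
  move=> x; have [dhx Dhx] := dh x.
  have d5 := is_diffM (is_diff_coord j x) (differentiableP dhx).
  have [d6 d7] := derive_is_diff (delta_mx ord0 i) d5.
  split; first exact: d6.
  rewrite [LHS]d7 /= !fctE/= -deriveE// Dhx mxE eqxx/= /GRing.scale/=.
  by rewrite addrC mulrC.
- exists (fun x => h1' x + h2' x); first exact: gosc_add.
  move=> x; have [a1 b1] := dh1 x; have [a2 b2] := dh2 x.
  have [d6 d7] := derive_is_diff (delta_mx ord0 i) (is_diffD (differentiableP a1) (differentiableP a2)).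
  by split; [exact: d6|rewrite [LHS]d7 !fctE/= -!deriveE// b1 b2].
- exists (fun x => k * h' x); first exact: gosc_scale.
  move=> x; have [a1 b1] := dh x.
  have [d6 d7] := derive_is_diff (delta_mx ord0 i) (is_diffZ k (differentiableP a1)).
  by split; [exact: d6|rewrite [LHS]d7 !fctE/= -!deriveE// b1].
Qed.

Lemma gosc_bounded h : gosc h -> exists M s, 0 < s /\
  forall x, `|h x| <= M * gaussn s x.
Proof.
move=> gh0; elim: gh0 => {h} 
  [c z s s0|j h gh [M [s [s0 hM]]]|h1 h2 _ [M1 [s1 [s10 hM1]]] _ [M2 [s2 [s20 hM2]]]|k h _ [M [s [s0 hM]]]].
- exists 1, s; split=> // x; rewrite mul1r normrM [X in _ * X]ger0_norm ?gaussn_ge0//.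
  by rewrite ler_piMl ?gaussn_ge0// normr_cos_le1.
- exists (M * (s^-1 + 1)), (s / 2); split; first by rewrite divr_gt0.
  move=> x; rewrite normrM.
  have M0 : 0 <= M.
    have := le_trans (normr_ge0 _) (hM x).
    by rewrite pmulr_lge0 ?gaussn_gt0.
  apply: (le_trans (ler_wpM2l (normr_ge0 _) (hM x))).
  rewrite mulrCA -mulrA ler_wpM2l//.
  apply: (@le_trans _ _ (enorm x * gaussn s x)).
    by rewrite ler_wpM2r ?gaussn_ge0// normr_coord_le.
  have := normr_gauss_le (enorm x) s0.
  by rewrite ger0_norm ?enorm_ge0// /gauss !sqr_enorm.
- have M10 : 0 <= M1.
    have := le_trans (normr_ge0 _) (hM1 0).
    by rewrite pmulr_lge0 ?gaussn_gt0.
  have M20 : 0 <= M2.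
    have := le_trans (normr_ge0 _) (hM2 0).
    by rewrite pmulr_lge0 ?gaussn_gt0.
  exists (M1 + M2), (Num.min s1 s2); split; first by rewrite lt_min s10.
  move=> x; apply: (le_trans (ler_normD _ _)); rewrite mulrDl.
  have le s : Num.min s1 s2 <= s -> gaussn s x <= gaussn (Num.min s1 s2) x.
    by move=> h; rewrite ler_expR lerN2 ler_wpM2r ?dot_ge0//; lra.
  apply: lerD.
    by apply: (le_trans (hM1 x)); rewrite ler_wpM2l// le// ge_min lexx.
  by apply: (le_trans (hM2 x)); rewrite ler_wpM2l// le// ge_min lexx orbT.
- exists (`|k| * M), s; split=> // x; rewrite normrM -mulrA.
  by rewrite ler_wpM2l.
Qed.

Lemma gosc_iter_partial (s : seq 'I_n) h : gosc h -> gosc (iter_partial s h).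
Proof.
elim: s => [//|i s IH] gh /=; have [h' gh' dh] := gosc_derive i (IH gh).
by rewrite (_ : 'D_(delta_mx ord0 i) _ = h')//; apply/funext => x; have [] := dh x.
Qed.

Lemma gosc_monomial (r : seq 'I_n) (alpha : 'I_n -> nat) h : gosc h ->
  gosc (fun x => (\prod_(i <- r) x ord0 i ^+ alpha i) * h x).
Proof.
move=> gh; elim: r => [|i r IH].
  by rewrite (_ : (fun x => _) = h)//; apply/funext => x; rewrite big_nil mul1r.
rewrite (_ : (fun x => _) = (fun x => x ord0 i ^+ alpha i *
  ((\prod_(i <- r) x ord0 i ^+ alpha i) * h x))); last first.
  by apply/funext => x; rewrite big_cons mulrA.
elim: (alpha i) => [|k IHk].
  by rewrite (_ : (fun x => _) = (fun x => (\prod_(i <- r) x ord0 i ^+ alpha i) * h x))//;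
    apply/funext => x; rewrite expr0 mul1r.
rewrite (_ : (fun x => _) = (fun x => x ord0 i * (x ord0 i ^+ k *
  ((\prod_(i <- r) x ord0 i ^+ alpha i) * h x)))); last first.
  by apply/funext => x; rewrite exprS !mulrA.
exact: gosc_coord.
Qed.

Lemma gosc_schwartz h : (0 < n)%N -> gosc h -> real_schwartz h.
Proof.
move=> n0 gh r; have gr := gosc_iter_partial r gh; split=> [x|alpha].
  by have [h' _ dh] := gosc_derive (Ordinal n0) gr; have [] := dh x.
have [M [s [s0 hM]]] := gosc_bounded (gosc_monomial (index_enum _) alpha gr).
exists M => x; apply: (le_trans (hM x)).
have M0 : 0 <= M.
  have := le_trans (normr_ge0 _) (hM 0).
  by rewrite pmulr_lge0 ?gaussn_gt0.
by rewrite ler_piMr// gaussn_le1// ltW.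
Qed.

Lemma gosc_sum (I : Type) (r : seq I) (h : I -> 'rV[R]_n -> R) :
  (forall k, gosc (h k)) -> gosc (fun x => \sum_(k <- r) h k x).
Proof.
move=> gh; elim: r => [|k r IH].
  rewrite (_ : (fun x => _) = (fun x => 0 * (cos (0 + dot 0 x) * gaussn 1 x))).
    by apply: gosc_scale; exact: gosc_base.
  by apply/funext => x; rewrite big_nil mul0r.
rewrite (_ : (fun x => _) = (fun x => h k x + \sum_(k <- r) h k x)).
  exact: gosc_add.
by apply/funext => x; rewrite big_cons.
Qed.

End schwartz_gauss.

(** * Wave packets *)

Local Open Scope complex_scope.

Section wave_packets.
Context {R : realType} {n : nat}.
Local Notation mu := (lebesgue_rV R n).
Implicit Types (x xi : 'rV[R]_n).

Lemma Rintegral_sum (J : Type) (r : seq J) (h : J -> 'rV[R]_n -> R) :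
  (forall k, mu.-integrable setT (EFin \o h k)) ->
  mu.-integrable setT (EFin \o (fun x => \sum_(k <- r) h k x)) /\
  \int[mu]_x (\sum_(k <- r) h k x) = \sum_(k <- r) \int[mu]_x h k x.
Proof.
move=> ih; elim: r => [|k r [IH1 IH2]].
  have E : (fun x : 'rV[R]_n => \sum_(k <- [::]) h k x) = cst 0.
    by apply/funext => x; rewrite big_nil.
  split; last by rewrite E big_nil /Rintegral integral0.
  by rewrite E (_ : EFin \o cst 0 = cst 0%E)//; exact: integrable0.
have E : (fun x => \sum_(k <- k :: r) h k x) = (fun x => h k x + \sum_(k <- r) h k x).
  by apply/funext => x; rewrite big_cons.
rewrite E; split; first exact: (integrableD measurableT (ih k) IH1).
by rewrite big_cons RintegralD// IH2.
Qed.

Lemma sin_cosB (u : R) : sin u = cos (u - pi / 2).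
Proof. by rewrite cosB cos_pihalf sin_pihalf mulr0 add0r mulr1. Qed.

Lemma Re_le_normc (w : R[i]) : complex.Re w <= Normc.normc w.
Proof.
case: w => a b /=; apply: (le_trans (ler_norm a)).
by rewrite -sqrtr_sqr ler_wsqrtr// lerDl sqr_ge0.
Qed.

Variables (I : finType) (b al t : I -> R) (z : I -> 'rV[R]_n).
Hypothesis t0 : forall k, 0 < t k.

(** The sum of [b k * exp (i (al k + z k . x)) * gaussn (t k) x], split into components because
    integrals and the Schwartz condition are componentwise. *)
Definition wave_packet x : R[i] :=
  (\sum_k b k * (cos (al k + dot (z k) x) * gaussn (t k) x)) +i*
  (\sum_k b k * (sin (al k + dot (z k) x) * gaussn (t k) x)).

(** With [cos] and [sin] for [g] these are the two components of the Fourier transform; a general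
    [g] lets one estimate serve both. *)
Definition wave_amplitude (g : R -> R) xi : R :=
  \sum_k b k * g (al k) *
    (Num.sqrt (2 * pi / t k) ^+ n * gaussn (t k)^-1 (xi - z k)).

Lemma schwartz_wave_packet : (0 < n)%N -> schwartz wave_packet.
Proof.
move=> n0; split => /=; apply: gosc_schwartz => //; apply: gosc_sum => k;
  apply: gosc_scale; first exact: gosc_base.
rewrite (_ : (fun x => _) =
  (fun x => cos ((al k - pi / 2) + dot (z k) x) * gaussn (t k) x)).
  exact: gosc_base.
by apply/funext => x; rewrite sin_cosB addrAC.
Qed.

(** The shift [c] is used at [0] and at [pi / 2], so one computation yields both the cosine and the
    sine integrals. *)
Lemma Rintegral_wave (c : R) xi :
  \int[mu]_x (\sum_k b k * (cos (al k - c + dot (z k - xi) x) * gaussn (t k) x)) =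
  \sum_k b k * (cos (al k - c) *
    (Num.sqrt (2 * pi / t k) ^+ n * gaussn (t k)^-1 (xi - z k))).
Proof.
have ic k := integrable_cos_gaussn (al k - c) (z k - xi) (t0 k).
rewrite (Rintegral_sum _ (fun k => integrableZl measurableT (b k) (ic k))).2.
apply: eq_bigr => k _; rewrite RintegralZl// Rintegral_cos_gaussn// -mulrA.
by rewrite -(opprB xi) /gaussn dotNl dotNr opprK.
Qed.

Lemma fourier_wave_packet xi :
  fourier wave_packet xi = wave_amplitude cos xi +i* wave_amplitude sin xi.
Proof.
rewrite /fourier /cintegral; congr (_ +i* _).
  transitivity (\int[mu]_x (\sum_k b k * (cos (al k - 0 + dot (z k - xi) x) * gaussn (t k) x))).
    apply: eq_Rintegral => x _.
    rewrite /cexpi /wave_packet /= cosN sinN mulNr opprK !mulr_sumr -big_split/=.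
    apply: eq_bigr => k _; rewrite subr0 dotDl dotNl addrA (dotC xi x) cosB; ring.
  by rewrite Rintegral_wave; apply: eq_bigr => k _; rewrite subr0 mulrA.
transitivity (\int[mu]_x (\sum_k b k * (cos (al k - pi / 2 + dot (z k - xi) x) * gaussn (t k) x))).
  apply: eq_Rintegral => x _.
  rewrite /cexpi /wave_packet /= cosN sinN mulNr !mulr_sumr -sumrN -big_split/=.
  apply: eq_bigr => k _; rewrite (addrAC (al k)) -sin_cosB.
  by rewrite dotDl dotNl addrA (dotC xi x) sinB; ring.
by rewrite Rintegral_wave; apply: eq_bigr => k _; rewrite -sin_cosB mulrA.
Qed.

Lemma measurable_wave_amplitude g : measurable_fun setT (wave_amplitude g).
Proof.
apply: measurable_sum => k; apply: measurable_funM => //; apply: measurable_funM => //.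
rewrite (_ : (fun xi => _) = gaussn (t k)^-1 \o (fun xi => 1 *: xi + (- z k))).
  exact: (measurableT_comp (measurable_gaussn _) (measurable_rV_affine _ _)).
by apply/funext => xi /=; rewrite scale1r.
Qed.

Variables (rho m : R).
Let phase xi := enorm xi `^ (1 - rho).

Lemma measurable_phase c x :
  measurable_fun setT (fun xi => cos (c + (dot x xi + phase xi))).
Proof.
apply: (measurableT_comp (f := @cos R)).
  by apply: continuous_measurable_fun; exact: continuous_cos.
apply: measurable_funD => //; apply: measurable_funD; first exact: measurable_dot.
exact: measurable_enorm_powR.
Qed.

Lemma cintegrable_symbol_wave (H : 'rV[R]_n -> R) :
  mu.-integrable setT (EFin \o H) ->
  (forall g, (forall u, `|g u| <= 1) ->
    forall xi, `|wave_amplitude g xi| * enorm xi `^ m <= H xi) ->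
  cintegrable mu (fun xi => oscillating_symbol rho m xi * fourier wave_packet xi).
Proof.
move=> iH hH.
have mc := @measurable_phase 0 0.
have ms := @measurable_phase (- (pi / 2)) 0.
have mcos : measurable_fun setT (fun xi : 'rV[R]_n => cos (phase xi)).
  by move: mc; under eq_fun do rewrite dot0l !add0r.
have msin : measurable_fun setT (fun xi : 'rV[R]_n => sin (phase xi)).
  by move: ms; under eq_fun do rewrite dot0l add0r addrC -sin_cosB.
have mm := @measurable_enorm_powR R n m.
have iH2 := integrableZl measurableT 2 iH.
have bnd c s xi : `|c| <= 1 -> `|s| <= 1 ->
  `|enorm xi `^ m * (c * wave_amplitude cos xi) +
    enorm xi `^ m * (s * wave_amplitude sin xi)| <= 2 * H xi.
  move=> c1 s1; rewrite mulrDl mul1r; apply: (le_trans (ler_normD _ _)).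
  have H1 := hH _ normr_cos_le1 xi; have H2 := hH _ normr_sin_le1 xi.
  apply: lerD; rewrite !normrM (ger0_norm (powR_ge0 _ _)) mulrCA.
    apply: le_trans (ler_piMl _ c1) _; first by rewrite mulr_ge0 ?powR_ge0.
    by rewrite mulrC.
  apply: le_trans (ler_piMl _ s1) _; first by rewrite mulr_ge0 ?powR_ge0.
  by rewrite mulrC.
split; apply: le_norm_integrable iH2 _ => [|xi].
- rewrite (_ : (fun xi => _) = (fun xi => enorm xi `^ m * (cos (phase xi) * wave_amplitude cos xi)
    + enorm xi `^ m * (- sin (phase xi) * wave_amplitude sin xi))); last first.
    apply/funext => xi; rewrite fourier_wave_packet /oscillating_symbol /cexpi /=.
    by rewrite /phase; ring.
  apply: measurable_funD; apply: measurable_funM => //; apply: measurable_funM => //.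
  + exact: measurable_wave_amplitude.
  + exact: measurableT_comp.
  + exact: measurable_wave_amplitude.
- rewrite fourier_wave_packet /oscillating_symbol /cexpi /=.
  have := bnd (cos (phase xi)) (- sin (phase xi)) xi (normr_cos_le1 _).
  rewrite normrN => /(_ (normr_sin_le1 _)).
  by apply: le_trans; rewrite le_eqVlt; apply/orP; left; apply/eqP; congr `|_|; rewrite /phase; ring.
- rewrite (_ : (fun xi => _) = (fun xi => enorm xi `^ m * (sin (phase xi) * wave_amplitude cos xi)
    + enorm xi `^ m * (cos (phase xi) * wave_amplitude sin xi))); last first.
    apply/funext => xi; rewrite fourier_wave_packet /oscillating_symbol /cexpi /=.
    by rewrite /phase; ring.
  apply: measurable_funD; apply: measurable_funM => //; apply: measurable_funM => //;
    exact: measurable_wave_amplitude.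
- rewrite fourier_wave_packet /oscillating_symbol /cexpi /=.
  have := bnd (sin (phase xi)) (cos (phase xi)) xi (normr_sin_le1 _) (normr_cos_le1 _).
  by apply: le_trans; rewrite le_eqVlt; apply/orP; left; apply/eqP; congr `|_|; rewrite /phase; ring.
Qed.

(** Lower bounds are only sought for the real part, which [Re_le_normc] transfers to the modulus.
    The packet phase, [dot x xi] and the phase of the symbol merge into a single cosine. *)
Lemma Re_multiplier_wave x :
  complex.Re (multiplier_op (oscillating_symbol rho m) wave_packet x) =
  (2 * pi) ^- n * \int[mu]_xi (enorm xi `^ m * (\sum_k b k *
    cos (al k + (dot x xi + phase xi)) *
    (Num.sqrt (2 * pi / t k) ^+ n * gaussn (t k)^-1 (xi - z k)))).
Proof.
have Ef : fourier wave_packet =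
    fun xi => wave_amplitude cos xi +i* wave_amplitude sin xi.
  by apply/funext => xi; exact: fourier_wave_packet.
rewrite /multiplier_op Ef /cintegral /= mul0r subr0; congr (_ * _).
apply: eq_Rintegral => xi _.
rewrite /= /wave_amplitude -/(phase xi).
transitivity (enorm xi `^ m * (cos (dot x xi + phase xi) * (\sum_k b k * cos (al k) *
    (Num.sqrt (2 * pi / t k) ^+ n * gaussn (t k)^-1 (xi - z k)))
  - sin (dot x xi + phase xi) * (\sum_k b k * sin (al k) *
    (Num.sqrt (2 * pi / t k) ^+ n * gaussn (t k)^-1 (xi - z k))))).
  by rewrite cosD sinD; ring.
congr (_ * _); rewrite !mulr_sumr -sumrB; apply: eq_bigr => k _.
by rewrite [cos (al k + _)]cosD; ring.
Qed.

End wave_packets.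

(** * Testing boundedness on boxes *)

Section boundedness_test.
Context {R : realType} {n : nat}.
Local Notation mu := (lebesgue_rV R n).
Implicit Types (x : 'rV[R]_n).

Lemma integral_box (h : R) : 0 < h ->
  (\int[mu]_x (\prod_i (\1_(`]h, (2 * h)%R]%classic : set R) (x ord0 i) : R))%:E
   = (h ^+ n)%:E)%E.
Proof.
move=> h0; rewrite (@ge0_integral_rV_prod R n (fun=> \1_`]h, (2 * h)%R]) (fun=> h)).
- by rewrite prodr_const card_ord.
- by move=> i; exact: measurable_indic.
- by [].
- move=> i; rewrite integral_indic//= setIT lebesgue_measure_itv/= lte_fin.
  by rewrite ifT ?EFinN -?EFinB; [congr EFin; ring|lra].
Qed.

(** On the box []h, 2h]^n] one has [|x| <= 2 h * Num.sqrt n%:R], so for [s < 0] the weight is at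
    least a multiple of [h^(p s)], and the volume is [h^n]: a pointwise lower bound becomes a norm
    bound. [C] is independent of [f], [h], [c] and [B], so whole families of test functions may be
    inserted. *)
Lemma multiplier_bounded_test (a : 'rV[R]_n -> R[i]) (p q s : R) :
  (0 < n)%N -> 0 < p -> 0 < q -> s < 0 ->
  multiplier_bounded a q (fun x => enorm x `^ (q * s))
                       p (fun x => enorm x `^ (p * s)) ->
  exists2 C : R, 0 < C & forall f, schwartz f ->
    cintegrable mu (fun xi => a xi * fourier f xi) ->
  forall h c B : R, 0 < h -> 0 <= c ->
    (forall x, (forall i, h < x ord0 i <= 2 * h) ->
       c <= Normc.normc (multiplier_op a f x)) ->
    (\int[mu]_x (Normc.normc (f x) `^ q * enorm x `^ (q * s))%:E <= B%:E)%E ->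
    c * h `^ (n%:R / p + s) <= C * B `^ q^-1.
Proof.
move=> n0 p0 q0 s0 [C [C0 HC]].
pose D : R := (Num.sqrt n%:R * 2) `^ s.
have sn0 : 0 < Num.sqrt n%:R * 2 :> R by rewrite mulr_gt0// sqrtr_gt0 ltr0n.
have D0 : 0 < D by rewrite powR_gt0.
exists (C / D); first by rewrite divr_gt0.
move=> f Sf If h c B h0 c0 Hc HB.
have B0 : 0 <= B.
  rewrite -lee_fin; apply: le_trans HB; apply: integral_ge0 => x _.
  by rewrite lee_fin mulr_ge0 ?powR_ge0.
have := HC f Sf If; rewrite /weighted_norm.
set w0 := (Num.sqrt n%:R * (2 * h)) `^ (p * s).
have L : ((c `^ p * w0 * h ^+ n)%:E <=
    \int[mu]_x (Normc.normc (multiplier_op a f x) `^ p * enorm x `^ (p * s))%:E)%E.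
  rewrite EFinM -integral_box// -ge0_integral_rVZl//; last 3 first.
  - by rewrite mulr_ge0 ?powR_ge0.
  - apply: measurable_prod => i _.
    have mind : measurable_fun setT (\1_`]h, (2 * h)%R]%classic : R -> R).
      exact: measurable_indic.
    exact: (measurableT_comp mind (measurable_rV_coord i)).
  - by move=> x; apply: prodr_ge0.
  apply: le_ge0_integral => x.
    by rewrite lee_fin !mulr_ge0 ?powR_ge0 ?prodr_ge0.
  rewrite lee_fin.
  have [hx|hx] := boolP [forall i, h < x ord0 i <= 2 * h]; last first.
    move: hx; rewrite negb_forall => /existsP[i hi].
    rewrite (bigD1 i)//= indicE memNset ?mul0r ?mulr0 ?mulr_ge0 ?powR_ge0//.
    by rewrite /= in_itv/= (negbTE hi).
  have {}hx i : h < x ord0 i <= 2 * h by exact: (forallP hx).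
  rewrite big1 ?mulr1; last by move=> i _; rewrite indicE mem_set//= in_itv/=.
  apply: ler_pM; rewrite ?powR_ge0//.
    apply: ge0_ler_powR; rewrite ?nnegrE ?(ltW p0)//; first exact: le_trans (Hc x hx).
    exact: Hc.
  have xp i : `|x ord0 i| = x ord0 i by rewrite gtr0_norm//; have /andP[]:= hx i; lra.
  apply: ler_powR_npos.
  - by rewrite pmulr_rle0// ltW.
  - apply: lt_le_trans (normr_coord_le x (Ordinal n0)).
    by rewrite xp; have /andP[]:= hx (Ordinal n0); lra.
  - by apply: enorm_le => i; rewrite xp; have /andP[] := hx i.
move=> H.
have pi0 : 0 <= p^-1 by rewrite invr_ge0 ltW.
have qi0 : 0 <= q^-1 by rewrite invr_ge0 ltW.
have M0 : 0 <= c `^ p * w0 * h ^+ n by rewrite !mulr_ge0 ?powR_ge0 ?exprn_ge0 ?ltW.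
have : ((c `^ p * w0 * h ^+ n)%:E `^ p^-1 <= C%:E * (B%:E `^ q^-1))%E.
  have in0 (y : \bar R) : (0 <= y)%E -> y \in `[0%E, +oo%E].
    by move=> y0; rewrite in_itv/= leey andbT.
  have int0 (g : 'rV[R]_n -> R[i]) u v :
      (0 <= \int[mu]_x (Normc.normc (g x) `^ u * enorm x `^ v)%:E)%E.
    by apply: integral_ge0 => x _; rewrite lee_fin mulr_ge0 ?powR_ge0.
  apply: le_trans (le_trans H _).
    by apply: gt0_ler_poweR => //; apply: in0.
  apply: lee_wpmul2l; first by rewrite lee_fin ltW.
  by apply: gt0_ler_poweR => //; apply: in0.
rewrite !poweR_EFin -EFinM lee_fin => H2.
have h00 := ltW h0.
have E0 : (Num.sqrt n%:R * (2 * h)) `^ s = D * h `^ s.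
  by rewrite mulrA powRM ?mulr_ge0 ?sqrtr_ge0.
have E1 : (c `^ p * w0 * h ^+ n) `^ p^-1 = D * (c * h `^ (n%:R / p + s)).
  rewrite powRM ?mulr_ge0 ?powR_ge0 ?exprn_ge0// powRM ?powR_ge0//.
  rewrite -powRrM divff ?gt_eqF// powRr1// /w0 -powRrM (mulrAC p) divff ?gt_eqF// mul1r.
  rewrite -powR_mulrn// -powRrM E0.
  have hn : h != 0 by rewrite gt_eqF.
  by rewrite powRD; [ring|rewrite hn implybT].
move: H2; rewrite E1 => H2.
by rewrite -(ler_pM2l D0) (le_trans H2)// mulrA mulrCA divff ?mulr1 ?gt_eqF.
Qed.

End boundedness_test.

(** * Elementary inequalities for cosines and powers *)

Section scalar.
Context {R : realType}.
Implicit Types (r m u v X tau : R).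

Lemma normr_cosB_le u v : `|cos u - cos v| <= `|u - v|.
Proof.
wlog uv : u v / u <= v.
  move=> H; case: (leP u v) => [/H//|/ltW /H h].
  by rewrite -(distrC (cos v)) -(distrC v).
have [c _ E] : exists2 c, c \in `[u, v] & cos v - cos u = - sin c * (v - u).
  apply: (@MVT_segment R (@cos R) (fun x => - sin x) u v uv).
  - by apply/continuous_subspaceT => t; exact: continuous_cos.
by rewrite -(distrC (cos v)) E normrM normrN -(distrC v) ler_piMl// normr_sin_le1.
Qed.

Lemma ln_le_subr1 r : 0 < r -> ln r <= r - 1.
Proof. by move=> r0; have := @le_ln1Dx R (r - 1); rewrite addrCA subrr addr0; apply; lra. Qed.

(** For [r <= 1 / 2] the factor [2 * |r - 1|] is at least one and the triangle inequality suffices.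
    For larger [r] one has [|ln r| <= 2 * |r - 1|], combined with [expR_ge1Dx] at [m * ln r] and at
    its opposite. The factor [1 + r^m] accommodates both signs of [m]. *)
Lemma normr_powR_sub1_le m r : 0 <= r ->
  `|r `^ m - 1| <= 2 * (`|m| + 1) * `|r - 1| * (1 + r `^ m).
Proof.
move=> r0; have p0 := powR_ge0 r m; have m0 := normr_ge0 m.
case: (lerP r (1 / 2)) => r2.
  have h : `|r `^ m - 1| <= 1 + r `^ m by rewrite ler_norml; apply/andP; split; lra.
  apply: (le_trans h); rewrite ler_peMl ?addr_ge0//.
  have -> : `|r - 1| = 1 - r by rewrite ltr0_norm; lra.
  nra.
have rp : 0 < r by lra.
have lnr : `|ln r| <= 2 * `|r - 1|.
  have l1 := ln_le_subr1 rp.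
  have ri : 0 < r^-1 by rewrite invr_gt0.
  have l2 := ln_le_subr1 ri; rewrite lnV ?posrE// in l2.
  have l3 : r^-1 - 1 <= 2 * `|r - 1|.
    have -> : r^-1 - 1 = r^-1 * (1 - r) by field; rewrite gt_eqF.
    have ri2 : r^-1 <= 2 by rewrite -[leRHS]invrK lef_pV2 ?posrE//; lra.
    apply: (le_trans (ler_norm _)); rewrite normrM (gtr0_norm ri) (distrC 1).
    by rewrite ler_wpM2r.
  by rewrite ler_norml; apply/andP; split; have := ler_norm (r - 1); have := normr_ge0 (r-1); lra.
have E : r `^ m = expR (m * ln r) by rewrite /powR gt_eqF.
have h1 : m * ln r <= r `^ m - 1 by have := expR_ge1Dx (m * ln r); rewrite -E; lra.
have h2 : r `^ m - 1 <= r `^ m * (m * ln r).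
  have := expR_ge1Dx (- (m * ln r)); rewrite expRN -E => h.
  have rm0 : 0 < r `^ m by rewrite powR_gt0.
  have := ler_wpM2l p0 h; rewrite divff ?gt_eqF//; lra.
have h3 : `|m * ln r| <= `|m| * (2 * `|r - 1|) by rewrite normrM ler_wpM2l.
have h4 : `|m * ln r| <= 2 * (`|m| + 1) * `|r - 1| by have := normr_ge0 (r - 1); nra.
have /andP[h5 h6] : - `|m * ln r| <= m * ln r <= `|m * ln r| by rewrite -ler_norml.
have h7 := normr_ge0 (m * ln r).
apply: (@le_trans _ _ (`|m * ln r| * (1 + r `^ m))); last by rewrite ler_wpM2r ?addr_ge0.
rewrite ler_norml; apply/andP; split; nra.
Qed.

(** Above: concavity of the logarithm between [X] and [1], through [ln x <= x - 1] at [X / Z] and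
    [1 / Z]. Below: [X^tau = X * X^(tau - 1)] and [ln X <= X - 1], which miss the tangent by
    [(1 - tau) * (X - 1) ^+ 2]. The value [X = 0] is included because [kappa + eta] may vanish in
    the application. *)
Lemma normr_powR_tangent_le tau X : 0 < tau < 1 -> 0 <= X ->
  `|X `^ tau - 1 - tau * (X - 1)| <= (X - 1) ^+ 2.
Proof.
move=> /andP[t0 t1]; rewrite le_eqVlt => /orP[/eqP<-|X0].
  by rewrite powR0 ?gt_eqF// ler_norml; apply/andP; split; nra.
have E : X `^ tau = expR (tau * ln X) by rewrite /powR gt_eqF.
have lX := ln_le_subr1 X0.
have up : X `^ tau <= 1 + tau * (X - 1).
  pose Z := 1 + tau * (X - 1); have Z0 : 0 < Z by rewrite /Z; nra.
  have XZ : 0 < X / Z by rewrite divr_gt0.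
  have Zi : 0 < Z^-1 by rewrite invr_gt0.
  have l1 := ln_le_subr1 XZ; have l2 := ln_le_subr1 Zi.
  rewrite ln_div ?posrE// in l1; rewrite lnV ?posrE// in l2.
  have EZ : tau * (X / Z) + (1 - tau) * Z^-1 = 1 by rewrite /Z; field; rewrite gt_eqF// -/Z.
  have l3 := ler_wpM2l (ltW t0) l1.
  have l4 : (1 - tau) * (- ln Z) <= (1 - tau) * (Z^-1 - 1) by rewrite ler_wpM2l//; lra.
  have l5 : tau * ln X <= ln Z by lra.
  by rewrite E -(lnK (x := 1 + _)) ?posrE// ler_expR.
have lo : X * (1 + (tau - 1) * (X - 1)) <= X `^ tau.
  have -> : X `^ tau = X * X `^ (tau - 1).
    by rewrite -{2}(powRr1 (ltW X0)) -powRD; [congr powR; ring|rewrite (gt_eqF X0) implybT].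
  rewrite ler_pM2l// /powR gt_eqF//.
  apply: le_trans (expR_ge1Dx _); rewrite lerD2l.
  by rewrite ler_wnM2l//; lra.
rewrite ler_norml; apply/andP; split; nra.
Qed.

Lemma powR_le_1D u a : 0 <= u -> 0 <= a <= 1 -> u `^ a <= 1 + u.
Proof.
move=> u0 /andP[a0 a1]; case: (lerP u 1) => u1.
  have : u `^ a <= 1 `^ a by apply: ge0_ler_powR; rewrite ?nnegrE.
  by rewrite powR1; lra.
have : u `^ a <= u `^ 1 by apply: ler_powR => //; exact: ltW.
by rewrite powRr1//; lra.
Qed.

End scalar.

(** * The oscillatory integral of one wave packet *)

Section mixture.
Context {R : realType} {n : nat}.
Local Notation mu := (lebesgue_rV R n).
Implicit Types (x y eta kappa : 'rV[R]_n).

Definition mix_coef (k : nat) (j : 'I_k.+1) : R := (-1) ^+ j *+ 'C(k, j).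

Definition mix_rate (k : nat) (j : 'I_k.+1) : R := j.+1%:R.

Lemma mix_rate_gt0 k (j : 'I_k.+1) : 0 < mix_rate j.
Proof. by rewrite ltr0n. Qed.

(* Equal to [g (1 - g)^k] for the standard Gaussian [g] ([mixtureE]), hence
   vanishing to order [2 * k] at [0], with an explicit Fourier transform. *)
Definition mixture (k : nat) y : R := \sum_(j < k.+1) mix_coef j * gaussn (mix_rate j) y.

Definition mixture_hat (k : nat) eta : R := \sum_(j < k.+1)
  mix_coef j * (Num.sqrt (2 * pi / mix_rate j) ^+ n * gaussn (mix_rate j)^-1 eta).

Lemma gaussn_exp (j : nat) y : gaussn 1 y ^+ j = gaussn j%:R y.
Proof. by rewrite /gaussn -expRM_natl; congr expR; move: (j%:R : R) => J; ring. Qed.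

Lemma mixtureE k y : mixture k y = gaussn 1 y * (1 - gaussn 1 y) ^+ k.
Proof.
rewrite exprDn mulr_sumr; apply: eq_bigr => j _.
by rewrite expr1n mul1r exprNn /mix_coef /mix_rate -gaussn_exp exprS mulrnAr mulrnAl mulrCA.
Qed.

Lemma mixture_hat_bound k : exists2 C, 0 <= C & forall eta,
  `|mixture_hat k eta| <= C * gaussn (k.+1%:R^-1) eta.
Proof.
exists (\sum_(j < k.+1) `|mix_coef j| * Num.sqrt (2 * pi / mix_rate j) ^+ n).
  by apply: sumr_ge0 => j _; rewrite mulr_ge0 ?exprn_ge0 ?sqrtr_ge0.
move=> eta; apply: (le_trans (ler_norm_sum _ _ _)).
rewrite mulr_suml; apply: ler_sum => j _; rewrite normrM -(mulrA `|_|) ler_wpM2l//.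
rewrite normrM (ger0_norm (gaussn_ge0 _ _)) ger0_norm ?exprn_ge0 ?sqrtr_ge0//.
rewrite ler_wpM2l ?exprn_ge0 ?sqrtr_ge0// ler_expR lerN2 ler_wpM2r ?dot_ge0//.
rewrite ler_wpM2r ?invr_ge0// lef_pV2 ?posrE ?ltr0n//.
by rewrite ler_nat ltn_ord.
Qed.

Lemma measurable_mixture_hat k : measurable_fun setT (@mixture_hat k).
Proof.
apply: measurable_sum => j; apply: measurable_funM => //; apply: measurable_funM => //.
exact: measurable_gaussn.
Qed.

Lemma Rintegral_cos_mixture_hat k y :
  \int[mu]_eta (cos (dot y eta) * mixture_hat k eta) = (2 * pi) ^+ n * mixture k y.
Proof.
transitivity (\int[mu]_eta (\sum_(j < k.+1) (mix_coef j * Num.sqrt (2 * pi / mix_rate j) ^+ n) *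
    (cos (0 + dot y eta) * gaussn (mix_rate j)^-1 eta))).
  by apply: eq_Rintegral => eta _; rewrite mulr_sumr; apply: eq_bigr => j _; rewrite add0r; ring.
have r0 (j : 'I_k.+1) : 0 < (mix_rate j)^-1 by rewrite invr_gt0 mix_rate_gt0.
have ic (j : 'I_k.+1) := integrable_cos_gaussn 0 y (r0 j).
rewrite (Rintegral_sum _ (fun j => integrableZl measurableT
  (mix_coef j * Num.sqrt (2 * pi / mix_rate j) ^+ n) (ic j))).2.
rewrite mulr_sumr; apply: eq_bigr => j _.
rewrite RintegralZl// Rintegral_cos_gaussn// cos0 mul1r invrK.
have : Num.sqrt (2 * pi / mix_rate j) ^+ n * Num.sqrt (2 * pi * mix_rate j) ^+ n = (2 * pi) ^+ n.
  rewrite -exprMn -sqrtrM; last by rewrite divr_ge0 ?mulr_ge0 ?pi_ge0// ltW ?mix_rate_gt0.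
  rewrite (_ : 2 * pi / mix_rate j * (2 * pi * mix_rate j) = (2 * pi) ^+ 2); last by field; rewrite gt_eqF ?mix_rate_gt0.
  by rewrite sqrtr_sqr ger0_norm// mulr_ge0 ?pi_ge0.
by move=> <-; ring.
Qed.

Lemma integrable_poly_gaussn (K s : R) : 0 <= K -> 0 < s ->
  mu.-integrable setT (EFin \o (fun x => (1 + enorm x) `^ K * gaussn s x)).
Proof.
move=> K0 s0; have s20 : 0 < s / 2 by rewrite divr_gt0.
have := integrableZl measurableT (expR (K ^+ 2 / s)) (integrable_gaussn n s20).
move=> iH; apply: le_norm_integrable iH _.
  by apply: measurable_funM; [exact: measurable_poly_enorm|exact: measurable_gaussn].
move=> x; rewrite ger0_norm ?mulr_ge0 ?powR_ge0 ?gaussn_ge0//.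
exact: poly_gaussn_le.
Qed.

Lemma moment_integrable (m K s : R) : - n%:R < m -> 0 <= K -> 0 < s ->
  exists2 C, 0 <= C & forall kappa, 1 <= enorm kappa ->
  mu.-integrable setT (EFin \o (fun eta => (1 + enorm eta) `^ K * enorm (kappa + eta) `^ m * gaussn s eta))
  /\ \int[mu]_eta ((1 + enorm eta) `^ K * enorm (kappa + eta) `^ m * gaussn s eta) <=
    C * enorm kappa `^ m.
Proof.
move=> nm K0 s0; have [C C0 HC] := integral_moment nm K0 s0; exists C => // kappa k1.
apply: ge0_integrable_le (HC kappa k1).
- apply: measurable_funM; last exact: measurable_gaussn.
  apply: measurable_funM; first exact: measurable_poly_enorm.
  exact: measurable_enorm_shift_powR.
- by move=> eta; rewrite !mulr_ge0 ?powR_ge0 ?gaussn_ge0.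
Qed.

(** Freeze the amplitude at [|kappa|^m] and replace [theta] by its linear part [dot y eta]: Fourier
    inversion then gives exactly [mixture k y]. The first replacement costs a multiple of
    [1 / |kappa|], the second a multiple of [eps], both uniformly by the moment bounds. *)
Lemma oscillatory_main_term (k : nat) (m : R) : - n%:R < m ->
  exists2 C : R, 0 <= C & forall kappa y (theta : 'rV[R]_n -> R) (eps : R),
    1 <= enorm kappa -> 0 <= eps -> measurable_fun setT theta ->
    (forall eta, `|theta eta - dot y eta| <= eps * (1 + enorm eta) `^ 4) ->
    mu.-integrable setT (EFin \o
      (fun eta => enorm (kappa + eta) `^ m * (cos (theta eta) * mixture_hat k eta))) /\
    enorm kappa `^ m * ((2 * pi) ^+ n * mixture k y - C * (eps + (enorm kappa)^-1)) <=
    \int[mu]_eta (enorm (kappa + eta) `^ m * (cos (theta eta) * mixture_hat k eta)).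
Proof.
move=> nm; pose s : R := k.+1%:R^-1.
have s0 : 0 < s by rewrite invr_gt0.
have [CW CW0 HW] := mixture_hat_bound k.
have [C0 C00 H0] := moment_integrable nm (lexx 0) s0.
have [C1 C10 H1] := moment_integrable nm ler01 s0.
have i1 := integrable_poly_gaussn ler01 s0.
have i4 := integrable_poly_gaussn (ler0n R 4) s0.
pose I1 := \int[mu]_eta ((1 + enorm eta) `^ 1 * gaussn s eta).
pose I4 := \int[mu]_eta ((1 + enorm eta) `^ 4 * gaussn s eta).
have I10 : 0 <= I1 by apply: Rintegral_ge0 => x _; rewrite mulr_ge0 ?powR_ge0 ?gaussn_ge0.
have I40 : 0 <= I4 by apply: Rintegral_ge0 => x _; rewrite mulr_ge0 ?powR_ge0 ?gaussn_ge0.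
pose Cm := 2 * (`|m| + 1).
have Cm0 : 0 <= Cm by rewrite mulr_ge0// addr_ge0.
exists (CW * I4 + CW * Cm * (I1 + C1)).
  by rewrite addr_ge0 ?mulr_ge0// addr_ge0.
move=> kappa y theta eps k1 eps0 mth hth.
set r := enorm kappa in k1 *; have r0 : 0 < r by lra.
have [i0k _] := H0 kappa k1; have [i1k H1k] := H1 kappa k1.
pose A eta := enorm (kappa + eta) `^ m * (cos (theta eta) * mixture_hat k eta).
pose B eta := r `^ m * (cos (0 + dot y eta) * mixture_hat k eta).
have mcos : measurable_fun setT (fun eta => cos (theta eta)).
  by apply: (measurableT_comp (f := @cos R)) => //; apply: continuous_measurable_fun;
    exact: continuous_cos.
have mA : measurable_fun setT A.
  apply: measurable_funM; first exact: measurable_enorm_shift_powR.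
  by apply: measurable_funM => //; exact: measurable_mixture_hat.
have iA : mu.-integrable setT (EFin \o A).
  apply: le_norm_integrable mA (integrableZl measurableT CW i0k) _ => eta.
  apply: (@le_trans _ _ (enorm (kappa + eta) `^ m * (CW * gaussn s eta))); last first.
    by rewrite powRr0 mul1r mulrCA.
  rewrite !normrM (ger0_norm (powR_ge0 _ _)) ler_wpM2l ?powR_ge0//.
  by apply: le_trans (HW eta); rewrite ler_piMl ?normr_cos_le1.
have mB : measurable_fun setT B.
  apply: measurable_funM => //; apply: measurable_funM; first exact: measurable_cos_dot.
  exact: measurable_mixture_hat.
have iW : mu.-integrable setT (EFin \o (fun eta => cos (0 + dot y eta) * mixture_hat k eta)).
  apply: le_norm_integrable _ (integrableZl measurableT CW (integrable_gaussn n s0)) _.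
    by apply: measurable_funM; [exact: measurable_cos_dot|exact: measurable_mixture_hat].
  move=> eta; rewrite normrM; apply: le_trans (HW eta).
  by rewrite ler_piMl ?normr_cos_le1.
have iB : mu.-integrable setT (EFin \o B) by exact: (integrableZl measurableT (r `^ m) iW).
split=> //.
(* The pointwise error: the first term pays for the phase, the other two for the amplitude, whose
   change [normr_powR_sub1_le] controls by the sum of the two amplitudes. *)
pose D eta := (CW * r `^ m * eps) * ((1 + enorm eta) `^ 4 * gaussn s eta)
  + ((CW * Cm * r^-1 * r `^ m) * ((1 + enorm eta) `^ 1 * gaussn s eta)
  + (CW * Cm * r^-1) * ((1 + enorm eta) `^ 1 * enorm (kappa + eta) `^ m * gaussn s eta)).
have iD1 := integrableZl measurableT (CW * r `^ m * eps) i4.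
have iD2 := integrableZl measurableT (CW * Cm * r^-1 * r `^ m) i1.
have iD3 := integrableZl measurableT (CW * Cm * r^-1) i1k.
have iD23 := integrableD measurableT iD2 iD3.
have iD : mu.-integrable setT (EFin \o D) by exact: (integrableD measurableT iD1 iD23).
have BAD eta : B eta - D eta <= A eta.
  have e0 := enorm_ge0 eta.
  have amp : `|enorm (kappa + eta) `^ m - r `^ m| <=
      Cm * r^-1 * (1 + enorm eta) * (r `^ m + enorm (kappa + eta) `^ m).
    have t0 : 0 <= enorm (kappa + eta) / r by rewrite divr_ge0 ?enorm_ge0 ?ltW.
    have rm0 : 0 <= r `^ m by exact: powR_ge0.
    have E : enorm (kappa + eta) `^ m = r `^ m * (enorm (kappa + eta) / r) `^ m.
      by rewrite -powRM ?(ltW r0)// mulrC divfK ?gt_eqF.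
    have := ler_wpM2l rm0 (normr_powR_sub1_le m t0).
    rewrite -{1}(ger0_norm rm0) -normrM mulrBr mulr1 -E => h; apply: (le_trans h).
    rewrite -/Cm mulrCA mulrDr mulr1 -E ler_wpM2r ?addr_ge0 ?powR_ge0//.
    rewrite -mulrA ler_wpM2l//.
    have -> : enorm (kappa + eta) / r - 1 = r^-1 * (enorm (kappa + eta) - r).
      by field; rewrite gt_eqF.
    rewrite normrM gtr0_norm ?invr_gt0// ler_pM2l ?invr_gt0// ler_norml.
    have h1 := ler_enormD kappa eta; have h2 := ler_enormD (kappa + eta) (- eta).
    rewrite addrK enormN in h2; rewrite -/r in h1 h2.
    by apply/andP; split; lra.
  have ph : `|cos (theta eta) - cos (0 + dot y eta)| <= eps * (1 + enorm eta) `^ 4.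
    by rewrite add0r; apply: le_trans (normr_cosB_le _ _) (hth eta).
  have Wb := HW eta; rewrite -/s in Wb.
  have AB : `|B eta - A eta| <= D eta; last first.
    by have := le_trans (ler_norm _) AB; lra.
  have -> : B eta - A eta = (- r `^ m * (cos (theta eta) - cos (0 + dot y eta))
     - (enorm (kappa + eta) `^ m - r `^ m) * cos (theta eta)) * mixture_hat k eta.
    by rewrite /B /A; ring.
  rewrite normrM.
  have -> : D eta = (r `^ m * (eps * (1 + enorm eta) `^ 4) +
    Cm * r^-1 * (1 + enorm eta) * (r `^ m + enorm (kappa + eta) `^ m)) * (CW * gaussn s eta).
    have e1 : 0 <= 1 + enorm eta by lra.
    by rewrite /D (powRr1 e1); ring.
  apply: ler_pM => //; apply: (le_trans (ler_normB _ _)); apply: lerD.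
    by rewrite normrM normrN (ger0_norm (powR_ge0 _ _)) ler_wpM2l ?powR_ge0.
  rewrite normrM; apply: le_trans amp; rewrite ler_piMr ?normr_cos_le1//.
have iBD := integrableB measurableT iB iD.
apply: le_trans (le_Rintegral measurableT iBD iA (fun eta _ => BAD eta)).
rewrite RintegralB// /B RintegralZl//.
have -> : \int[mu]_eta (cos (0 + dot y eta) * mixture_hat k eta) = (2 * pi) ^+ n * mixture k y.
  by rewrite -Rintegral_cos_mixture_hat; apply: eq_Rintegral => eta _; rewrite add0r.
rewrite /D RintegralD// RintegralD// !RintegralZl// -/I1 -/I4.
rewrite mulrBr lerD2l lerN2.
have ri0 : 0 <= r^-1 by rewrite invr_ge0 ltW.
have h := ler_wpM2l (mulr_ge0 (mulr_ge0 CW0 Cm0) ri0) H1k.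
apply: (le_trans (lerD (lexx _) (lerD (lexx _) h))).
rewrite -subr_ge0 [leRHS](_ : _ =
  r `^ m * (CW * I4 * r^-1) + r `^ m * (CW * Cm * (I1 + C1) * eps)); last by rewrite -/r; ring.
by rewrite addr_ge0 ?mulr_ge0 ?powR_ge0 ?addr_ge0.
Qed.

End mixture.

Section high_frequency.
Context {R : realType} {n : nat}.
Local Notation mu := (lebesgue_rV R n).
Implicit Types (x y xi eta kappa : 'rV[R]_n) (sg : R).

(** [|kappa + eta|^2 = r^2 (1 + u)] with [u = r^-2 (2 d + e^2)], so the tangent bound for the power
    [sg / 2] applies. Its error [u^2] is at most [r^-2 (1 + e)^4], the origin of the exponent [4];
    the part [e^2] of [u] gives a term of the same size, hence the factor [2]. *)
Lemma phase_taylor sg kappa eta : 0 < sg < 1 -> 1 <= enorm kappa ->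
  `|enorm (kappa + eta) `^ sg - enorm kappa `^ sg
     - sg * enorm kappa `^ (sg - 2) * dot kappa eta| <=
  2 * enorm kappa `^ (sg - 2) * (1 + enorm eta) `^ 4.
Proof.
move=> /andP[s0 s1]; set r := enorm kappa => r1; have r0 : 0 < r by lra.
have := enorm_ge0 eta; set e := enorm eta => e0.
set d := dot kappa eta.
have dre : `|d| <= r * e by exact: normr_dot_le.
pose u := r ^- 2 * (2 * d + e ^+ 2).
have E1 : enorm (kappa + eta) ^+ 2 = r ^+ 2 * (1 + u).
  rewrite sqr_enorm dotDl !dotDr (dotC eta kappa) -!sqr_enorm -/r -/e -/d /u.
  by field; rewrite gt_eqF.
have X0 : 0 <= 1 + u.
  by rewrite -(pmulr_rge0 _ (exprn_gt0 2 r0)) -E1 sqr_ge0.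
have t01 : 0 < sg / 2 < 1 by apply/andP; split; lra.
have E2 : enorm (kappa + eta) `^ sg = r `^ sg * (1 + u) `^ (sg / 2).
  have h a : 0 <= a -> a `^ sg = (a ^+ 2) `^ (sg / 2).
    by move=> a0; rewrite -(powR_mulrn 2 a0) -powRrM; congr (_ `^ _); field.
  by rewrite (h _ (enorm_ge0 _)) (h _ (ltW r0)) E1 powRM// sqr_ge0.
have E3 : r `^ (sg - 2) = r `^ sg * r ^- 2.
  rewrite powRD; last by rewrite (gt_eqF r0) implybT.
  by rewrite (powR_invn 2 (ltW r0)).
have T := normr_powR_tangent_le t01 X0.
have rs0 := powR_ge0 r sg.
have ri0 : 0 <= r ^- 2 by rewrite invr_ge0 exprn_ge0 ?ltW.
have D : enorm (kappa + eta) `^ sg - r `^ sg - sg * r `^ (sg - 2) * d =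
  r `^ sg * ((1 + u) `^ (sg / 2) - 1 - sg / 2 * (1 + u - 1))
  + r `^ sg * r ^- 2 * (sg / 2 * e ^+ 2).
  by rewrite E2 E3 /u; field; rewrite gt_eqF.
have e4 : (1 + e) `^ 4 = (1 + e) ^+ 4 by rewrite powR_mulrn//; lra.
have ub : u ^+ 2 <= r ^- 2 * (1 + e) ^+ 4.
  have -> : u ^+ 2 = r ^- 2 * (r^-1 * (2 * d + e ^+ 2)) ^+ 2.
    by rewrite /u; field; rewrite gt_eqF.
  rewrite ler_wpM2l// (_ : (1 + e) ^+ 4 = ((1 + e) ^+ 2) ^+ 2); last by rewrite -exprM.
  rewrite -(real_normK (num_real (_ * _))) ler_pXn2r ?nnegrE ?normr_ge0 ?sqr_ge0//.
  rewrite normrM gtr0_norm ?invr_gt0// ler_pdivrMl//.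
  apply: (@le_trans _ _ (2 * `|d| + e ^+ 2)).
    by apply: (le_trans (ler_normD _ _)); rewrite normrM (ger0_norm (sqr_ge0 e)) (ger0_norm (ler0n R 2)).
  by nra.
rewrite D e4 E3; apply: (le_trans (ler_normD _ _)).
rewrite normrM (ger0_norm rs0) [X in _ + X]ger0_norm; last first.
  by rewrite !mulr_ge0 ?sqr_ge0 ?divr_ge0 ?(ltW s0).
have h1 := ler_wpM2l rs0 (le_trans T (le_trans (_ : _ <= u ^+ 2) ub)).
have {}h1 := h1 _.
have h2 : sg / 2 * e ^+ 2 <= (1 + e) ^+ 4.
  have : 1 <= (1 + e) ^+ 2 by rewrite exprn_ege1//; lra.
  rewrite (_ : (1 + e) ^+ 4 = (1 + e) ^+ 2 * (1 + e) ^+ 2); last by rewrite -exprD.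
  by have := sqr_ge0 e; nra.
have h3 := ler_wpM2l (mulr_ge0 rs0 ri0) h2.
have -> : 2 * (r `^ sg * r ^- 2) * (1 + e) ^+ 4 = r `^ sg * (r ^- 2 * (1 + e) ^+ 4) + r `^ sg * r ^- 2 * (1 + e) ^+ 4 by ring.
apply: lerD h3; apply: h1.
by rewrite addrAC subrr add0r.
Qed.

End high_frequency.

(** * The high-frequency test function *)

Section focusing_packet.
Context {R : realType} {n : nat}.
Local Notation mu := (lebesgue_rV R n).
Implicit Types (x y xi eta : 'rV[R]_n).
Variables (L : nat) (rho m delta : R).
Let sg := 1 - rho.
Local Notation grid := {ffun 'I_n -> 'I_L}.

(* The phases of the wave packets cancel the phase of the symbol at their
   frequencies [delta *: node f], so the operator makes all of them add up near
   the origin. *)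
Definition node (f : grid) : 'rV[R]_n := \row_i (L + f i)%:R.

Definition focus_phase (f : grid) : R := - (enorm (delta *: node f) `^ (1 - rho)).

Definition focus : 'rV[R]_n -> R[i] :=
  wave_packet (fun k : grid * 'I_n.+1 => mix_coef k.2) (fun k => focus_phase k.1)
    (fun k => delta ^+ 2 * mix_rate k.2) (fun k => delta *: node k.1).

Hypothesis d0 : 0 < delta.

Lemma focus_rate_gt0 (k : grid * 'I_n.+1) : 0 < delta ^+ 2 * mix_rate k.2.
Proof. by rewrite mulr_gt0 ?exprn_gt0 ?mix_rate_gt0. Qed.

Lemma schwartz_focus : (0 < n)%N -> schwartz focus.
Proof. by apply: schwartz_wave_packet; exact: focus_rate_gt0. Qed.

(** For a fixed node the sum over the mixture index reassembles one dilate of [mixture_hat]. The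
    free coefficients [c] serve both the integrability and the output of the operator. *)
Lemma focus_amplitude (c : grid -> R) xi :
  \sum_(k : grid * 'I_n.+1) mix_coef k.2 * c k.1 *
    (Num.sqrt (2 * pi / (delta ^+ 2 * mix_rate k.2)) ^+ n *
     gaussn (delta ^+ 2 * mix_rate k.2)^-1 (xi - delta *: node k.1)) =
  \sum_(f : grid) c f * (delta ^- n * mixture_hat n (delta^-1 *: xi - node f)).
Proof.
rewrite -(pair_bigA _ (fun f (j : 'I_n.+1) => mix_coef j * c f *
    (Num.sqrt (2 * pi / (delta ^+ 2 * mix_rate j)) ^+ n *
     gaussn (delta ^+ 2 * mix_rate j)^-1 (xi - delta *: node f))))/=.
apply: eq_bigr => f _; rewrite /mixture_hat !mulr_sumr; apply: eq_bigr => j _.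
have r0 : 0 < mix_rate j :> R by exact: mix_rate_gt0.
set r : R := mix_rate j in r0 *.
have -> : Num.sqrt (2 * pi / (delta ^+ 2 * r)) = delta^-1 * Num.sqrt (2 * pi / r).
  rewrite (_ : 2 * pi / (delta ^+ 2 * r) = (delta^-1) ^+ 2 * (2 * pi / r)); last first.
    by field; rewrite !gt_eqF.
  by rewrite sqrtrM ?sqr_ge0// sqrtr_sqr gtr0_norm ?invr_gt0.
have -> : gaussn (delta ^+ 2 * r)^-1 (xi - delta *: node f) =
    gaussn r^-1 (delta^-1 *: xi - node f).
  rewrite (_ : delta^-1 *: xi - node f = delta^-1 *: (xi - delta *: node f)).
    by rewrite gaussnZ exprVn -invfM (mulrC r).
  by rewrite scalerBr scalerA mulVf ?scale1r ?gt_eqF.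
by rewrite exprMn exprVn; ring.
Qed.

Lemma node_coord (f : grid) i : L%:R <= node f ord0 i <= 2 * L%:R.
Proof.
rewrite mxE -natrM !ler_nat leq_addr/= mul2n -addnn leq_add2l.
exact: ltnW (ltn_ord (f i)).
Qed.

Lemma enorm_node_ge (f : grid) : (0 < n)%N -> L%:R <= enorm (node f).
Proof.
move=> n0; apply: le_trans (normr_coord_le (node f) (Ordinal n0)).
have /andP[h _] := node_coord f (Ordinal n0).
by apply: (le_trans h); exact: ler_norm.
Qed.

Lemma enorm_node_le (f : grid) : enorm (node f) <= Num.sqrt n%:R * (2 * L%:R).
Proof.
apply: enorm_le => i; have /andP[h1 h2] := node_coord f i.
by rewrite ger0_norm//; apply: le_trans h1.
Qed.

Hypothesis n0 : (0 < n)%N.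
Hypothesis L0 : (0 < L)%N.
Hypothesis nm : - n%:R < m.

Lemma node_ge1 (f : grid) : 1 <= enorm (node f).
Proof. by apply: le_trans (enorm_node_ge f n0); rewrite ler1n. Qed.

Lemma focus_cintegrable :
  cintegrable mu (fun xi => oscillating_symbol rho m xi * fourier focus xi).
Proof.
have s0 : 0 < n.+1%:R^-1 :> R by rewrite invr_gt0.
have [CW CW0 HW] := @mixture_hat_bound R n n.
have [C0 C00 H0] := moment_integrable nm (lexx 0) s0.
have di : 0 < delta^-1 by rewrite invr_gt0.
pose g (f : grid) (eta : 'rV[R]_n) := delta `^ m * (delta ^- n * CW) *
  ((1 + enorm eta) `^ 0 * enorm (node f + eta) `^ m * gaussn n.+1%:R^-1 eta).
have ig f : mu.-integrable setT (EFin \o g f).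
  by have [i _] := H0 _ (node_ge1 f); exact: (integrableZl measurableT (delta `^ m * (delta ^- n * CW)) i).
have iga f := integrable_rV_affine (- node f) di (ig f).
have [iH _] := Rintegral_sum (h := fun f xi => g f (delta^-1 *: xi + - node f))
  (index_enum grid) iga.
have Q := @cintegrable_symbol_wave R n _ (fun k : grid * 'I_n.+1 => mix_coef k.2)
  (fun k => focus_phase k.1) _ (fun k => delta *: node k.1) focus_rate_gt0 rho m _ iH.
rewrite /focus; apply: Q => h h1 xi.
rewrite /wave_amplitude (focus_amplitude (fun f => h (focus_phase f))).
rewrite mulrC -(ger0_norm (powR_ge0 _ m)) -normrM mulr_sumr.
apply: (le_trans (ler_norm_sum _ _ _)); apply: ler_sum => f _.
rewrite /g powRr0 mul1r.
have -> : node f + (delta^-1 *: xi - node f) = delta^-1 *: xi by rewrite addrC subrK.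
rewrite !normrM enormZ (gtr0_norm di) (ger0_norm (powR_ge0 _ _)).
rewrite (powRM _ (ltW di) (enorm_ge0 _)).
have -> : delta^-1 `^ m = (delta `^ m)^-1 by rewrite -powRN -(powR_inv1 (ltW d0)) -powRrM mulN1r.
have dm0 : 0 < delta `^ m by rewrite powR_gt0.
have dn0 : 0 < delta ^- n by rewrite invr_gt0 exprn_gt0.
rewrite (gtr0_norm dn0).
have -> : delta `^ m * (delta ^- n * CW) * ((delta `^ m)^-1 * enorm xi `^ m *
     gaussn n.+1%:R^-1 (delta^-1 *: xi - node f)) =
   enorm xi `^ m * (1 * (delta ^- n * (CW * gaussn n.+1%:R^-1 (delta^-1 *: xi - node f)))).
  by move: (gaussn _ _) => G; field; rewrite !gt_eqF// exprn_gt0.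
rewrite ler_wpM2l ?powR_ge0// ler_pM//.
  by rewrite mulr_ge0// ltW.
by rewrite ler_pM2l.
Qed.

(** Total phase of the packet [f] in the output at [x], in the variable
    [xi = delta *: (node f + eta)]. *)
Definition focus_angle (f : grid) x eta : R := focus_phase f +
  (dot x (delta *: (node f + eta)) + enorm (delta *: (node f + eta)) `^ (1 - rho)).

Lemma measurable_focus_angle f x : measurable_fun setT (focus_angle f x).
Proof.
have maff : measurable_fun setT (fun eta : 'rV[R]_n => delta *: (node f + eta)).
  rewrite (_ : (fun eta => _) = (fun eta => delta *: eta + delta *: node f)).
    exact: measurable_rV_affine.
  by apply/funext => eta; rewrite scalerDr addrC.
apply: measurable_funD => //; apply: measurable_funD.
  exact: (measurableT_comp (measurable_dot x) maff).
exact: (measurableT_comp (measurable_enorm_powR (1 - rho)) maff).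
Qed.

Lemma Re_multiplier_focus x :
  (forall f, mu.-integrable setT (EFin \o (fun eta => enorm (node f + eta) `^ m *
     (cos (focus_angle f x eta) * mixture_hat n eta)))) ->
  complex.Re (multiplier_op (oscillating_symbol rho m) focus x) =
  (2 * pi) ^- n * (delta `^ m * \sum_(f : grid) \int[mu]_eta
    (enorm (node f + eta) `^ m * (cos (focus_angle f x eta) * mixture_hat n eta))).
Proof.
move=> iG; have di : 0 < delta^-1 by rewrite invr_gt0.
pose G f eta := enorm (node f + eta) `^ m * (cos (focus_angle f x eta) * mixture_hat n eta).
pose F (f : grid) xi := delta `^ m * delta ^- n * G f (delta^-1 *: xi + - node f).
rewrite /focus Re_multiplier_wave; last exact: focus_rate_gt0.
congr (_ * _).
transitivity (\int[mu]_xi \sum_(f : grid) F f xi).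
  apply: eq_Rintegral => xi _.
  rewrite (focus_amplitude (fun f => cos (focus_phase f + (dot x xi + enorm xi `^ (1 - rho))))).
  rewrite mulr_sumr; apply: eq_bigr => f _; rewrite /F /G /focus_angle.
  have -> : node f + (delta^-1 *: xi - node f) = delta^-1 *: xi by rewrite addrC subrK.
  rewrite scalerA divff ?gt_eqF// scale1r enormZ (gtr0_norm di).
  rewrite (powRM _ (ltW di) (enorm_ge0 _)).
  have -> : delta^-1 `^ m = (delta `^ m)^-1 by rewrite -powRN -(powR_inv1 (ltW d0)) -powRrM mulN1r.
  have dm0 : 0 < delta `^ m by rewrite powR_gt0.
  have dn0 : 0 < delta ^- n by rewrite invr_gt0 exprn_gt0.
  by move: (mixture_hat _ _) (cos _) => M C; field; rewrite !gt_eqF// exprn_gt0.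
have iF f : mu.-integrable setT (EFin \o F f).
  exact: (integrableZl measurableT (delta `^ m * delta ^- n)
    (integrable_rV_affine (- node f) di (iG f))).
rewrite (Rintegral_sum _ iF).2 mulr_sumr; apply: eq_bigr => f _.
rewrite (RintegralZl _ measurableT (integrable_rV_affine (- node f) di (iG f))).
rewrite (Rintegral_rV_affine (- node f) di (iG f)) mulrA; congr (_ * _).
by rewrite exprVn invrK divfK// gt_eqF// exprn_gt0.
Qed.

End focusing_packet.

(** * Lower bound for the operator on the focusing packet *)

Section focus_lower_bound.
Context {R : realType} {n : nat}.
Local Notation mu := (lebesgue_rV R n).
Implicit Types (x y xi eta : 'rV[R]_n).
Variables (rho m : R).
Let sg := 1 - rho.
Hypothesis n0 : (0 < n)%N.
Hypothesis rho01 : 0 < rho < 1.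
Let sqn := Num.sqrt n%:R : R.

Let sqn1 : 1 <= sqn.
Proof. by rewrite -sqrtr1 ler_wsqrtr// ler1n. Qed.

Lemma mixture_ge (k : nat) (lo : R) y : 0 <= lo -> lo <= enorm y <= 1 ->
  expR (- (1 / 2)) * (1 - expR (- (1 / 2 * lo ^+ 2))) ^+ k <= mixture k y.
Proof.
move=> lo0 /andP[h1 h2]; have y0 := enorm_ge0 y.
have g1 : expR (- (1 / 2)) <= gaussn 1 y.
  by rewrite ler_expR lerN2 -sqr_enorm; have := ler_pM y0 y0 h2 h2; rewrite -expr2; lra.
have g2 : gaussn 1 y <= expR (- (1 / 2 * lo ^+ 2)).
  by rewrite ler_expR lerN2 -sqr_enorm; have := ler_pM lo0 lo0 h1 h1; rewrite -!expr2; lra.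
have g3 : 0 <= 1 - expR (- (1 / 2 * lo ^+ 2)).
  by rewrite subr_ge0 -expR0 ler_expR oppr_le0 mulr_ge0 ?sqr_ge0.
rewrite mixtureE; apply: ler_pM; rewrite ?expR_ge0 ?exprn_ge0//.
by apply: lerXn2r; rewrite ?nnegrE//; lra.
Qed.

(** The gradient at [eta = 0] of [|delta (node f + eta)|^sg]. Fourier inversion turns it into the
    point at which the mixture is evaluated. *)
Definition focus_center (L : nat) (delta : R) (f : {ffun 'I_n -> 'I_L}) : 'rV[R]_n :=
  (sg * (delta `^ sg * enorm (@node R n L f) `^ (sg - 2))) *: @node R n L f.

(** [focus_phase] removes the constant term and [focus_center] the linear one. There remain the term
    in [x], of size [eps] because the nodes have size about [L], and the remainder of
    [phase_taylor], where the coupling gives [delta^sg * |node|^(sg - 2) <= 1 / L]. *)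
Lemma focus_angle_near (L : nat) (delta eps : R) (f : {ffun 'I_n -> 'I_L}) x :
  (0 < L)%N -> 0 < delta -> delta `^ sg = L%:R `^ rho ->
  enorm x * (delta * L%:R) <= eps ->
  forall eta, `|focus_angle rho delta f x eta - dot (focus_center delta f) eta| <=
    (eps * (2 * sqn + 1) + 2 * L%:R^-1) * (1 + enorm eta) `^ 4.
Proof.
move=> L0 d0 dL xeps eta.
have [r0 r1] := andP rho01; have s1 : 1 <= sqn := sqn1.
have l1 : 1 <= L%:R :> R by rewrite ler1n.
set l : R := L%:R in l1 dL xeps *.
have k1 := @node_ge1 R n L n0 L0 f; have kge := @enorm_node_ge R n L f n0; have kle := @enorm_node_le R n L f.
rewrite -/l -/sqn in kge kle; set k := enorm (@node R n L f) in k1 kge kle *.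
have e0 := enorm_ge0 eta; set e := enorm eta in e0 *.
have e41 : 1 + e <= (1 + e) `^ 4.
  by rewrite powR_mulrn; [rewrite ler_eXnr//; lra|lra].
have sg01 : 0 < sg < 1 by rewrite /sg; apply/andP; split; lra.
have P := phase_taylor eta sg01 k1; rewrite -/k -/e in P.
have dk : delta `^ sg * k `^ (sg - 2) <= l^-1.
  rewrite dL; apply: (@le_trans _ _ (l `^ rho * l `^ (sg - 2))).
    by rewrite ler_wpM2l ?powR_ge0// ler_powR_npos//; rewrite /sg; lra.
  have l0 : 0 < l by lra.
  rewrite -powRD; last by rewrite (gt_eqF l0) implybT.
  rewrite (_ : rho + (sg - 2) = -1); last by rewrite /sg; ring.
  by rewrite powR_inv1//; lra.
have -> : focus_angle rho delta f x eta - dot (focus_center delta f) eta =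
   delta * dot x (@node R n L f + eta) + delta `^ sg * (enorm (@node R n L f + eta) `^ sg - k `^ sg
     - sg * k `^ (sg - 2) * dot (@node R n L f) eta).
  rewrite /focus_angle /focus_phase /focus_center -/sg !enormZ (gtr0_norm d0).
  rewrite !(powRM _ (ltW d0) (enorm_ge0 _)) dotZr dotZl -/k; ring.
apply: (le_trans (ler_normD _ _)); rewrite [leRHS]mulrDl; apply: lerD.
  rewrite normrM gtr0_norm//.
  have h1 := normr_dot_le x (@node R n L f + eta); have h2 := ler_enormD (@node R n L f) eta.
  rewrite -/k -/e in h2; have x0 := enorm_ge0 x.
  apply: (le_trans (ler_wpM2l (ltW d0) (le_trans h1 (ler_wpM2l x0 h2)))).
  apply: (@le_trans _ _ (eps * (2 * sqn + 1) * (1 + e))); last first.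
    have eps0 : 0 <= eps by apply: le_trans xeps; rewrite !mulr_ge0// ltW.
    by apply: ler_wpM2l => //; apply: mulr_ge0 => //; lra.
  have h3 : k + e <= l * ((2 * sqn + 1) * (1 + e)) by nra.
  have h4 := ler_wpM2l (mulr_ge0 x0 (ltW d0)) h3.
  have h5 : 0 <= (2 * sqn + 1) * (1 + e) by apply: mulr_ge0; lra.
  have h6 := ler_wpM2r h5 xeps.
  have -> : delta * (enorm x * (k + e)) = enorm x * delta * (k + e) by ring.
  apply: (le_trans h4); rewrite -(mulrA eps).
  by apply: le_trans h6; rewrite le_eqVlt; apply/orP; left; apply/eqP; ring.
rewrite normrM (ger0_norm (powR_ge0 _ _)).
apply: (le_trans (ler_wpM2l (powR_ge0 _ _) P)).
have := ler_wpM2r (powR_ge0 (1 + e) 4) (ler_wpM2l (ler0n R 2) dk).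
by apply: le_trans; rewrite le_eqVlt; apply/orP; left; apply/eqP; ring.
Qed.

(** The norm equals [sg * L^rho * |node|^(- rho)], and the nodes have size between [L] and
    [2 * sqn * L]. Thus the coupling of [delta] with [L] places every centre in one fixed annulus,
    where [mixture_ge] applies. *)
Lemma enorm_focus_center (L : nat) (delta : R) (f : {ffun 'I_n -> 'I_L}) :
  (0 < L)%N -> 0 < delta -> delta `^ sg = L%:R `^ rho ->
  sg * (2 * sqn) `^ (- rho) <= enorm (focus_center delta f) <= 1.
Proof.
move=> L0 d0 dL.
have [r0 r1] := andP rho01; have s1 : 1 <= sqn := sqn1.
have l1 : 1 <= L%:R :> R by rewrite ler1n.
set l : R := L%:R in l1 dL *; have l0 : 0 < l by lra.
have k1 := @node_ge1 R n L n0 L0 f; have kge := @enorm_node_ge R n L f n0; have kle := @enorm_node_le R n L f.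
rewrite -/l -/sqn in kge kle.
have sg0 : 0 < sg by rewrite /sg; lra.
rewrite /focus_center enormZ ger0_norm ?mulr_ge0 ?powR_ge0// ?(ltW sg0)//.
set k := enorm (@node R n L f) in k1 kge kle *.
have k0 : 0 < k by lra.
have -> : sg * (delta `^ sg * k `^ (sg - 2)) * k = sg * (l `^ rho * k `^ (- rho)).
  rewrite dL -!mulrA -{2}(powRr1 (ltW k0)) -powRD; last by rewrite (gt_eqF k0) implybT.
  by congr (_ * (_ * powR _ _)); rewrite /sg; ring.
have E a : 0 < a -> l `^ rho * (a * l) `^ (- rho) = a `^ (- rho).
  move=> a0; rewrite powRM ?(ltW a0) ?(ltW l0)// mulrCA -powRD; last by rewrite (gt_eqF l0) implybT.
  by rewrite subrr powRr0 mulr1.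
apply/andP; split.
  rewrite ler_wpM2l ?(ltW sg0)// -E; last by lra.
  by rewrite ler_wpM2l ?powR_ge0// ler_powR_npos//; lra.
have := E 1 ltr01; rewrite mul1r powR1 => E1.
have h : l `^ rho * k `^ (- rho) <= 1.
  by rewrite -E1 ler_wpM2l ?powR_ge0// ler_powR_npos//; lra.
have sg1 : sg <= 1 by rewrite /sg; lra.
have := ler_pM (ltW sg0) (mulr_ge0 (powR_ge0 l rho) (powR_ge0 k (- rho))) sg1 h.
by rewrite mulr1.
Qed.

Lemma sum_node_powR_ge (L : nat) : (0 < L)%N ->
  Num.min 1 ((2 * sqn) `^ m) * L%:R `^ (m + n%:R) <=
  \sum_(f : {ffun 'I_n -> 'I_L}) enorm (@node R n L f) `^ m.
Proof.
move=> L0; have l0 : 0 < L%:R :> R by rewrite ltr0n.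
have s1 : 1 <= sqn := sqn1.
rewrite powRD; last by rewrite (gt_eqF l0) implybT.
rewrite powR_mulrn// -natrX.
have cardE : #|{: {ffun 'I_n -> 'I_L}}| = (L ^ n)%N by rewrite card_ffun !card_ord.
rewrite -cardE mulrA mulr_natr -sumr_const; apply: ler_sum => f _.
have kge := @enorm_node_ge R n L f n0; have kle := @enorm_node_le R n L f.
rewrite -/sqn in kle.
case: (leP 0 m) => m0.
  apply: (@le_trans _ _ (1 * L%:R `^ m)).
    by rewrite ler_wpM2r ?powR_ge0// ge_min lexx.
  by rewrite mul1r; apply: ge0_ler_powR; rewrite ?nnegrE ?enorm_ge0// ltW.
apply: (@le_trans _ _ ((2 * sqn) `^ m * L%:R `^ m)).
  by rewrite ler_wpM2r ?powR_ge0// ge_min lexx orbT.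
rewrite -powRM ?(ltW l0)//; last by lra.
apply: ler_powR_npos; first exact: ltW.
  exact: lt_le_trans l0 kge.
by apply: (le_trans kle); rewrite mulrA (mulrC sqn).
Qed.

Lemma focus_lower : - n%:R < m ->
  exists eps c : R, exists L0 : nat, [/\ 0 < eps, 0 < c, (0 < L0)%N &
  forall (L : nat) (delta : R), (L0 <= L)%N -> 0 < delta ->
    delta `^ sg = L%:R `^ rho -> forall x, enorm x * (delta * L%:R) <= eps ->
    c * (delta `^ m * L%:R `^ (m + n%:R)) <=
    complex.Re (multiplier_op (oscillating_symbol rho m) (@focus R n L rho delta) x)].
Proof.
move=> nm; have [r0 r1] := andP rho01; have s1 : 1 <= sqn := sqn1.
have [C C0 HC] := oscillatory_main_term n nm.
have sg0 : 0 < sg by rewrite /sg; lra.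
pose lo := sg * (2 * sqn) `^ (- rho).
have s20 : 0 < 2 * sqn by lra.
have lo0 : 0 < lo by rewrite mulr_gt0// powR_gt0.
pose c0 := expR (- (1 / 2)) * (1 - expR (- (1 / 2 * lo ^+ 2))) ^+ n.
have c00 : 0 < c0.
  rewrite mulr_gt0 ?expR_gt0// exprn_gt0// subr_gt0 -[ltRHS]expR0 ltr_expR.
  by rewrite oppr_lt0 mulr_gt0// exprn_gt0.
pose p2 := (2 * pi : R) ^+ n.
have p20 : 0 < p2 by rewrite exprn_gt0// mulr_gt0// pi_gt0.
(* Chosen so that the part of the phase error due to [x] costs a quarter of the main term [p2 * c0];
   [C + 1] keeps the denominator positive. *)
pose eps := p2 * c0 / (4 * (C + 1) * (2 * sqn + 1)).
have C1 : 0 < C + 1 by lra.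
have s3 : 0 < 2 * sqn + 1 by lra.
have pc0 : 0 < p2 * c0 by exact: (mulr_gt0 p20 c00).
have eps0 : 0 < eps by apply: divr_gt0 => //; apply: mulr_gt0 => //; exact: mulr_gt0.
(* [3 / L] collects [2 / L] from the Taylor remainder and [1 / |node| <= 1 / L] from the amplitude;
   from [L0] on it costs at most another quarter. *)
pose L0 := (Num.Def.archi_bound (12 * (C + 1) / (p2 * c0))).+1.
have HL0 (L : nat) : (L0 <= L)%N -> 3 * (C + 1) * L%:R^-1 <= p2 * c0 / 4.
  move=> LL; have l0 : 0 < L%:R :> R by rewrite ltr0n (leq_trans _ LL).
  have h : 12 * (C + 1) / (p2 * c0) <= L%:R.
    apply: (@le_trans _ _ L0%:R); last by rewrite ler_nat.
    apply: ltW; apply: (@lt_trans _ _ (Num.Def.archi_bound (12 * (C + 1) / (p2 * c0)))%:R).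
      by apply: archi_boundP; apply: divr_ge0; [lra|exact: ltW].
    by rewrite ltr_nat.
  rewrite (ler_pdivrMr _ _ pc0) in h.
  rewrite ler_pdivrMr//.
  have -> : p2 * c0 / 4 * L%:R = L%:R * (p2 * c0) / 4 by ring.
  by rewrite ler_pdivlMr//; lra.
pose c1 : R := Num.min 1 ((2 * sqn) `^ m).
have c10 : 0 < c1 by rewrite lt_min ltr01 powR_gt0.
exists eps; exists (c0 / 2 * c1); exists L0; split => //; first by apply: mulr_gt0 => //; apply: divr_gt0.
move=> L delta LL d0 dL x xe.
have Lgt0 : (0 < L)%N by apply: leq_trans LL.
have {HL0} HL := HL0 L LL; set li : R := L%:R^-1 in HL.
have li0 : 0 < li by rewrite invr_gt0 ltr0n.
have nearE f := @focus_angle_near L delta eps f x Lgt0 d0 dL xe.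
have eps'0 : 0 <= eps * (2 * sqn + 1) + 2 * li.
  by apply: addr_ge0; apply: mulr_ge0; lra.
have core f := HC _ _ _ _ (@node_ge1 R n L n0 Lgt0 f) eps'0
  (@measurable_focus_angle R n L rho delta f x) (nearE f).
rewrite Re_multiplier_focus//; last by move=> f; have [] := core f.
have term f : p2 * c0 / 2 * enorm (@node R n L f) `^ m <=
    \int[mu]_eta (enorm (node f + eta) `^ m * (cos (focus_angle rho delta f x eta) * mixture_hat n eta)).
  have [_] := core f; apply: le_trans; rewrite mulrC ler_wpM2l ?powR_ge0//.
  have k1 := @node_ge1 R n L n0 Lgt0 f; have kge := @enorm_node_ge R n L f n0.
  have kli : (enorm (@node R n L f))^-1 <= li.
    by rewrite lef_pV2 ?posrE ?ltr0n//; lra.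
  have W := mixture_ge n (ltW lo0) (enorm_focus_center f Lgt0 d0 dL).
  rewrite -/c0 in W.
  have h1 : p2 * c0 <= p2 * mixture n (focus_center delta f) by rewrite ler_pM2l.
  have h2 : C * (eps * (2 * sqn + 1) + 2 * li + (enorm (@node R n L f))^-1) <=
     (C + 1) * (eps * (2 * sqn + 1)) + 3 * (C + 1) * li.
    apply: (@le_trans _ _ (C * (eps * (2 * sqn + 1) + 3 * li))).
      by rewrite ler_wpM2l//; lra.
    have : 0 <= eps * (2 * sqn + 1) by apply: mulr_ge0; lra.
    by nra.
  have h3 : (C + 1) * (eps * (2 * sqn + 1)) = p2 * c0 / 4.
    by rewrite /eps; field; rewrite !gt_eqF//; lra.
  rewrite -/p2 -/li; lra.
have S := sum_node_powR_ge Lgt0; rewrite -/c1 in S.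
have T : p2 * c0 / 2 * (c1 * L%:R `^ (m + n%:R)) <= \sum_(f : {ffun 'I_n -> 'I_L}) \int[mu]_eta
    (enorm (node f + eta) `^ m * (cos (focus_angle rho delta f x eta) * mixture_hat n eta)).
  apply: (@le_trans _ _ (p2 * c0 / 2 * \sum_(f : {ffun 'I_n -> 'I_L}) enorm (@node R n L f) `^ m)).
    by rewrite ler_wpM2l// ltW// divr_gt0// mulr_gt0.
  by rewrite mulr_sumr; apply: ler_sum => f _; exact: term.
have p2i : 0 <= p2^-1 by rewrite invr_ge0 ltW.
have := ler_wpM2l p2i (ler_wpM2l (powR_ge0 delta m) T).
rewrite -/p2; apply: le_trans.
by rewrite le_eqVlt; apply/orP; left; apply/eqP; field; rewrite gt_eqF.
Qed.

End focus_lower_bound.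

(** * Weighted norm of the focusing packet *)

Section focus_upper_bound.
Context {R : realType} {n : nat}.
Local Notation mu := (lebesgue_rV R n).
Implicit Types (x y xi eta : 'rV[R]_n).

(** The one-dimensional row bound for Schur's test, uniform in [a] and [L]. Since [k <= k ^ 2], the
    Gaussian at the integers lies below a geometric sequence. *)
Lemma sum_gauss_lattice : exists2 S : R, 0 <= S & forall a L : nat,
  \sum_(j < L) gauss 1 (a%:R - j%:R) <= S.
Proof.
pose th : R := expR (- (1 / 2)).
have th0 : 0 < th by exact: expR_gt0.
have th1 : th < 1 by rewrite -[ltRHS]expR0 ltr_expR; lra.
have gth (k : nat) : gauss 1 (k%:R : R) <= th ^+ k.
  rewrite /gauss /th -expRM_natl ler_expR mulrN lerN2 mulrC ler_pM2l; last by lra.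
  by rewrite -natrX ler_nat; case: k => [|k]; rewrite ?expn_gt0// expnS leq_pmulr.
(* The value of the sum of [th ^ |a - j|] over all naturals [j]: a finite geometric sum on the left
   of [a] and a full tail on its right. *)
pose U (a : nat) := (1 + th - th ^+ a.+1) / (1 - th).
have t1 : 0 < 1 - th by lra.
have UL a L : \sum_(j < L) gauss 1 (a%:R - j%:R : R) <= U a.
  elim: a L => [|a IH] [|L].
  - by rewrite big_ord0 /U expr1 addrK divr_ge0//; lra.
  - rewrite /U expr1 addrK.
    have := @geometric_le_lim R L.+1 1 th ler01 th0; rewrite gtr0_norm// => /(_ th1).
    apply: le_trans; rewrite /series/= big_mkord; apply: ler_sum => j _.
    by rewrite sub0r mul1r /gauss sqrrN; exact: gth.
  - rewrite big_ord0 divr_ge0 ?(ltW t1)//.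
    have : th ^+ a.+2 <= 1 by rewrite exprn_ile1 ?(ltW th0) ?(ltW th1).
    by lra.
  - rewrite big_ord_recl/= subr0.
    have -> : U a.+1 = th ^+ a.+1 + U a.
      by rewrite /U (exprS _ a.+1); field; rewrite gt_eqF.
    rewrite lerD ?gth//; apply: le_trans (IH L); apply: ler_sum => j _.
    by rewrite le_eqVlt; apply/orP; left; apply/eqP; congr gauss; rewrite /bump/= !mulrS; ring.
exists (2 / (1 - th)); first by rewrite divr_ge0 ?ltW.
move=> a L; apply: (le_trans (UL a L)).
rewrite /U ler_pM2r ?invr_gt0//.
have : 0 <= th ^+ a.+1 by rewrite exprn_ge0 ?ltW.
by lra.
Qed.

(** This is why the envelope has order [n]: for [|y| < 1] one has [1 - g <= |y|], so [(1 - g)^n]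
    absorbs [|y|^s] down to [s = -n]. For [|y| >= 1] the power is at most one. *)
Lemma mixture_powR_le (s : R) y : - n%:R <= s < 0 ->
  mixture n y * enorm y `^ s <= gaussn 1 y.
Proof.
move=> /andP[ns s0]; have g1 := gaussn_le1 y ler01; have g0 := gaussn_ge0 1 y.
rewrite mixtureE -mulrA ler_piMr//.
have [y0|y0] := eqVneq (enorm y) 0.
  by rewrite y0 powR0 ?mulr0// lt_eqF.
have {}y0 : 0 < enorm y by rewrite lt0r y0 enorm_ge0.
have h1 : 1 - gaussn 1 y <= 1 by lra.
have h0 : 0 <= 1 - gaussn 1 y by lra.
have [y1|y1] := leP 1 (enorm y).
  rewrite -[leRHS]mulr1; apply: ler_pM; rewrite ?exprn_ge0 ?powR_ge0 ?exprn_ile1//.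
  by have := ler_powR_npos (ltW s0) ltr01 y1; rewrite powR1.
have h2 : 1 - gaussn 1 y <= enorm y.
  have := expR_ge1Dx (- (1 / 2 * dot y y)); rewrite -/(gaussn 1 y) -sqr_enorm => h.
  have : enorm y ^+ 2 <= enorm y by rewrite expr2 ler_piMr ?ltW.
  by lra.
apply: (@le_trans _ _ (enorm y ^+ n * enorm y `^ s)).
  by rewrite ler_wpM2r ?powR_ge0// lerXn2r ?nnegrE ?enorm_ge0.
rewrite -powR_mulrn ?enorm_ge0// -powRD; last by rewrite (gt_eqF y0) implybT.
have : enorm y `^ (n%:R + s) <= 1 `^ (n%:R + s).
  by apply: ge0_ler_powR; rewrite ?nnegrE ?enorm_ge0 ?(ltW y1)//; lra.
by rewrite powR1.
Qed.

Variables (L : nat) (rho delta : R).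
Local Notation grid := {ffun 'I_n -> 'I_L}.
Local Notation nd f := (@node R n L f).

Definition focus_sum (h : R -> R) x : R :=
  \sum_(f : grid) h (focus_phase rho delta f + dot (delta *: nd f) x).

(** All packets share the envelope [mixture n (delta *: x)]; what remains is a trigonometric sum
    with unimodular coefficients, the object of Schur's test. *)
Lemma focusE x : @focus R n L rho delta x =
  ((focus_sum cos x * mixture n (delta *: x)) +i* (focus_sum sin x * mixture n (delta *: x)))%C.
Proof.
have E (h : R -> R) : \sum_(k : grid * 'I_n.+1) mix_coef k.2 *
    (h (focus_phase rho delta k.1 + dot (delta *: nd k.1) x) * gaussn (delta ^+ 2 * mix_rate k.2) x) =
    focus_sum h x * mixture n (delta *: x).
  rewrite -(pair_bigA _ (fun f (j : 'I_n.+1) => mix_coef j *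
    (h (focus_phase rho delta f + dot (delta *: nd f) x) * gaussn (delta ^+ 2 * mix_rate j) x)))/=.
  rewrite /focus_sum mulr_suml; apply: eq_bigr => f _.
  rewrite /mixture mulr_sumr; apply: eq_bigr => j _.
  by rewrite gaussnZ (mulrC _ (delta ^+ 2)) mulrCA.
by rewrite /focus /wave_packet !E.
Qed.

Definition focus_sqr x : R := focus_sum cos x ^+ 2 + focus_sum sin x ^+ 2.

Lemma focus_sqrE x : focus_sqr x = \sum_(f : grid) \sum_(g : grid)
  cos ((focus_phase rho delta f - focus_phase rho delta g) + dot (delta *: (nd f - nd g)) x).
Proof.
rewrite /focus_sqr !expr2 /focus_sum !mulr_suml -big_split/=; apply: eq_bigr => f _.
rewrite !mulr_sumr -big_split/=; apply: eq_bigr => g _.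
by rewrite -cosB scalerBr dotDl dotNl opprD addrACA.
Qed.

Hypothesis d0 : 0 < delta.

Lemma focus_pointwise (q s : R) x : (0 < L)%N -> 1 <= q <= 2 -> - n%:R <= s < 0 ->
  Normc.normc (@focus R n L rho delta x) `^ q * enorm x `^ (q * s) <=
  delta `^ (- (q * s)) * L%:R `^ (n%:R * q / 2) *
    (gaussn (delta ^+ 2) x * (1 + (L%:R ^- n) * focus_sqr x)).
Proof.
move=> L0 /andP[q1 q2] hs; have l0 : 0 < L%:R :> R by rewrite ltr0n.
have ln0 : 0 < L%:R ^+ n :> R by rewrite exprn_gt0.
have w0 : 0 <= mixture n (delta *: x).
  have g1 := gaussn_le1 (delta *: x) ler01.
  by rewrite mixtureE mulr_ge0 ?gaussn_ge0// exprn_ge0//; lra.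
have Q0 : 0 <= focus_sqr x by rewrite /focus_sqr addr_ge0 ?sqr_ge0.
have -> : Normc.normc (@focus R n L rho delta x) = mixture n (delta *: x) * Num.sqrt (focus_sqr x).
  rewrite focusE /= !exprMn -mulrDl sqrtrM ?addr_ge0 ?sqr_ge0//.
  by rewrite sqrtr_sqr (ger0_norm w0) mulrC.
rewrite powRM ?sqrtr_ge0//.
(* The zero of the envelope absorbs the weight; then [g ^ q <= g], because [g <= 1 <= q], leaves a
   Gaussian that integrates exactly. *)
have E1 : mixture n (delta *: x) `^ q * enorm x `^ (q * s) <= delta `^ (- (q * s)) * gaussn (delta ^+ 2) x.
  rewrite (mulrC q s) powRrM -powRM ?powR_ge0//.
  have h := mixture_powR_le (delta *: x) hs.
  rewrite enormZ (gtr0_norm d0) (powRM _ (ltW d0) (enorm_ge0 _)) mulrCA in h.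
  have ds0 : 0 < delta `^ s by rewrite powR_gt0.
  rewrite -ler_pdivlMl// in h.
  have h2 : (mixture n (delta *: x) * enorm x `^ s) `^ q <= ((delta `^ s)^-1 * gaussn 1 (delta *: x)) `^ q.
    apply: ge0_ler_powR => //; rewrite ?nnegrE ?mulr_ge0 ?powR_ge0 ?gaussn_ge0 ?invr_ge0 ?powR_ge0//.
    by lra.
  apply: (le_trans h2); rewrite powRM ?invr_ge0 ?powR_ge0 ?gaussn_ge0//.
  rewrite -powRN -powRrM mulNr ler_wpM2l ?powR_ge0//.
  have -> : gaussn (delta ^+ 2) x = gaussn 1 (delta *: x) by rewrite gaussnZ mul1r.
  have g01 : 0 < gaussn 1 (delta *: x) <= 1 by rewrite gaussn_gt0 gaussn_le1.
  by have := ge1r_powR g01 q1.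
(* Here [q <= 2] enters, as [u ^ (q / 2) <= 1 + u] with [u = L^-n * focus_sqr x], normalised so that
   its Gaussian mean is bounded. *)
have E2 : Num.sqrt (focus_sqr x) `^ q <= L%:R `^ (n%:R * q / 2) * (1 + (L%:R ^- n) * focus_sqr x).
  have -> : Num.sqrt (focus_sqr x) `^ q = (L%:R ^+ n * (L%:R ^- n * focus_sqr x)) `^ (q / 2).
    rewrite mulrA divff ?gt_eqF// mul1r -powR12_sqrt// -powRrM.
    by congr (_ `^ _); rewrite mulrC.
  have li0 : 0 <= L%:R ^- n * focus_sqr x by rewrite mulr_ge0// invr_ge0 ltW.
  have E3 : (L%:R ^+ n) `^ (q / 2) = L%:R `^ (n%:R * q / 2) :> R.
    by rewrite -(powR_mulrn n (ltW l0)) -powRrM mulrA.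
  rewrite (powRM _ (ltW ln0) li0) E3 ler_wpM2l ?powR_ge0//.
  by apply: powR_le_1D => //; apply/andP; split; lra.
have := ler_pM (mulr_ge0 (powR_ge0 _ _) (powR_ge0 _ _)) (powR_ge0 _ _) E1 E2.
by move=> h; apply: (le_trans _ (le_trans h _)); rewrite le_eqVlt; apply/orP; left;
  apply/eqP; ring.
Qed.

Lemma sum_gaussn_lattice (S : R) (f : grid) :
  (forall a k : nat, \sum_(j < k) gauss 1 (a%:R - j%:R) <= S) ->
  \sum_(g : grid) gaussn 1 (nd f - nd g) <= S ^+ n.
Proof.
move=> HS.
have -> : \sum_(g : grid) gaussn 1 (nd f - nd g) =
    \sum_(g : grid) \prod_i gauss 1 ((f i)%:R - (g i)%:R).
  apply: eq_bigr => g _; rewrite gaussnE; apply: eq_bigr => i _.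
  by rewrite !mxE !natrD; congr gauss; ring.
rewrite -(bigA_distr_bigA (fun i (j : 'I_L) => gauss 1 ((f i)%:R - j%:R))).
rewrite -[X in _ ^+ X](card_ord n) -prodr_const; apply: ler_prod => i _.
by rewrite HS andbT; apply: sumr_ge0 => j _; exact: expR_ge0.
Qed.

(** Each pair of nodes contributes a Gaussian integral of size at most [K * gaussn 1 (nd f - nd g)],
    because the spacing [delta] of the frequencies matches the width [1 / delta] of the Gaussian.
    Every one of the [L^n] rows sums to at most [K * S^n]; the phases enter only through
    [|cos| <= 1]. *)
Lemma integral_focus_sqr (S : R) :
  (forall a k : nat, \sum_(j < k) gauss 1 (a%:R - j%:R) <= S) ->
  mu.-integrable setT (EFin \o (fun x => focus_sqr x * gaussn (delta ^+ 2) x)) /\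
  \int[mu]_x (focus_sqr x * gaussn (delta ^+ 2) x) <=
    Num.sqrt (2 * pi / delta ^+ 2) ^+ n * (L%:R ^+ n * S ^+ n).
Proof.
move=> HS; have d20 : 0 < delta ^+ 2 by rewrite exprn_gt0.
pose h (fg : grid * grid) x := cos ((focus_phase rho delta fg.1 - focus_phase rho delta fg.2)
  + dot (delta *: (nd fg.1 - nd fg.2)) x) * gaussn (delta ^+ 2) x.
have ih fg : mu.-integrable setT (EFin \o h fg) by exact: integrable_cos_gaussn.
have E : (fun x => focus_sqr x * gaussn (delta ^+ 2) x) = (fun x => \sum_fg h fg x).
  apply/funext => x; rewrite focus_sqrE -(pair_bigA _ (fun f g => h (f, g) x))/= mulr_suml.
  by apply: eq_bigr => f _; rewrite mulr_suml.
have [iH vH] := Rintegral_sum (index_enum (grid * grid)%type) ih.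
rewrite E; split; first exact: iH.
rewrite vH -(pair_bigA _ (fun f g => \int[mu]_x h (f, g) x))/=.
have cardE : #|{: grid}| = (L ^ n)%N by rewrite card_ffun !card_ord.
set K := Num.sqrt (2 * pi / delta ^+ 2) ^+ n.
have K0 : 0 <= K by rewrite exprn_ge0 ?sqrtr_ge0.
apply: (@le_trans _ _ (\sum_(f : grid) K * S ^+ n)); last first.
  by rewrite sumr_const cardE -[leLHS]mulr_natl natrX mulrCA.
apply: ler_sum => f _.
apply: le_trans (ler_wpM2l K0 (sum_gaussn_lattice f HS)).
rewrite mulr_sumr; apply: ler_sum => g _.
rewrite /h Rintegral_cos_gaussn//= gaussnZ mulVf ?gt_eqF// -/K -mulrA.
by rewrite ler_piMl ?mulr_ge0 ?gaussn_ge0// (le_trans (ler_norm _)) ?normr_cos_le1.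
Qed.

End focus_upper_bound.

(** The power [delta^(- q s)] comes from rescaling the weight and [delta^(- n)] from the mass of the
    Gaussian. The phases are only bounded, so [C] is uniform in [rho]. *)
Lemma focus_upper (R : realType) (n : nat) (q s : R) :
  1 <= q <= 2 -> - n%:R <= s < 0 ->
  exists2 C : R, 0 <= C & forall (L : nat) (rho delta : R), (0 < L)%N -> 0 < delta ->
  (\int[lebesgue_rV R n]_x (Normc.normc (@focus R n L rho delta x) `^ q * enorm x `^ (q * s))%:E
   <= (C * (delta `^ (- (q * s) - n%:R) * L%:R `^ (n%:R * q / 2)))%:E)%E.
Proof.
move=> hq hs; have [S S0 HS] := @sum_gauss_lattice R.
exists (Num.sqrt (2 * pi) ^+ n * (1 + S ^+ n)).
  by rewrite mulr_ge0 ?addr_ge0 ?exprn_ge0 ?sqrtr_ge0.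
move=> L rho delta L0 d0; have l0 : 0 < L%:R ^+ n :> R by rewrite exprn_gt0 ?ltr0n.
have d20 : 0 < delta ^+ 2 by rewrite exprn_gt0.
have [iQ vQ] := @integral_focus_sqr R n L rho delta d0 S HS.
set K := Num.sqrt (2 * pi / delta ^+ 2) ^+ n in vQ.
pose k := delta `^ (- (q * s)) * L%:R `^ (n%:R * q / 2).
have k0 : 0 <= k by rewrite mulr_ge0 ?powR_ge0.
apply: (@le_trans _ _ (\int[lebesgue_rV R n]_x (k * (gaussn (delta ^+ 2) x +
   L%:R ^- n * (@focus_sqr R n L rho delta x * gaussn (delta ^+ 2) x)))%:E)%E).
  apply: le_ge0_integral => x.
    by rewrite lee_fin mulr_ge0 ?powR_ge0.
  rewrite lee_fin; apply: le_trans (@focus_pointwise R n L rho delta d0 q s x L0 hq hs) _.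
  by rewrite -/k le_eqVlt; apply/orP; left; apply/eqP; ring.
have ig := integrable_gaussn n d20.
have iQ2 := integrableZl measurableT (L%:R ^- n) iQ.
have iT := integrableD measurableT ig iQ2.
have iK := integrableZl measurableT k iT.
rewrite (EFin_Rintegral iK) lee_fin RintegralZl// RintegralD// RintegralZl//.
rewrite Rintegral_gaussn// -/K.
have li0 : 0 <= L%:R ^- n :> R by rewrite invr_ge0 ltW.
have h1 := ler_wpM2l li0 vQ.
have KE : K = Num.sqrt (2 * pi) ^+ n * delta ^- n.
  rewrite /K sqrtrM ?mulr_ge0 ?pi_ge0// exprMn; congr (_ * _).
  by rewrite -exprVn sqrtr_sqr gtr0_norm ?invr_gt0// exprVn.
have DE : delta `^ (- (q * s) - n%:R) = delta `^ (- (q * s)) * delta ^- n.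
  by rewrite powRD ?(gt_eqF d0) ?implybT// powR_invn// ltW.
apply: (le_trans (ler_wpM2l k0 (lerD (lexx K) h1))).
rewrite DE /k KE le_eqVlt; apply/orP; left; apply/eqP.
by field; rewrite !gt_eqF// exprn_gt0.
Qed.

(** * Necessary condition from high frequencies *)

Section high_frequency_necessity.
Context {R : realType}.

Lemma powR_bounded_le0 (e c C : R) (L0 : nat) : 0 < c ->
  (forall L : nat, (L0 <= L)%N -> (0 < L)%N -> c * L%:R `^ e <= C) -> e <= 0.
Proof.
move=> c0 H; rewrite leNgt; apply/negP => e0.
pose D := (`|C| / c + 1) `^ e^-1.
have D1 : 0 < `|C| / c + 1.
  have : 0 <= `|C| / c by rewrite divr_ge0// ltW.
  by lra.
pose N := maxn L0 (Num.Def.archi_bound D).+1.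
have := H N (leq_maxl _ _) (leq_trans (ltn0Sn _) (leq_maxr _ _)).
have DN : D <= N%:R.
  apply: ltW; apply: (lt_le_trans (archi_boundP (powR_ge0 _ _))).
  by rewrite ler_nat; apply: leq_trans (leqnSn _) (leq_maxr _ _).
have : D `^ e <= N%:R `^ e.
  by apply: ge0_ler_powR; rewrite ?nnegrE ?powR_ge0// ltW.
rewrite /D -powRrM mulVf ?gt_eqF// (powRr1 (ltW D1)) => h1 h2.
have := ler_wpM2l (ltW c0) h1; rewrite mulrDr mulr1 mulrCA divff ?gt_eqF// mulr1.
by have := ler_norm C; lra.
Qed.

Lemma high_frequency_bound (n : nat) (rho m p q s : R) :
  (0 < n)%N -> 0 < rho < 1 -> - n%:R < m -> 0 < p -> 1 <= q <= 2 ->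
  - n%:R <= s < 0 ->
  multiplier_bounded (oscillating_symbol rho m : 'rV[R]_n -> R[i])
    q (fun x => enorm x `^ (q * s)) p (fun x => enorm x `^ (p * s)) ->
  m <= n%:R / p - (1 - rho) * n%:R / 2 - rho * n%:R / q + (1 - rho) * s.
Proof.
move=> n0 rho01 nm p0 hq hs Hb.
have [r0 r1] := andP rho01; have [q1 q2] := andP hq; have [ns s0] := andP hs.
have q0 : 0 < q by lra.
have [C C0 HC] := multiplier_bounded_test n0 p0 q0 s0 Hb.
have [eps [c [L0 [eps0 c0 L00 HL]]]] := focus_lower n0 rho01 nm.
have [C' C'0 HU] := focus_upper hq hs.
pose sg := 1 - rho; have sg0 : 0 < sg by rewrite /sg; lra.
(* The coupling solved for [delta], that is [delta = L^tau]. The test boxes then have side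
   [h0 / (delta * L)], the scale on which all packets stay in phase. *)
pose tau := rho / sg.
have sn0 : 0 < 2 * Num.sqrt n%:R :> R by rewrite mulr_gt0// sqrtr_gt0 ltr0n.
pose h0 := eps / (2 * Num.sqrt n%:R).
have h00 : 0 < h0 by rewrite divr_gt0.
pose a := n%:R / p + s.
(* The exponent of [L] on the left of the tested inequality minus that on the right; multiplied by
   [sg] it gives the claim. *)
pose e := tau * m + (m + n%:R) - (tau + 1) * a - (tau * (- (q * s) - n%:R) + n%:R * q / 2) / q.
suff e0 : e <= 0.
  have : sg * e <= 0 by rewrite mulr_ge0_le0// ltW.
  have -> : sg * e = m - (n%:R / p - (1 - rho) * n%:R / 2 - rho * n%:R / q + (1 - rho) * s).
    by rewrite /e /tau /a /sg; field; rewrite -/sg !gt_eqF.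
  by lra.
have k0 : 0 < c * h0 `^ a by rewrite mulr_gt0// powR_gt0.
apply: (@powR_bounded_le0 e _ (C * C' `^ q^-1) L0 k0) => L LL Lgt0.
have l0 : 0 < L%:R :> R by rewrite ltr0n.
set l : R := L%:R in l0 *.
have ld : l != 0 by rewrite gt_eqF.
pose delta := l `^ tau.
have d0 : 0 < delta by rewrite powR_gt0.
have dsg : delta `^ sg = l `^ rho by rewrite /delta -powRrM /tau divfK// gt_eqF.
pose h := h0 * l `^ (- (tau + 1)).
have hgt0 : 0 < h by rewrite mulr_gt0// powR_gt0.
have dl : delta * l = l `^ (tau + 1).
  by rewrite powRD ?ld ?implybT// powRr1// ltW.
have low (x : 'rV[R]_n) : (forall i, h < x ord0 i <= 2 * h) ->
    c * (delta `^ m * l `^ (m + n%:R)) <=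
    Normc.normc (multiplier_op (oscillating_symbol rho m) (@focus R n L rho delta) x).
  move=> hx; apply: le_trans (Re_le_normc _).
  apply: HL => //; rewrite -/l dl.
  have xh : enorm x <= Num.sqrt n%:R * (2 * h).
    by apply: enorm_le => i; have /andP[h1 h2] := hx i; rewrite ger0_norm//; lra.
  apply: (le_trans (ler_wpM2r (powR_ge0 _ _) xh)).
  rewrite le_eqVlt; apply/orP; left; apply/eqP.
  have -> : Num.sqrt n%:R * (2 * h) * l `^ (tau + 1) =
     (2 * Num.sqrt n%:R * h0) * (l `^ (- (tau + 1)) * l `^ (tau + 1)) by rewrite /h; ring.
  by rewrite -powRD ?ld ?implybT// addNr powRr0 mulr1 /h0 mulrC divfK// gt_eqF.
have cl0 : 0 <= c * (delta `^ m * l `^ (m + n%:R)) by rewrite mulr_ge0 ?mulr_ge0 ?powR_ge0// ltW.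
have := HC _ (@schwartz_focus R n L rho delta d0 n0) (@focus_cintegrable R n L rho m delta d0 n0 Lgt0 nm)
  h _ _ hgt0 cl0 low (HU L rho delta Lgt0 d0).
rewrite -/a -/l.
have E1 : c * (delta `^ m * l `^ (m + n%:R)) * h `^ a =
    c * h0 `^ a * l `^ (tau * m + (m + n%:R) - (tau + 1) * a).
  rewrite /h powRM ?powR_ge0 ?(ltW h00)// /delta -!powRrM.
  rewrite (powRD _ (r := tau * m + (m + n%:R))) ?ld ?implybT//.
  rewrite (powRD _ (r := tau * m)) ?ld ?implybT// -mulNr; ring.
have E2 : (C' * (delta `^ (- (q * s) - n%:R) * l `^ (n%:R * q / 2))) `^ q^-1 =
    C' `^ q^-1 * l `^ ((tau * (- (q * s) - n%:R) + n%:R * q / 2) / q).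
  rewrite powRM ?mulr_ge0 ?powR_ge0//; congr (_ * _).
  by rewrite /delta -powRrM -powRD ?ld ?implybT// -powRrM.
rewrite E1 E2 => H.
have lp : 0 < l `^ ((tau * (- (q * s) - n%:R) + n%:R * q / 2) / q) by rewrite powR_gt0.
rewrite -(ler_pM2r lp) -[leLHS]mulrA -powRD ?ld ?implybT//.
by rewrite /e subrK -[leRHS]mulrA.
Qed.

End high_frequency_necessity.

(** * The low-frequency test function *)

Section low_frequency.
Context {R : realType} {n : nat}.
Local Notation mu := (lebesgue_rV R n).
Implicit Types (x y xi eta : 'rV[R]_n).

Section bump.
Variables (J : nat) (delta : R).
Hypothesis d0 : 0 < delta.

(* The Fourier transform of this packet is [delta^-n * mixture J (xi / delta)],
   which vanishes to order [2 * J] at [0] and compensates [enorm xi `^ m]. *)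
Definition bump_packet : 'rV[R]_n -> R[i] :=
  wave_packet (fun j : 'I_J.+1 => mix_coef j / Num.sqrt (2 * pi * mix_rate j) ^+ n)
    (fun=> 0) (fun j => delta ^+ 2 / mix_rate j) (fun=> 0).

Lemma bump_rate_gt0 (j : 'I_J.+1) : 0 < delta ^+ 2 / mix_rate j.
Proof. by rewrite divr_gt0 ?exprn_gt0 ?mix_rate_gt0. Qed.

Lemma schwartz_bump : (0 < n)%N -> schwartz bump_packet.
Proof. by apply: schwartz_wave_packet; exact: bump_rate_gt0. Qed.

Lemma bump_amplitude (c : R) xi :
  \sum_(j < J.+1) mix_coef j / Num.sqrt (2 * pi * mix_rate j) ^+ n * c *
    (Num.sqrt (2 * pi / (delta ^+ 2 / mix_rate j)) ^+ n *
     gaussn (delta ^+ 2 / mix_rate j)^-1 (xi - 0)) =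
  c * (delta ^- n * mixture J (delta^-1 *: xi)).
Proof.
rewrite /mixture !mulr_sumr; apply: eq_bigr => j _.
have r0 : 0 < mix_rate j :> R by exact: mix_rate_gt0.
set r : R := mix_rate j in r0 *; rewrite subr0 gaussnZ.
have -> : Num.sqrt (2 * pi / (delta ^+ 2 / r)) = delta^-1 * Num.sqrt (2 * pi * r).
  rewrite (_ : 2 * pi / (delta ^+ 2 / r) = (delta^-1) ^+ 2 * (2 * pi * r)); last first.
    by field; rewrite !gt_eqF.
  by rewrite sqrtrM ?sqr_ge0// sqrtr_sqr gtr0_norm ?invr_gt0.
have -> : (delta ^+ 2 / r)^-1 = r * delta^-1 ^+ 2 by field; rewrite !gt_eqF.
have s0 : 0 < Num.sqrt (2 * pi * r) by rewrite sqrtr_gt0 mulr_gt0// mulr_gt0// pi_gt0.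
move: (gaussn _ _) => G; rewrite exprMn exprVn.
by field; rewrite !gt_eqF// exprn_gt0.
Qed.

Variable m : R.
Hypothesis mJ : 0 <= m + 2 * J%:R.

Lemma mixture_ge0 y : 0 <= mixture J y.
Proof.
have g1 := gaussn_le1 y ler01.
by rewrite mixtureE mulr_ge0 ?gaussn_ge0// exprn_ge0//; lra.
Qed.

(** [1 - g <= |y|^2] turns [(1 - g)^J] into [|y|^(2 J)], which makes the total exponent nonnegative
    whatever the sign of [m]. *)
Lemma powR_mixture_le y :
  enorm y `^ m * mixture J y <= (1 + enorm y) `^ (m + 2 * J%:R) * gaussn 1 y.
Proof.
have g1 := gaussn_le1 y ler01; have g0 := gaussn_ge0 1 y; have e0 := enorm_ge0 y.
rewrite mixtureE mulrCA mulrC ler_wpM2r//.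
have h0 : 0 <= 1 - gaussn 1 y by lra.
(* At the origin the power [|y|^m] is [0], or [1] when [m = 0], so it is at most one. *)
have [y0|y0] := eqVneq (enorm y) 0.
  rewrite y0 addr0 powR1; apply: mulr_ile1; rewrite ?powR_ge0 ?exprn_ge0//; last first.
    by rewrite exprn_ile1//; lra.
  by rewrite /powR eqxx; case: eqP.
have {}y0 : 0 < enorm y by rewrite lt0r y0 enorm_ge0.
have h2 : 1 - gaussn 1 y <= enorm y ^+ 2.
  have := expR_ge1Dx (- (1 / 2 * dot y y)); rewrite -/(gaussn 1 y) -sqr_enorm => h.
  by have := sqr_ge0 (enorm y); lra.
apply: (@le_trans _ _ (enorm y `^ m * (enorm y ^+ 2) ^+ J)).
  by rewrite ler_wpM2l ?powR_ge0// lerXn2r ?nnegrE ?sqr_ge0.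
rewrite -exprM -powR_mulrn// -powRD; last by rewrite (gt_eqF y0) implybT.
rewrite natrM; apply: ge0_ler_powR; rewrite ?nnegrE//; lra.
Qed.

Lemma integrable_powR_mixture K : 0 <= K ->
  mu.-integrable setT (EFin \o (fun y => (1 + enorm y) `^ K * (enorm y `^ m * mixture J y))).
Proof.
move=> K0; apply: le_norm_integrable _ (integrable_poly_gaussn (addr_ge0 K0 mJ) ltr01) _.
  apply: measurable_funM; first exact: measurable_poly_enorm.
  apply: measurable_funM; first exact: measurable_enorm_powR.
  apply: measurable_sum => j; apply: measurable_funM => //; exact: measurable_gaussn.
move=> y; rewrite ger0_norm ?mulr_ge0 ?powR_ge0 ?mixture_ge0//.
apply: (le_trans (ler_wpM2l (powR_ge0 _ _) (powR_mixture_le y))).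
rewrite mulrA -powRD// (_ : 1 + enorm y != 0) ?implybT// gt_eqF//.
by have := enorm_ge0 y; lra.
Qed.

Variable rho : R.

Lemma bump_cintegrable :
  cintegrable mu (fun xi => oscillating_symbol rho m xi * fourier bump_packet xi).
Proof.
have di : 0 < delta^-1 by rewrite invr_gt0.
have iH := integrable_rV_affine 0 di (integrable_powR_mixture (lexx 0)).
have iH2 := integrableZl measurableT (delta `^ m * delta ^- n) iH.
have Q := @cintegrable_symbol_wave R n 'I_J.+1
  (fun j => mix_coef j / Num.sqrt (2 * pi * mix_rate j) ^+ n) (fun=> 0)
  (fun j => delta ^+ 2 / mix_rate j) (fun=> 0) bump_rate_gt0 rho m _ iH2.
rewrite /bump_packet; apply: Q => g g1 xi.
rewrite /wave_amplitude (bump_amplitude (g 0)) powRr0 mul1r addr0.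
have dn0 : 0 < delta ^- n by rewrite invr_gt0 exprn_gt0.
rewrite enormZ (gtr0_norm di) (powRM _ (ltW di) (enorm_ge0 _)).
have -> : delta^-1 `^ m = (delta `^ m)^-1 by rewrite -powRN -(powR_inv1 (ltW d0)) -powRrM mulN1r.
have dm0 : 0 < delta `^ m by rewrite powR_gt0.
rewrite !normrM (gtr0_norm dn0) (ger0_norm (mixture_ge0 _)).
have -> : delta `^ m * delta ^- n * ((delta `^ m)^-1 * enorm xi `^ m * mixture J (delta^-1 *: xi)) =
  1 * (delta ^- n * mixture J (delta^-1 *: xi) * enorm xi `^ m).
  by move: (mixture _ _) => G; field; rewrite !gt_eqF// exprn_gt0.
rewrite -[leLHS]mulrA ler_wpM2r ?g1// mulr_ge0 ?powR_ge0//.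
by rewrite mulr_ge0 ?mixture_ge0// ltW.
Qed.

Lemma integrable_bump_phase x : mu.-integrable setT (EFin \o (fun eta =>
    cos (dot (delta *: x) eta + enorm (delta *: eta) `^ (1 - rho)) *
      (enorm eta `^ m * mixture J eta))).
Proof.
pose G eta := cos (dot (delta *: x) eta + enorm (delta *: eta) `^ (1 - rho)) *
      (enorm eta `^ m * mixture J eta).
have mG : measurable_fun setT G.
  apply: measurable_funM.
    apply: (measurableT_comp (f := @cos R)).
      by apply: continuous_measurable_fun; exact: continuous_cos.
    apply: measurable_funD; first exact: measurable_dot.
    rewrite (_ : (fun eta => _) = (fun eta => `|delta| `^ (1 - rho) * enorm eta `^ (1 - rho))).
      by apply: measurable_funM => //; exact: measurable_enorm_powR.
    by apply/funext => eta; rewrite enormZ powRM ?enorm_ge0.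
  apply: measurable_funM; first exact: measurable_enorm_powR.
  by apply: measurable_sum => j; apply: measurable_funM => //; exact: measurable_gaussn.
apply: le_norm_integrable mG (integrable_powR_mixture (lexx 0)) _ => eta.
have w0 : 0 <= enorm eta `^ m * mixture J eta by rewrite mulr_ge0 ?powR_ge0 ?mixture_ge0.
rewrite powRr0 mul1r /G normrM (ger0_norm w0).
by apply: ler_piMl => //; exact: normr_cos_le1.
Qed.

Lemma Re_multiplier_bump x :
  complex.Re (multiplier_op (oscillating_symbol rho m) bump_packet x) =
  (2 * pi) ^- n * (delta `^ m * \int[mu]_eta
    (cos (dot (delta *: x) eta + enorm (delta *: eta) `^ (1 - rho)) *
      (enorm eta `^ m * mixture J eta))).
Proof.
have di : 0 < delta^-1 by rewrite invr_gt0.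
pose G eta := cos (dot (delta *: x) eta + enorm (delta *: eta) `^ (1 - rho)) *
      (enorm eta `^ m * mixture J eta).
have iG : mu.-integrable setT (EFin \o G) by exact: integrable_bump_phase.
rewrite /bump_packet Re_multiplier_wave; last exact: bump_rate_gt0.
congr (_ * _).
have iGa := integrable_rV_affine 0 di iG.
transitivity (\int[mu]_xi (delta `^ m * delta ^- n * G (delta^-1 *: xi + 0))).
  apply: eq_Rintegral => xi _.
  under eq_bigr do rewrite add0r.
  rewrite (bump_amplitude (cos (dot x xi + enorm xi `^ (1 - rho)))) addr0 /G.
  have dd : delta / delta = 1 by rewrite divff// gt_eqF.
  have -> : dot (delta *: x) (delta^-1 *: xi) = dot x xi.
    by rewrite dotZl dotZr (mulrA delta) dd mul1r.
  rewrite (scalerA delta) dd scale1r.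
  rewrite enormZ (gtr0_norm di) (powRM m (ltW di) (enorm_ge0 _)).
  have -> : delta^-1 `^ m = (delta `^ m)^-1 by rewrite -powRN -(powR_inv1 (ltW d0)) -powRrM mulN1r.
  have dm0 : 0 < delta `^ m by rewrite powR_gt0.
  by move: (mixture _ _) (cos _) => M C; field; rewrite !gt_eqF// exprn_gt0.
rewrite (RintegralZl _ measurableT iGa) (Rintegral_rV_affine 0 di iG) mulrA; congr (_ * _).
by rewrite exprVn invrK divfK// gt_eqF// exprn_gt0.
Qed.

End bump.

Lemma bump_bound (J : nat) : exists2 C : R, 0 <= C & forall (delta : R) x, 0 < delta ->
  Normc.normc (bump_packet J delta x) <= C * gaussn J.+1%:R^-1 (delta *: x).
Proof.
pose b (j : 'I_J.+1) : R := mix_coef j / Num.sqrt (2 * pi * mix_rate j) ^+ n.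
pose C : R := \sum_j `|b j|.
have C0 : 0 <= C by apply: sumr_ge0.
exists (C + C); first by rewrite addr_ge0.
move=> delta x d0; rewrite /bump_packet /wave_packet.
have bnd (g : R -> R) : (forall u, `|g u| <= 1) ->
    `|\sum_(j < J.+1) b j * (g (0 + dot 0 x) * gaussn (delta ^+ 2 / mix_rate j) x)| <=
    C * gaussn J.+1%:R^-1 (delta *: x).
  move=> g1; apply: (le_trans (ler_norm_sum _ _ _)); rewrite mulr_suml; apply: ler_sum => j _.
  rewrite !normrM ler_wpM2l// (ger0_norm (gaussn_ge0 _ _)).
  apply: le_trans (ler_piMl (gaussn_ge0 _ _) (g1 _)) _.
  rewrite gaussnZ ler_expR lerN2 ler_wpM2r ?dot_ge0// ler_wpM2r ?invr_ge0//.
  rewrite mulrC ler_pM2l ?exprn_gt0// lef_pV2 ?posrE ?ltr0n//.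
  by rewrite ler_nat ltn_ord.
have h1 := bnd _ normr_cos_le1; have h2 := bnd _ normr_sin_le1.
have -> : (C + C) * gaussn J.+1%:R^-1 (delta *: x) =
  C * gaussn J.+1%:R^-1 (delta *: x) + C * gaussn J.+1%:R^-1 (delta *: x) by rewrite mulrDl.
apply: le_trans (lerD h1 h2); move: (\sum_(j < _) _) (\sum_(j < _) _) => A B.
rewrite /= -(@ler_pXn2r _ 2) ?nnegrE ?sqrtr_ge0 ?addr_ge0// sqr_sqrtr ?addr_ge0 ?sqr_ge0//.
rewrite sqrrD !real_normK ?num_real// addrAC lerDl.
by rewrite mulrn_wge0// mulr_ge0.
Qed.

(** Only a Gaussian bound is used for this packet, with no gain at the origin, so the weight itself
    has to be integrable there: hence [- n < q * s]. *)
Lemma bump_integral (J : nat) (q s : R) : 1 <= q -> - n%:R < q * s < 0 ->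
  exists2 C : R, 0 <= C & forall delta, 0 < delta ->
  (\int[mu]_x (Normc.normc (bump_packet J delta x) `^ q * enorm x `^ (q * s))%:E <=
    (C * delta `^ (- (n%:R + q * s)))%:E)%E.
Proof.
move=> q1 hqs; have [C C0 HC] := bump_bound J.
have r0 : 0 < J.+1%:R^-1 :> R by rewrite invr_gt0 ltr0n.
set r : R := J.+1%:R^-1 in HC r0.
have [D HD] := @integral_powR_gaussn R n _ _ hqs r0; have [nqs qs0] := andP hqs.
have mg : measurable_fun setT (fun x => enorm x `^ (q * s) * gaussn r x).
  by apply: measurable_funM; [exact: measurable_enorm_powR|exact: measurable_gaussn].
have g0 x : 0 <= enorm x `^ (q * s) * gaussn r x by rewrite mulr_ge0 ?powR_ge0 ?gaussn_ge0.
have D0 : 0 <= D.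
  by rewrite -lee_fin; apply: le_trans HD; apply: integral_ge0 => x _; rewrite lee_fin.
exists (C `^ q * D) => [|delta d0]; first by rewrite mulr_ge0 ?powR_ge0.
have ds0 : 0 <= delta `^ (- (q * s)) by exact: powR_ge0.
apply: (@le_trans _ _ (\int[mu]_x ((C `^ q * delta `^ (- (q * s)))%:E *
  (enorm (delta *: x + 0) `^ (q * s) * gaussn r (delta *: x + 0))%:E))%E).
  apply: le_ge0_integral => x; first by rewrite lee_fin mulr_ge0 ?powR_ge0.
  rewrite -EFinM lee_fin addr0 enormZ (gtr0_norm d0) (powRM _ (ltW d0) (enorm_ge0 _)).
  have -> : C `^ q * delta `^ (- (q * s)) * (delta `^ (q * s) * enorm x `^ (q * s) * gaussn r (delta *: x)) =
     (C `^ q * gaussn r (delta *: x)) * enorm x `^ (q * s).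
    have dp : 0 < delta `^ (q * s) by rewrite powR_gt0.
    by rewrite powRN; field; rewrite gt_eqF.
  rewrite ler_wpM2r ?powR_ge0//.
  have q0 : 0 <= q by lra.
  have g01 : 0 < gaussn r (delta *: x) <= 1 by rewrite gaussn_gt0 gaussn_le1// ltW.
  apply: (@le_trans _ _ ((C * gaussn r (delta *: x)) `^ q)).
    apply: ge0_ler_powR => //; rewrite ?nnegrE ?mulr_ge0 ?gaussn_ge0//; last exact: HC.
    by case: (bump_packet J delta x) => a b /=; exact: sqrtr_ge0.
  rewrite powRM ?gaussn_ge0// ler_wpM2l ?powR_ge0//.
  exact: ge1r_powR.
rewrite ge0_integralZl//; last 3 first.
- apply/measurable_EFinP.
  exact: (measurableT_comp mg (measurable_rV_affine delta 0)).
- by move=> x _; rewrite lee_fin.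
- by rewrite lee_fin mulr_ge0 ?powR_ge0.
rewrite (@ge0_integral_rV_affine R n delta 0 (fun x => (enorm x `^ (q * s) * gaussn r x)%:E))//; last first.
  exact/measurable_EFinP.
rewrite muleA -EFinM.
apply: (le_trans (lee_wpmul2l _ HD)).
  by rewrite lee_fin !mulr_ge0 ?powR_ge0// invr_ge0 exprn_ge0// ltW.
rewrite -EFinM lee_fin opprD powRD ?(gt_eqF d0) ?implybT// (powR_invn _ (ltW d0)).
by rewrite le_eqVlt; apply/orP; left; apply/eqP; ring.
Qed.

(** The cosine in the output falls below [b0] by at most [eps * (1 + |eta|)] on account of the phase
    of the symbol and as much again on account of [x], whence [2 * eps * B]. The parameter [b0] is
    later [1] when the phase is small, and [cos 1] when [rho = 1] and the phase is constant. *)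
Lemma bump_lower (J : nat) (m : R) : (0 < n)%N -> 0 <= m + 2 * J%:R ->
  exists A B : R, [/\ 0 < A, 0 <= B & forall (rho delta b0 eps : R) x,
    0 < delta -> 
    (forall eta, b0 - eps * (1 + enorm eta) <= cos (enorm (delta *: eta) `^ (1 - rho))) ->
    enorm x * delta <= eps ->
    (2 * pi) ^- n * (delta `^ m * (b0 * A - 2 * eps * B)) <=
    complex.Re (multiplier_op (oscillating_symbol rho m) (bump_packet J delta) x)].
Proof.
move=> n0 mJ.
pose w eta := enorm eta `^ m * mixture J eta.
have w0 eta : 0 <= w eta by rewrite mulr_ge0 ?powR_ge0 ?mixture_ge0.
have iw : mu.-integrable setT (EFin \o w).
  have := integrable_powR_mixture mJ (lexx 0).
  by apply: eq_integrable => // eta _; rewrite /= powRr0 mul1r.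
have i1 := integrable_powR_mixture mJ (@ler01 R).
exists (\int[mu]_eta w eta), (\int[mu]_eta ((1 + enorm eta) `^ 1 * w eta)); split.
- pose sqn := Num.sqrt n%:R : R.
  have sq0 : 0 < sqn by rewrite sqrtr_gt0 ltr0n.
  pose h := (2 * sqn)^-1; have h0 : 0 < h by rewrite invr_gt0 mulr_gt0.
  pose c2 : R := expR (- (1 / 2)) * (1 - expR (- (1 / 2 * h ^+ 2))) ^+ J.
  have c20 : 0 < c2.
    rewrite mulr_gt0 ?expR_gt0// exprn_gt0// subr_gt0 -expR0 ltr_expR oppr_lt0.
    by rewrite mulr_gt0// exprn_gt0.
  pose c1 := Num.min 1 (h `^ m); have c10 : 0 < c1 by rewrite lt_min ltr01 powR_gt0.
  apply: (@lt_le_trans _ _ (c1 * c2 * h ^+ n)).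
    exact: mulr_gt0 (mulr_gt0 c10 c20) (exprn_gt0 n h0).
  rewrite -lee_fin -(EFin_Rintegral iw) EFinM -integral_box// -ge0_integral_rVZl//; last 3 first.
  + by rewrite mulr_ge0// ltW.
  + apply: measurable_prod => i _.
    have mind : measurable_fun setT (\1_`]h, (2 * h)%R]%classic : R -> R).
      exact: measurable_indic.
    exact: (measurableT_comp mind (measurable_rV_coord i)).
  + by move=> x; apply: prodr_ge0.
  apply: le_ge0_integral => x.
    rewrite lee_fin; apply: mulr_ge0; first by rewrite mulr_ge0// ltW.
    by apply: prodr_ge0.
  rewrite lee_fin.
  have [hx|hx] := boolP [forall i, h < x ord0 i <= 2 * h]; last first.
    move: hx; rewrite negb_forall => /existsP[i hi].
    rewrite (bigD1 i)//= indicE memNset ?mul0r ?mulr0 ?w0//.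
    by rewrite /= in_itv/= (negbTE hi).
  have {}hx i : h < x ord0 i <= 2 * h by exact: (forallP hx).
  rewrite big1 ?mulr1; last by move=> i _; rewrite indicE mem_set//= in_itv/=.
  have xp i : `|x ord0 i| = x ord0 i by rewrite gtr0_norm//; have /andP[]:= hx i; lra.
  have xl : h <= enorm x.
    apply: le_trans (normr_coord_le x (Ordinal n0)).
    by rewrite xp ltW//; have /andP[]:= hx (Ordinal n0).
  have xu : enorm x <= 1.
    have -> : 1 = sqn * (2 * h) by rewrite /h; field; rewrite gt_eqF.
    by apply: enorm_le => i; rewrite xp; have /andP[] := hx i.
  apply: ler_pM; rewrite ?(ltW c10) ?(ltW c20)//; last by apply: (mixture_ge J (ltW h0)); rewrite xl xu.
  have x0 : 0 < enorm x by apply: lt_le_trans xl.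
  case: (leP 0 m) => m0.
    apply: (@le_trans _ _ (h `^ m)); first by rewrite ge_min lexx orbT.
    by apply: ge0_ler_powR; rewrite ?nnegrE ?(ltW x0) ?(ltW h0).
  apply: (@le_trans _ _ 1); first by rewrite ge_min lexx.
  by have := ler_powR_npos (ltW m0) x0 xu; rewrite powR1.
- by apply: Rintegral_ge0 => x _; rewrite mulr_ge0 ?powR_ge0.
move=> rho delta b0 eps x d0 hcos hx.
rewrite Re_multiplier_bump//.
have p0 : 0 < (2 * pi) ^- n :> R by rewrite invr_gt0 exprn_gt0// mulr_gt0 ?pi_gt0.
rewrite ler_pM2l// ler_pM2l ?powR_gt0//.
rewrite -RintegralZl// -RintegralZl// -RintegralB//; last 2 first.
- exact: (integrableZl measurableT b0 iw).
- exact: (integrableZl measurableT (2 * eps) i1).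
apply: le_Rintegral => //.
- exact: (integrableB measurableT (integrableZl measurableT b0 iw) (integrableZl measurableT (2 * eps) i1)).
- exact: integrable_bump_phase.
move=> eta _; have e0 := enorm_ge0 eta; have e1 : 0 <= 1 + enorm eta by lra.
rewrite (powRr1 e1) mulrA -mulrBl; apply: ler_wpM2r => //.
apply: (@le_trans _ _ (cos (enorm (delta *: eta) `^ (1 - rho)) - eps * (1 + enorm eta))).
  by have := hcos eta; lra.
set v := enorm _ `^ _; set u := dot _ _.
have h1 := normr_cosB_le v (u + v).
have h2 : `|v - (u + v)| <= eps * (1 + enorm eta).
  rewrite opprD addrCA addrN addr0 normrN.
  apply: (le_trans (normr_dot_le _ _)).
  rewrite enormZ (gtr0_norm d0) (mulrC delta).
  by apply: (le_trans (ler_wpM2r e0 hx)); rewrite ler_wpM2l//;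
    have := le_trans (mulr_ge0 (enorm_ge0 x) (ltW d0)) hx; lra.
by have := le_trans (ler_norm _) (le_trans h1 h2); lra.
Qed.
End low_frequency.

Section low_frequency_necessity.
Context {R : realType}.

(** The constants are uniform in [delta] and [h], which leaves two regimes open: [delta] fixed with
    [h] tending to zero, and [delta] tending to infinity with [delta * h] fixed. *)
Lemma low_frequency_test (n : nat) (rho m p q s b0 : R) :
  (0 < n)%N -> 0 < p -> 1 <= q -> s < 0 -> - n%:R < q * s -> 0 < b0 ->
  multiplier_bounded (oscillating_symbol rho m : 'rV[R]_n -> R[i])
    q (fun x => enorm x `^ (q * s)) p (fun x => enorm x `^ (p * s)) ->
  exists eps c C : R, [/\ 0 < eps, 0 < c & forall delta h : R,
    0 < delta -> 0 < h -> Num.sqrt n%:R * (2 * h) * delta <= eps ->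
    (forall eta : 'rV[R]_n,
      b0 - eps * (1 + enorm eta) <= cos (enorm (delta *: eta) `^ (1 - rho))) ->
    c * (delta `^ m * h `^ (n%:R / p + s)) <= C * delta `^ (- (n%:R + q * s) / q)].
Proof.
move=> n0 p0 q1 s0 nqs b00 Hb.
have q0 : 0 < q by lra.
have qs0 : q * s < 0 by rewrite pmulr_rlt0.
have [J mJ] : exists J : nat, 0 <= m + 2 * J%:R.
  exists (Num.Def.archi_bound `|m|).
  have := archi_boundP (normr_ge0 m); have := ler_norm (- m); rewrite normrN.
  have := normr_ge0 m; move: (Num.Def.archi_bound _)%:R => k h1 h2 h3; lra.
have [C C0 HC] := multiplier_bounded_test n0 p0 q0 s0 Hb.
have [A [B [A0 B0 HL]]] := bump_lower n0 mJ.
have hqs : - n%:R < q * s < 0 by rewrite nqs.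
have [D D0 HU] := bump_integral J q1 hqs.
(* The error [2 * eps * B] then takes at most half of [b0 * A]; the [+ 1] covers [B = 0]. *)
pose eps := b0 * A / (4 * B + 1).
have B41 : 0 < 4 * B + 1 by lra.
have bA : 0 < b0 * A by rewrite mulr_gt0.
have eps0 : 0 < eps by rewrite divr_gt0.
have epsB : 2 * eps * B <= b0 * A / 2.
  have : eps * (4 * B + 1) = b0 * A by rewrite /eps divfK// gt_eqF.
  by lra.
have p20 : 0 < (2 * pi) ^- n :> R by rewrite invr_gt0 exprn_gt0// mulr_gt0 ?pi_gt0.
exists eps, ((2 * pi) ^- n * (b0 * A / 2)), (C * D `^ q^-1); split => //.
  by rewrite mulr_gt0// divr_gt0.
move=> delta h d0 h0 hd hcos.
pose c := (2 * pi) ^- n * (delta `^ m * (b0 * A / 2)).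
have c0 : 0 <= c by rewrite !mulr_ge0 ?powR_ge0// ?ltW// divr_gt0.
have low (x : 'rV[R]_n) : (forall i, h < x ord0 i <= 2 * h) ->
    c <= Normc.normc (multiplier_op (oscillating_symbol rho m) (bump_packet J delta) x).
  move=> hx; apply: le_trans (Re_le_normc _).
  apply: le_trans (HL rho delta b0 eps x d0 hcos _).
    rewrite /c (ler_pM2l p20) ler_pM2l ?powR_gt0//.
    by lra.
  apply: le_trans hd; rewrite ler_pM2r//.
  by apply: enorm_le => i; have /andP[h1 h2] := hx i; rewrite ger0_norm//; lra.
have := HC _ (schwartz_bump J d0 n0) (bump_cintegrable d0 mJ rho) h _ _ h0 c0 low (HU delta d0).
rewrite powRM ?powR_ge0// -(powRrM delta) => H.
rewrite -[leRHS]mulrA; apply: le_trans H.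
by rewrite /c le_eqVlt; apply/orP; left; apply/eqP; ring.
Qed.

(** With [delta] fixed by [delta^sg = eps] the phase stays below [eps * (1 + |eta|)], so the output
    is bounded below on all small boxes near the origin. As the side [h0 / L] shrinks, its power
    [n / p + s] must stay bounded, so this exponent is nonnegative. *)
Lemma low_frequency_bound (n : nat) (rho m p q s : R) :
  (0 < n)%N -> 0 < rho < 1 -> 0 < p -> 1 <= q -> s < 0 -> - n%:R < q * s ->
  multiplier_bounded (oscillating_symbol rho m : 'rV[R]_n -> R[i])
    q (fun x => enorm x `^ (q * s)) p (fun x => enorm x `^ (p * s)) ->
  - s <= n%:R / p.
Proof.
move=> n0 /andP[r0 r1] p0 q1 s0 nqs Hb.
have [eps [c [C [eps0 c0 H]]]] := low_frequency_test n0 p0 q1 s0 nqs ltr01 Hb.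
pose sg := 1 - rho; have sg01 : 0 < sg < 1 by rewrite /sg; apply/andP; split; lra.
have [sg0 sg1] := andP sg01.
pose delta := eps `^ sg^-1; have d0 : 0 < delta by rewrite powR_gt0.
have dsg : delta `^ sg = eps by rewrite -powRrM mulVf ?gt_eqF// powRr1// ltW.
have hcos (eta : 'rV[R]_n) : 1 - eps * (1 + enorm eta) <= cos (enorm (delta *: eta) `^ (1 - rho)).
  have e0 := enorm_ge0 eta.
  rewrite -/sg enormZ (gtr0_norm d0) (powRM _ (ltW d0) e0) dsg.
  have h1 : enorm eta `^ sg <= 1 + enorm eta.
    apply: (@le_trans _ _ ((1 + enorm eta) `^ sg)).
      by apply: ge0_ler_powR; rewrite ?nnegrE ?(ltW sg0)//; lra.
    have e1 : 1 <= 1 + enorm eta by lra.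
    by have := ler_powR e1 (ltW sg1); rewrite powRr1//; lra.
  have := ler_wpM2l (ltW eps0) h1; have t0 : 0 <= eps * enorm eta `^ sg by rewrite mulr_ge0 ?powR_ge0// ltW.
  have := normr_cosB_le 0 (eps * enorm eta `^ sg); rewrite cos0 sub0r normrN (ger0_norm t0).
  have := ler_norm (1 - cos (eps * enorm eta `^ sg)).
  by lra.
have sn0 : 0 < Num.sqrt n%:R :> R by rewrite sqrtr_gt0 ltr0n.
pose h0 := eps / (2 * Num.sqrt n%:R * delta).
have h00 : 0 < h0 by rewrite divr_gt0// !mulr_gt0.
pose a := n%:R / p + s.
suff : - a <= 0 by rewrite /a; lra.
have k0 : 0 < c * (delta `^ m * h0 `^ a) by rewrite mulr_gt0// mulr_gt0// powR_gt0.
apply: (@powR_bounded_le0 R (- a) _ (C * delta `^ (- (n%:R + q * s) / q)) 0%N k0) => L _ L0.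
have l1 : 1 <= L%:R :> R by rewrite ler1n.
set l : R := L%:R in l1 *; have l0 : 0 < l by lra.
have hl0 : 0 < h0 / l by rewrite divr_gt0.
have li : l^-1 <= 1 by rewrite invf_le1.
have := H delta (h0 / l) d0 hl0.
have -> : Num.sqrt n%:R * (2 * (h0 / l)) * delta = eps * l^-1.
  by rewrite /h0; field; rewrite !gt_eqF.
rewrite (ler_piMr (ltW eps0) li) => /(_ isT hcos).
rewrite -/a (powRM _ (ltW h00)) ?invr_ge0 ?(ltW l0)//.
have -> : l^-1 `^ a = l `^ (- a) by rewrite -(powR_inv1 (ltW l0)) -powRrM mulN1r.
by rewrite !mulrA.
Qed.

(** For [rho = 1] the phase is the constant [1], also at the origin since a zeroth power is [1], so
    [b0 = cos 1] works at every scale. With [delta = L] and boxes of side [h0 / L] the contributions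
    of [s] cancel. *)
Lemma bounded_phase_bound (n : nat) (m p q s : R) :
  (0 < n)%N -> 0 < p -> 1 <= q -> s < 0 -> - n%:R < q * s ->
  multiplier_bounded (oscillating_symbol 1 m : 'rV[R]_n -> R[i])
    q (fun x => enorm x `^ (q * s)) p (fun x => enorm x `^ (p * s)) ->
  m <= n%:R / p - n%:R / q.
Proof.
move=> n0 p0 q1 s0 nqs Hb.
have [eps [c [C [eps0 c0 H]]]] := low_frequency_test n0 p0 q1 s0 nqs (@cos1_gt0 R) Hb.
have q0 : 0 < q by lra.
have sn0 : 0 < Num.sqrt n%:R :> R by rewrite sqrtr_gt0 ltr0n.
pose h0 := eps / (2 * Num.sqrt n%:R).
have h00 : 0 < h0 by rewrite divr_gt0// mulr_gt0.
pose a := n%:R / p + s; pose b := - (n%:R + q * s) / q.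
suff : m - a - b <= 0.
  have -> : m - a - b = m - (n%:R / p - n%:R / q) by rewrite /a /b; field; rewrite !gt_eqF.
  by lra.
have k0 : 0 < c * h0 `^ a by rewrite mulr_gt0// powR_gt0.
apply: (@powR_bounded_le0 R _ _ C 0%N k0) => L _ L0.
have l0 : 0 < L%:R :> R by rewrite ltr0n.
set l : R := L%:R in l0 *; have ld : l != 0 by rewrite gt_eqF.
have hl0 : 0 < h0 / l by rewrite divr_gt0.
have := H l (h0 / l) l0 hl0.
have -> : Num.sqrt n%:R * (2 * (h0 / l)) * l = eps.
  by rewrite /h0; field; rewrite !gt_eqF.
rewrite lexx => /(_ isT) H1; have {H1} := H1 _.
rewrite -/a -/b (powRM _ (ltW h00)) ?invr_ge0 ?(ltW l0)// => H1.
have {H1} : c * (l `^ m * (h0 `^ a * l^-1 `^ a)) <= C * l `^ b.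
  apply: H1 => eta; rewrite subrr powRr0 gerBl.
  by rewrite mulr_ge0 ?(ltW eps0)// addr_ge0 ?enorm_ge0.
have -> : l^-1 `^ a = l `^ (- a) by rewrite -(powR_inv1 (ltW l0)) -powRrM mulN1r.
move=> H1; have lb : 0 < l `^ b by rewrite powR_gt0.
rewrite -(ler_pM2r lb) -[leLHS]mulrA -powRD ?ld ?implybT// subrK powRD ?ld ?implybT//.
by apply: le_trans H1; rewrite le_eqVlt; apply/orP; left; apply/eqP; ring.
Qed.

End low_frequency_necessity.

(** * Necessity of the condition *)

Lemma power_weight_necessity (R : realType) (n : nat) (p q gamma m rho : R) :
  (0 < n)%N -> 1 < q -> q <= p -> 1 <= p^-1 + q^-1 -> 1 <= gamma -> 0 < rho <= 1 ->
  (forall s : R, - (n%:R / gamma) < s < 0 ->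
    multiplier_bounded (oscillating_symbol rho m : 'rV[R]_n -> R[i])
      q (fun x => enorm x `^ (q * s)) p (fun x => enorm x `^ (p * s))) ->
  m <= - (n%:R * (1 - rho) * (1 / 2 - 1 / p))
       - rho * n%:R * (1 / q - 1 / p) - n%:R * (1 - rho) / gamma.
Proof.
move=> n0 q1 qp pq gam1 /andP[r0 r1] Hb.
have p0 : 0 < p by lra.
have q0 : 0 < q by lra.
have g0 : 0 < gamma by lra.
have N0 : 0 < n%:R :> R by rewrite ltr0n.
rewrite !div1r; set P := p^-1 in pq *; set Q := q^-1 in pq *.
set g := gamma^-1 in Hb *; set N : R := n%:R in N0 Hb *.
have P0 : 0 < P by rewrite invr_gt0.
have gp : 0 < g <= 1 by rewrite invr_gt0 g0 invf_le1.
have PQ : P <= Q by rewrite lef_pV2.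
have Q1 : Q < 1 by rewrite invf_lt1.
have qQ : q * Q = 1 by rewrite divff// gt_eqF.
have [gg0 gg1] := andP gp.
(* [1 <= P + Q <= 2 * Q] gives [q <= 2]. *)
have q12 : 1 <= q <= 2.
  apply/andP; split; first exact: ltW.
  have : q * (1 / 2) <= q * Q by rewrite ler_pM2l//; lra.
  by rewrite qQ; lra.
have q1' := ltW q1.
have qs (t : R) : t < Q -> - N < q * - (N * t).
  move=> tQ; rewrite mulrN ltrN2 mulrCA -[ltRHS]mulr1 ltr_pM2l// -qQ ltr_pM2l//.
have sg (t : R) : 0 < t < g -> - (N * g) < - (N * t) < 0.
  by move=> /andP[t0 tg]; rewrite ltrN2 oppr_lt0 (ltr_pM2l N0) tg mulr_gt0.
move: r1; rewrite le_eqVlt => /orP[/eqP r1|r1].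
  (* [s = - N * t] must satisfy both [s > - n / gamma] and [q * s > - n], that is [t < g] and
     [t < Q]. *)
  pose t := Num.min g Q / 2.
  have [tm1 tm2] : Num.min g Q <= g /\ Num.min g Q <= Q by rewrite !ge_min !lexx orbT.
  have tm0 : 0 < Num.min g Q by rewrite lt_min gg0; lra.
  have t1 : 0 < t < g by apply/andP; rewrite /t; split; lra.
  have s0 : - (N * t) < 0 by have /andP[] := sg _ t1.
  have tQ : t < Q by rewrite /t; lra.
  have := Hb _ (sg _ t1); rewrite r1 => Hb1.
  have := bounded_phase_bound n0 p0 q1' s0 (qs _ tQ) Hb1.
  by rewrite -/N -/P -/Q; lra.
have gP : g <= P \/ Q <= P.
  apply/orP; rewrite -[_ || _]negbK negb_or -!ltNge; apply/negP => /andP[gP QP].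
  pose t := (P + Num.min g Q) / 2.
  have [tm1 tm2] : Num.min g Q <= g /\ Num.min g Q <= Q by rewrite !ge_min !lexx orbT.
  have tm0 : P < Num.min g Q by rewrite lt_min gP.
  have t1 : 0 < t < g by apply/andP; rewrite /t; split; lra.
  have s0 : - (N * t) < 0 by have /andP[] := sg _ t1.
  have tQ : t < Q by rewrite /t; lra.
  have rho01 : 0 < rho < 1 by rewrite r0.
  have := low_frequency_bound n0 rho01 p0 q1' s0 (qs _ tQ) (Hb _ (sg _ t1)).
  rewrite opprK -/N -/P ler_pM2l// leNgt => /negP; apply.
  by rewrite /t; lra.
(* Here it suffices that the claimed bound is at least [- N]. If [g <= P] the bracket
   [1 / 2 - P + g] is at most [1 / 2]; if [Q <= P] then [P + Q >= 1] gives [P >= 1 / 2], and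
   [g <= 1]. *)
have [mN|mN] := leP m (- N).
  apply: (le_trans mN).
  suff : (1 - rho) * (1 / 2 - P + g) + rho * (Q - P) <= 1.
    move=> /(ler_wpM2l (ltW N0)); rewrite mulr1; lra.
  have s1 : 1 / 2 - P + g <= 1 by case: gP; lra.
  have s2 : (1 - rho) * (1 / 2 - P + g) <= (1 - rho) * 1 by rewrite ler_wpM2l//; lra.
  have s3 : rho * (Q - P) <= rho * 1 by rewrite ler_wpM2l//; lra.
  by lra.
have rho01 : 0 < rho < 1 by rewrite r0.
have HF (t : R) : 0 < t < g -> m <= N * P - (1 - rho) * N / 2 - rho * N * Q - (1 - rho) * (N * t).
  move=> t1; have /andP[h1 h2] := sg _ t1; have /andP[t0 tg] := t1.
  have hs : - N <= - (N * t) < 0.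
    by rewrite h2 andbT lerN2 ger_pMr//; lra.
  by have := high_frequency_bound n0 rho01 mN p0 q12 hs (Hb _ (sg _ t1)); rewrite -/N -/P -/Q mulrN.
suff : m <= N * P - (1 - rho) * N / 2 - rho * N * Q - (1 - rho) * (N * g) by lra.
rewrite leNgt; apply/negP => hm.
pose d := m - (N * P - (1 - rho) * N / 2 - rho * N * Q - (1 - rho) * (N * g)).
have d0 : 0 < d by rewrite subr_gt0.
(* Keeps [t = g - u] inside the open interval while [N * u <= d / 2], less than the supposed excess
   [d]. *)
pose u := Num.min (g / 2) (d / (2 * N)).
have u0 : 0 < u by rewrite lt_min !divr_gt0// mulr_gt0.
have [u1 u2] : u <= g / 2 /\ u <= d / (2 * N) by rewrite !ge_min !lexx orbT.
have t1 : 0 < g - u < g by apply/andP; split; lra.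
have := HF _ t1.
have Nu : N * u <= d / 2.
  have := ler_wpM2l (ltW N0) u2.
  by rewrite (_ : N * (d / (2 * N)) = d / 2)//; field; rewrite gt_eqF.
have h3 : (1 - rho) * (N * u) <= 1 * (N * u).
  by rewrite ler_wpM2r ?mulr_ge0 ?(ltW u0) ?(ltW N0)//; lra.
rewrite -/d in Nu; have dE : d = m - (N * P - (1 - rho) * N / 2 - rho * N * Q - (1 - rho) * (N * g)) by [].
by rewrite mulrBr; lra.
Qed.

(** * Power weights and reverse Hoelder classes *)

Section power_weights.
Context {R : realType} {n : nat}.
Local Notation mu := (lebesgue_rV R n).
Implicit Types (x c : 'rV[R]_n) (l b t : R).

Lemma indic_cube c l :
  \1_(cube c l) = (fun x => \prod_i (\1_(`[c ord0 i, (c ord0 i + l)%R]%classic : set R) (x ord0 i) : R)).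
Proof.
apply/funext => x; rewrite indicE.
have [hx|hx] := boolP [forall i, c ord0 i <= x ord0 i <= c ord0 i + l].
  rewrite mem_set; last by move=> i; exact: (forallP hx).
  by rewrite big1// => i _; rewrite indicE mem_set//= in_itv/=; exact: (forallP hx).
rewrite memNset; last by move=> hc; move/negP : hx; apply; apply/forallP.
move: hx; rewrite negb_forall => /existsP[i hi].
by rewrite (bigD1 i)//= indicE memNset ?mul0r//= in_itv/= (negbTE hi).
Qed.

Lemma measurable_cube c l : measurable (cube c l).
Proof.
have mf : measurable_fun setT (\1_(cube c l) : 'rV[R]_n -> R).
  rewrite indic_cube; apply: measurable_prod => i _.
  have mind : measurable_fun setT (\1_`[c ord0 i, (c ord0 i + l)%R]%classic : R -> R).
    exact: measurable_indic.
  exact: (measurableT_comp mind (measurable_rV_coord i)).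
rewrite (_ : cube c l = setT `&` (\1_(cube c l) : 'rV[R]_n -> R) @^-1` [set 1]).
  by apply: mf.
by rewrite setTI preimage_indic mem_set// memNset//= => /eqP; rewrite eq_sym oner_eq0.
Qed.

Lemma lebesgue_rV_cube c l : 0 <= l -> mu (cube c l) = (l ^+ n)%:E.
Proof.
move=> l0; rewrite -[cube c l]setIT -(integral_indic mu measurableT (measurable_cube c l)).
rewrite indic_cube (@ge0_integral_rV_prod R n (fun i => \1_`[c ord0 i, (c ord0 i + l)%R]) (fun=> l)).
- by rewrite prodr_const card_ord.
- by move=> i; exact: measurable_indic.
- by [].
- move=> i; rewrite integral_indic//= setIT lebesgue_measure_itv/= lte_fin ltrDl.
  case: (ltgtP 0 l) l0 => // [l0|<-] _; last by [].
  by rewrite -EFinB addrC addKr.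
Qed.

Lemma negligible_origin : (0 < n)%N -> mu.-negligible [set (0 : 'rV[R]_n)].
Proof.
move=> n0; pose A := cube (0 : 'rV[R]_n) 0.
exists A; split; first exact: measurable_cube.
  by rewrite lebesgue_rV_cube// expr0n gtn_eqF.
by move=> x /= -> i; rewrite mxE addr0 lexx.
Qed.

Lemma average_cube_le c l (w : 'rV[R]_n -> R) (B : R) : 0 < l ->
  (\int[mu]_(x in cube c l) (w x)%:E <= (B * l ^+ n)%:E)%E ->
  (average (cube c l) w <= B%:E)%E.
Proof.
move=> l0 h; have ln0 : 0 < l ^+ n by rewrite exprn_gt0.
rewrite /average lebesgue_rV_cube ?(ltW l0)// inver gt_eqF//.
have li : (0 <= (l ^+ n)^-1%:E)%E by rewrite lee_fin invr_ge0 ltW.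
apply: le_trans (lee_wpmul2l li h) _.
by rewrite -EFinM lee_fin mulrC mulfK ?gt_eqF.
Qed.

(** The origin is exempted because a negative power of the norm has the conventional value [0]
    there; for [n > 0] it is a null set. *)
Lemma average_cube_ge c l (w : 'rV[R]_n -> R) (u : R) : (0 < n)%N -> 0 < l ->
  measurable_fun setT w -> (forall x, 0 <= w x) -> 0 <= u ->
  (forall x, cube c l x -> x != 0 -> u <= w x) ->
  (u%:E <= average (cube c l) w)%E.
Proof.
move=> n0 l0 mw w0 u0 h; have ln0 : 0 < l ^+ n by rewrite exprn_gt0.
have mQ := measurable_cube c l.
rewrite /average lebesgue_rV_cube ?(ltW l0)// inver gt_eqF//.
have H : (\int[mu]_(x in cube c l) u%:E <= \int[mu]_(x in cube c l) (w x)%:E)%E.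
  apply: ae_ge0_le_integral => //.
  - by move=> x _; rewrite lee_fin.
  - by apply/measurable_EFinP; apply: measurable_funS mw.
  - have [A [mA A0 HA]] := negligible_origin n0.
    exists A; split => // x /= hx; apply: HA => /=; apply: contrapT => /eqP x0.
    by apply: hx => xQ; rewrite lee_fin; apply: h.
rewrite integral_cst// [X in (_ * X <= _)%E](lebesgue_rV_cube c (ltW l0)) in H.
have li : (0 <= (l ^+ n)^-1%:E)%E by rewrite lee_fin invr_ge0 ltW.
apply: le_trans (lee_wpmul2l li H).
by rewrite -!EFinM lee_fin mulrC mulfK ?gt_eqF.
Qed.

Lemma integral_powR_subset_ball b (J a : R) (D : set 'rV[R]_n) :
  (\int[mu]_x (enorm x `^ b * (enorm x <= a)%R%:R)%:E <= (J * a `^ (b + n%:R))%:E)%E ->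
  (forall x, D x -> enorm x <= a) ->
  (\int[mu]_(x in D) (enorm x `^ b)%:E <= (J * a `^ (b + n%:R))%:E)%E.
Proof.
move=> HJ Da; apply: le_trans HJ; rewrite integral_mkcond.
apply: le_ge0_integral => x; rewrite patchE; case: ifPn => [|_].
- by rewrite lee_fin powR_ge0.
- by [].
- by rewrite inE => /Da ->; rewrite mulr1.
- by rewrite lee_fin mulr_ge0 ?powR_ge0.
Qed.

Lemma weight_powR b : - n%:R < b < 0 -> weight (fun x => enorm x `^ b).
Proof.
move=> hb; split; first exact: measurable_enorm_powR.
  by move=> x; exact: powR_ge0.
move=> K /compact_bounded[M [_ HM]].
have [J J0 HJ] := integral_ball_powR hb.
pose a := Num.sqrt n%:R * (`|M| + 1) + 1.
have a0 : 0 < a by rewrite ltr_wpDl// mulr_ge0 ?sqrtr_ge0 ?addr_ge0.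
apply: le_lt_trans (integral_powR_subset_ball (HJ a a0) _) (ltry _) => x Kx.
apply: (@le_trans _ _ (Num.sqrt n%:R * (`|M| + 1))); last by rewrite lerDl.
apply: enorm_le => i.
have M1 : M < `|M| + 1 by have := ler_norm M; lra.
apply: le_trans (HM _ M1 _ Kx); rewrite [leRHS]/Num.norm /= mx_normrE.
by apply/bigmax_geP; right => /=; exists (ord0, i).
Qed.

Lemma enorm_cube_le c l x : 0 < l -> cube c l x ->
  enorm c - Num.sqrt n%:R * l <= enorm x <= enorm c + Num.sqrt n%:R * l.
Proof.
move=> l0 hx; have d : enorm (x - c) <= Num.sqrt n%:R * l.
  apply: enorm_le => i; have /andP[h1 h2] := hx i.
  by rewrite !mxE ger0_norm; lra.
have h1 := ler_enormD c (x - c); have h2 := ler_enormD x (- (x - c)).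
rewrite subrKC in h1; rewrite enormN opprB subrKC in h2.
by apply/andP; split; lra.
Qed.

Lemma reverse_holder_quotient_le t w (Q : set 'rV[R]_n) (u v : R) : 0 < t -> 0 < u -> 0 <= v ->
  (u%:E <= average Q w)%E -> (average Q (fun x => w x `^ t)%R <= v%:E)%E ->
  (reverse_holder_quotient t w Q <= (u^-1 * v `^ t^-1)%:E)%E.
Proof.
move=> t0 u0 v0 hu hv; rewrite /reverse_holder_quotient.
have avg0 (g : 'rV[R]_n -> R) : (forall x, 0 <= g x) -> (0 <= average Q g)%E.
  move=> g0; rewrite /average mule_ge0// ?inve_ge0 ?measure_ge0//.
  by apply: integral_ge0 => x _; rewrite lee_fin.
have A0 : (0 <= average Q (fun x => w x `^ t)%R)%E by apply: avg0 => x; exact: powR_ge0.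
have u0' : (0 <= average Q w)%E by apply: le_trans hu; rewrite lee_fin ltW.
rewrite EFinM; apply: lee_pmul; rewrite ?inve_ge0 ?poweR_ge0//.
  rewrite (inve_ple (x := average Q w)) ?inE ?lee_fin ?invr_ge0 ?(ltW u0)//.
  by rewrite inver invr_eq0 gt_eqF// invrK.
rewrite -poweR_EFin; apply: gt0_ler_poweR => //; first by rewrite invr_ge0 ltW.
  by rewrite in_itv/= leey andbT.
by rewrite in_itv/= leey andbT lee_fin.
Qed.

(** Two kinds of cubes. If [|c| >= 2 * sn * l], then [|x|] lies between [|c| / 2] and [3 / 2 * |c|]
    and the quotient is at most [3^(- b)]. Otherwise the cube lies in the ball of radius
    [r = 3 * sn * l], comparable to its side: the weight is at least [r^b] off the origin, and
    [b * t > - n] bounds the other average by a multiple of [r^(b t)]. *)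
Lemma reverse_holder_powR t b : (0 < n)%N -> b < 0 -> - n%:R < b -> - n%:R < b * t ->
  reverse_holder t (fun x => enorm x `^ b).
Proof.
move=> n0 b0 nb nbt; split; first by apply: weight_powR; rewrite nb.
move=> t1; have t0 : 0 < t by lra.
have hbt : - n%:R < b * t < 0 by rewrite nbt nmulr_rlt0.
have [J J0 HJ] := integral_ball_powR hbt.
have sn0 : 0 < Num.sqrt n%:R :> R by rewrite sqrtr_gt0 ltr0n.
set sn : R := Num.sqrt n%:R in sn0 *.
pose M := Num.max (3 `^ (- b)) ((J * (3 * sn) `^ n%:R) `^ t^-1).
apply: (@le_lt_trans _ _ M%:E); last exact: ltry.
apply: ub_ereal_sup => _ /= [[c l] /= l0 <-].
have mw : measurable_fun setT (fun x : 'rV[R]_n => enorm x `^ b) by exact: measurable_enorm_powR.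
have w0 x : 0 <= enorm x `^ b by exact: powR_ge0.
have xpos x : x != 0 -> 0 < enorm x.
  by move=> x0; rewrite lt0r enorm_ge0 andbT; apply: contra_neq x0; exact: enorm_eq0.
have snl : 0 < sn * l by rewrite mulr_gt0.
have [hc|hc] := leP (2 * (sn * l)) (enorm c).
  have c0 : 0 < enorm c by lra.
  have u0 : 0 < (3 / 2 * enorm c) `^ b by rewrite powR_gt0// mulr_gt0.
  have hu : (((3 / 2 * enorm c) `^ b)%:E <= average (cube c l) (fun x => enorm x `^ b)%R)%E.
    apply: average_cube_ge => // [|x xQ x0]; first exact: ltW.
    have /andP[h1 h2] := enorm_cube_le l0 xQ.
    by apply: ler_powR_npos; rewrite ?xpos ?(ltW b0)//; rewrite -/sn in h2; lra.
  have hv : (average (cube c l) (fun x => (enorm x `^ b) `^ t)%R <= ((1 / 2 * enorm c) `^ (b * t))%:E)%E.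
    apply: average_cube_le => //.
    have mQ := measurable_cube c l.
    rewrite EFinM -(lebesgue_rV_cube c (ltW l0)) -integral_cst//.
    apply: ge0_le_integral => //.
    - by move=> x _; rewrite lee_fin powR_ge0.
    - apply/measurable_EFinP; apply: (@measurable_funS _ _ _ _ setT) => //.
      exact: (measurableT_comp (measurable_powR t) mw).
    move=> x xQ; have /andP[h1 h2] := enorm_cube_le l0 xQ.
    rewrite -/sn in h1.
    rewrite lee_fin -powRrM; apply: ler_powR_npos; [by case/andP: hbt => _ /ltW| |]; lra.
  apply: le_trans (reverse_holder_quotient_le t0 u0 (powR_ge0 _ _) hu hv) _.
  rewrite lee_fin -powRrM mulfK ?gt_eqF// le_max; apply/orP; left.
  have c0' := ltW c0.
  have cb0 : 0 < enorm c `^ b by rewrite powR_gt0.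
  have h30 : 0 < (3 / 2) `^ b :> R by rewrite powR_gt0.
  rewrite (powRM b _ c0')// (powRM b _ c0')//.
  have -> : (1 / 2) `^ b = (3 / 2) `^ b * 3 `^ (- b) :> R.
    have -> : 3 `^ (- b) = 3^-1 `^ b :> R by rewrite -(powR_inv1 (ler0n _ 3)) -powRrM mulN1r.
    by rewrite -powRM ?invr_ge0//; congr (_ `^ _); field.
  by rewrite le_eqVlt; apply/orP; left; apply/eqP; field; rewrite !gt_eqF.
pose r := 3 * sn * l; have r0 : 0 < r by rewrite mulr_gt0// mulr_gt0.
have Qr x : cube c l x -> enorm x <= r.
  by move=> xQ; have /andP[_ h2] := enorm_cube_le l0 xQ; rewrite /r -/sn in h2 *; lra.
have u0 : 0 < r `^ b by rewrite powR_gt0.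
have hu : ((r `^ b)%:E <= average (cube c l) (fun x => enorm x `^ b)%R)%E.
  apply: average_cube_ge => // [|x xQ x0]; first exact: ltW.
  by apply: ler_powR_npos; rewrite ?xpos ?(ltW b0) ?Qr.
pose K := J * (3 * sn) `^ n%:R; have K0 : 0 <= K by rewrite mulr_ge0 ?powR_ge0.
have hv : (average (cube c l) (fun x => (enorm x `^ b) `^ t)%R <= (K * r `^ (b * t))%:E)%E.
  apply: average_cube_le => //.
  under eq_integral do rewrite -powRrM.
  apply: le_trans (integral_powR_subset_ball (HJ r r0) Qr) _.
  rewrite lee_fin powRD ?(gt_eqF r0) ?implybT//.
  rewrite -(powR_mulrn n (ltW l0)) /K {2}/r (powRM _ _ (ltW l0)) ?mulr_ge0 ?(ltW sn0)//.
  by rewrite le_eqVlt; apply/orP; left; apply/eqP; ring.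
apply: le_trans (reverse_holder_quotient_le t0 u0 _ hu hv) _.
  by rewrite mulr_ge0 ?powR_ge0.
rewrite lee_fin powRM ?powR_ge0// -powRrM mulfK ?gt_eqF// le_max; apply/orP; right.
by rewrite mulrCA mulVf ?mulr1 ?gt_eqF.
Qed.

End power_weights.

Lemma hoelder_conjugate_EFin (R : realType) (x : R) : 1 < x ->
  hoelder_conjugate x%:E = (x / (x - 1))%:E.
Proof.
move=> x1; have x0 : 0 < x by lra.
by rewrite /hoelder_conjugate/= eqe gt_eqF// -EFinD inver subr_eq0 gt_eqF.
Qed.

(* Also valid at [r = 1], where the conjugate of [r] is [+oo]. *)
Lemma reverse_holder_exponent (R : realType) (p q r : R) : 1 < q -> 0 < p -> 1 <= r ->
  0 < p^-1 - 1 + r^-1 ->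
  fine ((p / q)%:E * hoelder_conjugate (hoelder_conjugate r%:E / p%:E))%E =
  (p^-1 - 1 + r^-1)^-1 / q.
Proof.
move=> q1 p0 r1 g0; have q0 : 0 < q by lra.
move: r1; rewrite le_eqVlt => /orP[/eqP r1|r1].
  rewrite -r1 hoelder_conjugate1 inver (gt_eqF p0) gt0_mulye ?lte_fin ?invr_gt0//.
  by rewrite hoelder_conjugatey mule1/= invr1 subrK invrK.
have r0 : 0 < r by lra.
have r10 : 0 < r - 1 by lra.
rewrite hoelder_conjugate_EFin// inver (gt_eqF p0) -EFinM.
have E : r + p - r * p = p * r * (p^-1 - 1 + r^-1) by field; rewrite !gt_eqF.
have D0 : 0 < r + p - r * p by rewrite E !mulr_gt0.
rewrite hoelder_conjugate_EFin/=.
  by field; rewrite !gt_eqF ?mulr_gt0//; lra.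
by rewrite ltr_pdivlMr// mul1r ltr_pdivlMr//; lra.
Qed.

Theorem proposition3p3 (R : realType) (n : nat) (p q gamma m rho : R)
    (hn : (0 < n)%N)
    (hq : 1 < q) (hqp : q <= p) (hpq' : (p%:E <= hoelder_conjugate q%:E)%E)
    (hgamma : 1 <= gamma) (hrho : 0 < rho <= 1) :
  let a : 'rV[R]_n -> R[i] := oscillating_symbol rho m in
  ((forall s : R, - (n%:R / gamma) < s < 0 ->
      multiplier_bounded a q (fun x => enorm x `^ (q * s))
                           p (fun x => enorm x `^ (p * s))) ->
   m <= - (n%:R * (1 - rho) * (1 / 2 - 1 / p))
        - rho * n%:R * (1 / q - 1 / p) - n%:R * (1 - rho) / gamma) /\
  (forall r : R, 1 <= r < q ->
   (forall omega : 'rV[R]_n -> R, weight omega ->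
      reverse_holder
        (fine ((p / q)%:E *
               hoelder_conjugate (hoelder_conjugate r%:E / p%:E))%E)
        (fun x => omega x `^ q) ->
      multiplier_bounded a q (fun x => omega x `^ q)
                           p (fun x => omega x `^ p)) ->
   m <= - (n%:R * (1 - rho) * (1 / r - 1 / 2))
        - rho * n%:R * (1 / q - 1 / p)).
Proof.
move=> a; have q0 : 0 < q by lra.
have p0 : 0 < p by lra.
have pq : 1 <= p^-1 + q^-1.
  move: hpq'; rewrite hoelder_conjugate_EFin// lee_fin ler_pdivlMr ?subr_gt0// => h.
  have -> : p^-1 + q^-1 = (p + q) / (p * q) by field; rewrite !gt_eqF.
  by rewrite ler_pdivlMr ?mulr_gt0//; lra.
split; first exact: power_weight_necessity.
move=> r /andP[r1 rq] Hb; have r0 : 0 < r by lra.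
(* Positive because [1 / r > 1 / q >= 1 - 1 / p], and at most [1 / p < 1] because [r >= 1]; hence
   [g^-1] is an admissible [gamma]. *)
pose g := p^-1 - 1 + r^-1.
have qr : q^-1 < r^-1 by rewrite ltf_pV2.
have ri : r^-1 <= 1 by rewrite invf_le1.
have pqi : p^-1 <= q^-1 by rewrite lef_pV2.
have qi : q^-1 < 1 by rewrite invf_lt1.
have g0 : 0 < g by rewrite /g; lra.
have gp : g <= p^-1 by rewrite /g; lra.
have gi1 : 1 <= g^-1 by rewrite invf_ge1//; lra.
have N0 : 0 < n%:R :> R by rewrite ltr0n.
have := @power_weight_necessity R n p q g^-1 m rho hn hq hqp pq gi1 hrho _.
rewrite invrK => H; have {H} : m <= - (n%:R * (1 - rho) * (1 / 2 - 1 / p))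
    - rho * n%:R * (1 / q - 1 / p) - n%:R * (1 - rho) * g; last first.
  by rewrite /g !div1r; lra.
apply: H => s /andP[ns s0].
have Ng : n%:R * g <= n%:R * q^-1 by rewrite ler_pM2l//; lra.
have nsq : - n%:R < s * q.
  have : - (n%:R * q^-1) < s by lra.
  by rewrite -(ltr_pM2r q0) mulNr divfK ?gt_eqF.
have ns1 : - n%:R < s.
  have : n%:R * g <= n%:R * 1 by rewrite ler_pM2l//; lra.
  by lra.
have E (u : R) : (fun x : 'rV[R]_n => (enorm x `^ s) `^ u) = (fun x => enorm x `^ (u * s)).
  by apply/funext => x; rewrite -powRrM mulrC.
have := Hb (fun x => enorm x `^ s); rewrite !E; apply; first by apply: weight_powR; rewrite ns1.
(* The exponent is [g^-1 / q], and [|x|^(q s)] raised to it is [|x|^(s / g)], locally integrable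
   because [s > - n * g]. *)
rewrite reverse_holder_exponent// -/g; apply: reverse_holder_powR => //.
- by rewrite pmulr_rlt0.
- by rewrite mulrC.
have -> : q * s * (g^-1 / q) = s / g by field; rewrite !gt_eqF.
by rewrite ltr_pdivlMr// mulNr.
Qed.
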